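(* Let $k\ge1$ and $n\ge 2k$ be integers, and let $Y_{n,k}$ be the circle quotient Stiefel manifold. With $\zeta_r$, $q$ and $\xi_{k+1}$ as defined in the context, the tangent bundle of $Y_{n,k}$ is described (up to isomorphism of real vector bundles) as $$TY_{n,k}\cong \binom{k}{2}\,\zeta_r\otimes_{\mathbb{R}}\zeta_r\ \oplus\ \bigl(k\,\zeta_r\otimes_{\mathbb{R}} q^*\xi_{k+1}\bigr)\ \oplus\ (k-1)\epsilon,$$ and additionally it satisfies $$TY_{n,k}\oplus\binom{k+1}{2}\,\zeta_r\otimes_{\mathbb{R}}\zeta_r\ \cong\ nk\,\zeta_r\oplus(k-1)\epsilon.$$
   Context: $V_{n,2k}$ is the real Stiefel manifold of orthonormal $2k$-tuples of vectors in $\mathbb{R}^n$. Regard $S^1=SO(2)$ as a subgroup of $SO(2k)$ via the diagonal map into the block-diagonal maximal torus $SO(2)^k\subset SO(2k)$. $SO(2k)$ acts on $V_{n,2k}$ from the right by matrix multiplication, and $Y_{n,k}=V_{n,2k}/S^1$ is the orbit space of the restricted action of $S^1$. This gives a principal bundle $S^1\to V_{n,2k}\to Y_{n,k}$; $\zeta$ denotes the associated complex line bundle over $Y_{n,k}$, and $\zeta_r$ its realification (a real $2$-plane bundle). $F$ is the space of flags $V_0\subset V_1\subset\cdots\subset V_k$ of subspaces of $\mathbb{R}^n$ with $\dim V_i=2i$; equivalently $F=V_{n,2k}/O(2)^k$, with $O(2)^k\subset O(2k)$ block diagonal. $\xi_1,\dots,\xi_{k+1}$ are the canonical real vector bundles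 over $F$: for $1\le j\le k$, $\xi_j$ has rank $2$ and fibre the orthogonal complement of $V_{j-1}$ in $V_j$, and $\xi_{k+1}$ has rank $n-2k$ and fibre the orthogonal complement of $V_k$ in $\mathbb{R}^n$. $q:Y_{n,k}\to F$ is the natural projection $V_{n,2k}/S^1\to V_{n,2k}/O(2)^k$. $\epsilon$ is the trivial real line bundle, and for an integer $a\ge0$ and a bundle $\eta$, $a\eta$ is the $a$-fold Whitney sum of $\eta$ with itself. *)

(* Defs.v *)
From HB Require Import structures.
From mathcomp Require Import all_boot all_order all_algebra.
From mathcomp Require Import all_classical all_reals all_analysis.
From mathcomp Require Import mxtens complex.

Set Implicit Arguments.
Unset Strict Implicit.
Unset Printing Implicit Defensive.

Import Order.TTheory GRing.Theory Num.Theory.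
Import numFieldNormedType.Exports.

Local Open Scope classical_set_scope.
Local Open Scope ring_scope.
Local Open Scope complex_scope.
Local Open Scope quotient_scope.

(** * Vector bundles

  A vector bundle is given in the style of Steenrod by a family of
  trivialisations and its coordinate transformations: [vtrans i j y] is the
  matrix which turns the (column) coordinates in trivialisation [j] of a vector
  of the fibre over [y] into its coordinates in trivialisation [i].  The record
  holds the bare data; [is_vbundle] says that they define a vector bundle.  It
  is part of [bundle_iso], so that an isomorphism can only hold between
  genuine vector bundles. *)

Record vbundle (K : numFieldType) (B : topologicalType) := VBundle {
  vrank : nat;
  vidx : Type;
  vdom : vidx -> set B;
  vtrans : vidx -> vidx -> B -> 'M[K]_vrank
}.

Section Bundles.
Context {K : numFieldType} {B : topologicalType}.
Implicit Types E F : vbundle K B.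

Definition is_vbundle E : Prop :=
  [/\ forall i, open (@vdom _ _ E i),
      forall y, exists i, @vdom _ _ E i y,
      forall i j y, @vdom _ _ E i y -> @vdom _ _ E j y ->
        {for y, continuous (@vtrans _ _ E i j)},
      forall i y, @vdom _ _ E i y -> @vtrans _ _ E i i y = 1%:M
    & forall i j l y, @vdom _ _ E i y -> @vdom _ _ E j y -> @vdom _ _ E l y ->
        @vtrans _ _ E i j y *m @vtrans _ _ E j l y = @vtrans _ _ E i l y].

(* A morphism over the identity of [B], by its matrices in all pairs of
   trivialisations of the source [E] and the target [F]. *)
Definition bundle_map E F
    (h : vidx F -> vidx E -> B -> 'M[K]_(vrank F, vrank E)) : Prop :=
  (forall i j y, vdom i y -> vdom j y -> {for y, continuous (h i j)}) /\
  (forall i i' j j' y, vdom i y -> vdom i' y -> vdom j y -> vdom j' y ->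
     h i' j' y = vtrans i' i y *m h i j y *m vtrans j j' y).

Definition bundle_iso E F : Prop :=
  [/\ is_vbundle E, is_vbundle F &
      exists h h', [/\ @bundle_map E F h, @bundle_map F E h' &
        forall i j y, vdom i y -> vdom j y ->
          h' j i y *m h i j y = 1%:M /\ h i j y *m h' j i y = 1%:M]].

Definition trivial_bundle (r : nat) : vbundle K B :=
  @VBundle K B r unit (fun=> setT) (fun _ _ _ => 1%:M).

Definition whitney E F : vbundle K B :=
  @VBundle K B (vrank E + vrank F) (vidx E * vidx F)
    (fun i => vdom i.1 `&` vdom i.2)
    (fun i j y => block_mx (vtrans i.1 j.1 y) 0 0 (vtrans i.2 j.2 y)).

Definition tensor E F : vbundle K B :=
  @VBundle K B (vrank E * vrank F) (vidx E * vidx F)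
    (fun i => vdom i.1 `&` vdom i.2)
    (fun i j y => tensmx (vtrans i.1 j.1 y) (vtrans i.2 j.2 y)).

Definition multiple (a : nat) E : vbundle K B :=
  iter a (whitney E) (trivial_bundle 0).

End Bundles.

Definition pullback (K : numFieldType) (B B' : topologicalType) (f : B' -> B)
    (E : vbundle K B) : vbundle K B' :=
  @VBundle K B' (vrank E) (vidx E) (fun i => f @^-1` vdom i)
    (fun i j y => vtrans i j (f y)).

Definition rot90 (R : rcfType) : 'M[R]_2 :=
  @block_mx R 1 1 1 1 0 (- 1%:M) 1%:M 0.

(* The matrix of the realification of a complex-linear map, in the real
   coordinates Re z_1, Im z_1, Re z_2, Im z_2, etc. *)
Definition realify_mx (R : rcfType) (r : nat) (A : 'M[R[i]]_r) : 'M[R]_(r * 2) :=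
  tensmx (map_mx (@complex.Re R) A) 1%:M +
  tensmx (map_mx (@complex.Im R) A) (rot90 R).

Definition realification (R : realType) (B : topologicalType)
    (E : vbundle R[i] B) : vbundle R B :=
  @VBundle R B (vrank E * 2) (vidx E) (@vdom _ _ E)
    (fun i j y => realify_mx (vtrans i j y)).

(** ** Subbundles of trivial bundles *)

Section Subbundle.
Context {R : realType} {B : topologicalType} (N r : nat).
Variable fib : B -> set 'cV[R]_N.

Record local_frame := LocalFrame {
  frame_dom : set B;
  frame :> B -> 'M[R]_(N, r);
  frame_open : open frame_dom;
  frame_continuous : forall y, frame_dom y -> {for y, continuous frame};
  frame_orthonormal : forall y, frame_dom y -> (frame y)^T *m frame y = 1%:M;
  frame_span : forall y, frame_dom y ->
    forall x, fib y x <-> exists c : 'cV[R]_r, x = frame y *m c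
}.

Definition subbundle : vbundle R B :=
  @VBundle R B r local_frame frame_dom (fun e e' y => (e y)^T *m e' y).

End Subbundle.

(** * Smooth functions, manifolds and tangent bundles *)

Section Smooth.
Context {R : realType} {V : normedModType R}.

Fixpoint Ck (m : nat) (O : set V) (f : V -> R) : Prop :=
  if m is m'.+1 then
    (forall x, O x -> differentiable f x) /\
    (forall v, Ck m' O (fun x => 'd f x v))
  else forall x, O x -> {for x, continuous f}.

Definition smooth (O : set V) (f : V -> R) : Prop := forall m, Ck m O f.

End Smooth.

(* A functional structure (in the sense of Bredon) says which functions are
   smooth on each open set; the values outside of the open set are junk. *)
Definition fstruct (R : realType) (B : topologicalType) :=
  set B -> (B -> R) -> Prop.

Section Tangent.
Context {R : realType} {B : topologicalType} (C : fstruct R B) (d : nat).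

(* Charts are the isomorphisms of functionally structured spaces from an open
   subset onto an open subset of R^d. *)
Record chart := Chart {
  chart_dom : set B;
  chart_map :> B -> 'rV[R]_d;
  chart_inv : 'rV[R]_d -> B;
  chart_dom_open : open chart_dom;
  chart_im_open : open (chart_map @` chart_dom);
  chartK : forall y, chart_dom y -> chart_inv (chart_map y) = y;
  chart_continuous : forall y, chart_dom y -> {for y, continuous chart_map};
  chart_inv_continuous : forall x, (chart_map @` chart_dom) x ->
    {for x, continuous chart_inv};
  chart_smooth : forall (W : set B) (f : B -> R), open W -> W `<=` chart_dom ->
    (C W f <-> smooth (chart_map @` W) (f \o chart_inv))
}.

(* The Jacobian ['J f x] of the library acts on row vectors on the right. *)
Definition tangent_bundle : vbundle R B :=
  @VBundle R B d chart chart_dom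
    (fun phi psi y => ('J (phi \o chart_inv psi) (psi y))^T).

End Tangent.

(** * Stiefel manifolds and their orbit spaces *)

Section Stiefel.
Context {R : realType}.

(* The m-tuple of vectors is the tuple of the columns of the matrix. *)
Definition stiefel (n m : nat) : Type :=
  set_type [set v : 'M[R]_(n, m) | v^T *m v = 1%:M].
HB.instance Definition _ n m := Topological.on (stiefel n m).

Definition stiefel_fstruct (n m : nat) : fstruct R (stiefel n m) :=
  fun O f => forall v, O v -> exists (W : set 'M[R]_(n, m)) F,
    [/\ open W, W (\val v), smooth W F &
        forall u, O u -> W (\val u) -> F (\val u) = f u].

Record osubgroup (m : nat) := OSubgroup {
  oset : set 'M[R]_m;
  oset1 : oset 1%:M;
  osetM : forall g h, oset g -> oset h -> oset (g *m h);
  osetV : forall g, oset g -> oset g^T;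
  osetO : forall g, oset g -> g^T *m g = 1%:M
}.

Section Orbits.
Variables (n m : nat) (G : osubgroup m).

Definition same_orbit (v w : stiefel n m) : bool :=
  `[< exists2 g, oset G g & \val w = \val v *m g >].

Lemma same_orbit_refl : reflexive same_orbit.
Proof. by move=> v; apply/asboolP; exists 1%:M; [exact: oset1|rewrite mulmx1]. Qed.

Lemma same_orbit_imp v w : same_orbit v w -> same_orbit w v.
Proof.
move=> /asboolP[g Gg wE]; apply/asboolP; exists g^T; first exact: osetV.
by rewrite wE -mulmxA (mulmx1C (osetO Gg)) mulmx1.
Qed.

Lemma same_orbit_sym : symmetric same_orbit.
Proof. by move=> v w; apply/idP/idP; exact: same_orbit_imp. Qed.

Lemma same_orbit_trans : transitive same_orbit.
Proof.
move=> v u w /asboolP[g Gg vE] /asboolP[h Gh wE]; apply/asboolP.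
by exists (g *m h); [exact: osetM|rewrite wE vE mulmxA].
Qed.

Definition same_orbit_equiv : equiv_rel (stiefel n m) :=
  EquivRel same_orbit same_orbit_refl same_orbit_sym same_orbit_trans.

Definition orbit_space : Type := quotient_topology {eq_quot same_orbit_equiv}.
HB.instance Definition _ := Topological.on orbit_space.
HB.instance Definition _ := Quotient.on orbit_space.

Definition orbit_proj : stiefel n m -> orbit_space := \pi_orbit_space.

(* The quotient smooth structure. *)
Definition orbit_fstruct : fstruct R orbit_space :=
  fun O f => stiefel_fstruct (orbit_proj @^-1` O) (f \o orbit_proj).

Record local_section := LocalSection {
  section_dom : set orbit_space;
  section :> orbit_space -> stiefel n m;
  section_open : open section_dom;
  section_continuous : forall y, section_dom y -> {for y, continuous section};
  sectionK : forall y, section_dom y -> orbit_proj (section y) = y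
}.

End Orbits.

Definition O2 : set 'M[R]_2 := [set r | r^T *m r = 1%:M].
Definition SO2 : set 'M[R]_2 := [set r | r^T *m r = 1%:M /\ \det r = 1].

Lemma O2_1 : O2 1%:M.
Proof. by rewrite /O2 /= trmx1 mulmx1. Qed.

Lemma O2_M g h : O2 g -> O2 h -> O2 (g *m h).
Proof.
rewrite /O2 /= => gO hO.
by rewrite trmx_mul mulmxA -(mulmxA _ g^T) gO mulmx1.
Qed.

Lemma O2_V g : O2 g -> O2 g^T.
Proof. by rewrite /O2 /= trmxK => /mulmx1C. Qed.

(* [diag_circle r] is the block diagonal matrix with k blocks equal to r, and
   [diag_blocks r] the one with blocks r 0, r 1, up to r (k - 1). *)
Definition diag_circle (k : nat) (r : 'M[R]_2) : 'M[R]_(k * 2) :=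
  tensmx 1%:M r.

Definition diag_blocks (k : nat) (r : 'I_k -> 'M[R]_2) : 'M[R]_(k * 2) :=
  \sum_(i < k) tensmx (delta_mx i i) (r i).

Lemma diag_circle1 k : diag_circle k 1%:M = 1%:M.
Proof.
apply/matrixP => i j.
case: (mxtens_indexP i) => a b; case: (mxtens_indexP j) => a' b'.
rewrite tensmxE !mxE -natrM mulnb; congr (nat_of_bool _)%:R.
by rewrite (can_eq (@mxtens_indexK _ _)) xpair_eqE.
Qed.

Lemma diag_circleM k r s :
  diag_circle k r *m diag_circle k s = diag_circle k (r *m s).
Proof. by rewrite /diag_circle tensmx_mul mulmx1. Qed.

Lemma diag_circleT k r : (diag_circle k r)^T = diag_circle k r^T.
Proof. by rewrite /diag_circle trmx_tens trmx1. Qed.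

Lemma diag_blocksE k r (a a' : 'I_k) b b' :
  diag_blocks r (mxtens_index (a, b)) (mxtens_index (a', b')) =
  if a == a' then r a b b' else 0.
Proof.
rewrite /diag_blocks summxE (bigD1 a) //= big1 ?addr0 => [|i ia].
  by rewrite tensmxE mxE eqxx eq_sym /=; case: eqP; rewrite ?mul1r ?mul0r.
by rewrite tensmxE mxE eq_sym (negbTE ia) mul0r.
Qed.

Lemma diag_blocks1 k : diag_blocks (fun=> 1%:M) = 1%:M :> 'M[R]_(k * 2).
Proof.
apply/matrixP => i j.
case: (mxtens_indexP i) => a b; case: (mxtens_indexP j) => a' b'.
rewrite diag_blocksE !mxE (can_eq (@mxtens_indexK _ _)) xpair_eqE.
by case: eqP.
Qed.

Lemma diag_blocksM k (r s : 'I_k -> 'M[R]_2) :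
  diag_blocks r *m diag_blocks s = diag_blocks (fun i => r i *m s i).
Proof.
rewrite /diag_blocks mulmx_suml; apply: eq_bigr => i _.
rewrite mulmx_sumr (bigD1 i) //= big1 ?addr0 => [|j ji].
  by rewrite tensmx_mul mul_delta_mx.
by rewrite tensmx_mul mul_delta_mx_0 1?eq_sym// tens0mx.
Qed.

Lemma diag_blocksT k (r : 'I_k -> 'M[R]_2) :
  (diag_blocks r)^T = diag_blocks (fun i => (r i)^T).
Proof.
rewrite /diag_blocks raddf_sum; apply: eq_bigr => i _ /=.
by rewrite trmx_tens trmx_delta.
Qed.

Program Definition circle (k : nat) : osubgroup (k * 2) :=
  @OSubgroup (k * 2) [set diag_circle k r | r in SO2] _ _ _ _.
Next Obligation.
move=> k; exists 1%:M; last exact: diag_circle1.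
by split; [exact: O2_1|rewrite det1].
Qed.
Next Obligation.
move=> k _ _ [r [rO r1] <-] [s [sO s1] <-].
exists (r *m s); last by rewrite diag_circleM.
by split; [exact: O2_M|rewrite det_mulmx r1 s1 mulr1].
Qed.
Next Obligation.
move=> k _ [r [rO r1] <-]; exists r^T; last by rewrite diag_circleT.
by split; [exact: O2_V|rewrite det_tr].
Qed.
Next Obligation.
by move=> k _ [r [rO _] <-]; rewrite diag_circleT diag_circleM rO diag_circle1.
Qed.

Program Definition O2_power (k : nat) : osubgroup (k * 2) :=
  @OSubgroup (k * 2)
    [set diag_blocks r | r in [set r : 'I_k -> 'M[R]_2 | forall i, O2 (r i)]]
    _ _ _ _.
Next Obligation.
move=> k; exists (fun=> 1%:M); last exact: diag_blocks1.
by move=> i; exact: O2_1.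
Qed.
Next Obligation.
move=> k _ _ [r rO <-] [s sO <-].
exists (fun i => r i *m s i); last by rewrite diag_blocksM.
by move=> i; exact: O2_M.
Qed.
Next Obligation.
move=> k _ [r rO <-]; exists (fun i => (r i)^T); last by rewrite diag_blocksT.
by move=> i; exact: O2_V.
Qed.
Next Obligation.
move=> k _ [r rO <-]; rewrite diag_blocksT diag_blocksM -diag_blocks1.
by congr diag_blocks; apply/funext => i; exact: rO.
Qed.

End Stiefel.

Arguments stiefel : clear implicits.
Arguments circle : clear implicits.
Arguments O2_power : clear implicits.

(** * Circle quotient Stiefel manifolds *)

Section CircleQuotient.
Variables (R : realType) (n k : nat).

Definition Y := orbit_space n (circle R k).
Definition flags := orbit_space n (O2_power R k).
HB.instance Definition _ := Topological.on Y.
HB.instance Definition _ := Topological.on flags.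

Definition q (y : Y) : flags := orbit_proj (O2_power R k) (repr y).

(* dim V_{n,2k} - dim S^1 *)
Definition dimY : nat := (n * (k * 2) - k * (k * 2).+1 - 1)%N.

Definition TY : vbundle R Y :=
  tangent_bundle (@orbit_fstruct R n _ (circle R k)) dimY.

(* The line bundle V x_{S^1} C, where (v.r, z) is identified with (v, r.z): the
   coordinate transformation from section [t] to section [s] is the complex
   number of the rotation r such that t y = s y . r *)
Definition zeta : vbundle R[i] Y :=
  @VBundle R[i] Y 1 (local_section n (circle R k)) (@section_dom _ _ _ _)
    (fun s t y =>
       let r := xget 1%:M [set r | SO2 r /\
                  \val (t y) = \val (s y) *m diag_circle k r] in
       (r 0 0 +i* r 1 0)%:M).

Definition zeta_r : vbundle R Y := realification zeta.

(* The last canonical bundle over the flag space: since V_k is spanned by the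
   columns of v, the fibre over the class of v is the orthogonal complement of
   those columns. *)
Definition xi_last : vbundle R flags :=
  @subbundle R flags n (n - k * 2)
    (fun y => [set x | forall v : stiefel R n (k * 2),
                 orbit_proj (O2_power R k) v = y -> (\val v)^T *m x = 0]).

Definition epsilon : vbundle R Y := trivial_bundle 1.

End CircleQuotient.

(* Main.v *)
Require Import Defs.
From HB Require Import structures.
From mathcomp Require Import all_boot all_order all_algebra.
From mathcomp Require Import all_classical all_reals all_analysis.
From mathcomp Require Import mxtens complex.
From mathcomp Require Import ring lra zify.

(** A tangent vector of [Y] at the class of [v] is a matrix [X] with [v^T X] skew
  and with vanishing component along the direction [v J] of the circle, where [J]
  is the complex structure [diag_circle k (rot90 R)].  Cut [v^T X] into 2 x 2
  blocks.  Under a rotation [r] of [v] the [C(k, 2)] blocks [B] below the diagonal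
  become [r^T B r]: these are copies of zeta_r (x) zeta_r.  The diagonal blocks
  are multiples [b_j] of [rot90] and are invariant; their sum vanishes, which
  leaves [k - 1] trivial lines.  The part of [X] orthogonal to the columns of [v]
  gives the copies of zeta_r (x) q^* xi.

  For the second isomorphism, [C(k + 1, 2)] blocks of size 4 amount to the
  symmetric matrices [S] together with [k] further scalars, the skew parts of the
  diagonal blocks.  The matrices [X + v (S + c J)], where [c] is the first scalar,
  fill the space of all n x 2k matrices, whose rows are [n k] copies of zeta_r;
  the other [k - 1] scalars are the trivial lines.  Since both ranks agree, the
  injectivity of this map also shows that the first model is onto.

  Charts of [Y] come from the slice [p . u e2 = 0 < p . u e1] of the action, with
  [p = v e1], which every orbit near [v] meets exactly once.  Tangent vectors
  act on charts by differentiating along the equivariant curves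
  [cay (t/2 sk v X) v]; that no horizontal vector is killed is seen on the
  invariant matrices [v Q v^T], where [Q] commutes with the circle. *)

Set Implicit Arguments.
Unset Strict Implicit.
Unset Printing Implicit Defensive.

Import Order.TTheory GRing.Theory Num.Theory.
Import numFieldNormedType.Exports.

Local Open Scope classical_set_scope.
Local Open Scope ring_scope.

(** * Smooth functions of matrices *)

(** Bundles are given by coordinate transformations over a quotient on which little can be computed,
    so isomorphisms are built upstairs: each summand is embedded equivariantly in a trivial bundle
    over the Stiefel manifold, and an invariant continuous family of injective matrices between
    bundles of equal rank descends. That the first model is onto serves the charts, whose linear
    coordinates must exhaust the tangent space of the slice.

    The smooth structure of [Y] only says which functions are smooth, so charts need explicit smooth
    inverses. This dictates the Cayley transform in place of the exponential, and stereographic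
    projection for the one column that the slice condition constrains. The tangent space of the
    slice is not the horizontal space; both are complements of the line of [v J] in the tangent
    space of the Stiefel manifold, and projecting along that line carries linear coordinates from
    one to the other.

    [TY] contains all charts, not only those from slices. Hence derivatives are taken in an
    arbitrary chart, and their injectivity is tested on invariant functions, which every chart sees
    as smooth. *)

Section NearEq.
Context {R : realType} {V W : normedModType R}.

Lemma diff_near_eq (f g : V -> W) (x : V) : (\forall y \near x, f y = g y) ->
  differentiable f x -> differentiable g x /\ 'd g x = 'd f x :> (V -> W).
Proof.
move=> fg df.
have cf : continuous ('d f x) by exact: diff_continuous.
have E : g \o shift x = cst (g x) + 'd f x +o_ 0 id.
  apply/eqaddoP => e e0.
  have /eqaddoP/(_ e e0) := diff_locally df.
  have fgx : f x = g x by exact: nbhs_singleton fg.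
  have fg0 : \forall h \near (0 : V), f (h + x) = g (h + x).
    have := fg; rewrite (near_shift 0 x) subr0.
    by apply: filterS => h /=.
  move=> H; near=> h.
  have -> : (g \o shift x - (cst (g x) + 'd f x)) h =
            (f \o shift x - (cst (f x) + 'd f x)) h.
    suff fgh : f (h + x) = g (h + x).
      by rewrite [LHS](_ : _ = g (h + x) - (g x + 'd f x h)) // -fgx -fgh.
    by near: h.
  by near: h.
have D : 'd g x = 'd f x :> (V -> W) by exact: diff_unique.
split; last exact: D.
by apply/diff_locallyP; rewrite D; split; [exact: cf|exact: E].
Unshelve. all: by end_near. Qed.

End NearEq.

(** * Calculus of functions of class C^m *)

Section CkTheory.
Context {R : realType} {V : normedModType R}.
Implicit Types (O U : set V) (f g : V -> R).

Lemma Ck_sub m O U f : U `<=` O -> Ck m O f -> Ck m U f.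
Proof.
move=> UO; elim: m f => [|m IH] f /=; first by move=> H x /UO/H.
by move=> [H1 H2]; split=> [x /UO/H1|v]//; exact: IH.
Qed.

(** Openness of [O] lets the induction pass to derivatives, which depend on the values nearby. *)
Lemma Ck_ext m O f g : open O -> (forall x, O x -> f x = g x) ->
  Ck m O f -> Ck m O g.
Proof.
move=> oO; elim: m f g => [|m IH] f g fg /=.
  move=> H x Ox; have fgx : \forall y \near x, f y = g y.
    by apply: filterS (open_nbhs_nbhs (conj oO Ox)).
  have K : f @ x --> f x := H x Ox.
  have K' : g @ x --> f x by apply: cvg_trans K; exact: near_eq_cvg.
  by rewrite (fg _ Ox) in K'.
move=> [H1 H2].
have fgx x : O x -> \forall y \near x, f y = g y.
  by move=> Ox; apply: filterS (open_nbhs_nbhs (conj oO Ox)).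
split=> [x Ox|v]; first by case: (diff_near_eq (fgx _ Ox) (H1 _ Ox)).
apply: IH (H2 v) => x Ox.
by have [_ /(congr1 (@^~ v)) /esym] := diff_near_eq (fgx _ Ox) (H1 _ Ox).
Qed.

Lemma Ck_local m O f :
  (forall x, O x -> exists2 U, U x & Ck m U f) -> Ck m O f.
Proof.
elim: m f => [|m IH] f /=.
  by move=> H x /H[U Ux]; apply.
move=> H; split=> [x /H[U Ux []]|v]; first by move=> + _; apply.
by apply: IH => x /H[U Ux []] _ Hv; exists U.
Qed.

Lemma CkS m O f : Ck m.+1 O f -> Ck m O f.
Proof.
elim: m f => [|m IH] f [H1 H2].
  by move=> x /H1; exact: differentiable_continuous.
by split=> // v; exact: IH.
Qed.

Lemma Ck_cst m O (c : R) : Ck m O (cst c).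
Proof.
elim: m c => [|m IH] c /=; first by move=> x _; exact: cst_continuous.
split=> [x _|v]; first exact: differentiable_cst.
rewrite (_ : (fun x => _) = cst 0); first exact: IH.
by apply/funext => x; rewrite diff_cst.
Qed.

Lemma CkD m O f g : open O -> Ck m O f -> Ck m O g ->
  Ck m O (fun x => f x + g x).
Proof.
move=> oO; elim: m f g => [|m IH] f g /=.
  by move=> Hf Hg x Ox; apply: cvgD; [exact: Hf|exact: Hg].
move=> [Hf1 Hf2] [Hg1 Hg2]; split=> [x Ox|v].
  by apply: differentiableD; [exact: Hf1|exact: Hg1].
apply: Ck_ext (IH _ _ (Hf2 v) (Hg2 v)) => // x Ox.
by rewrite [RHS](congr1 (@^~ v) (diffD (Hf1 _ Ox) (Hg1 _ Ox))).
Qed.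

Lemma CkM m O f g : open O -> Ck m O f -> Ck m O g ->
  Ck m O (fun x => f x * g x).
Proof.
move=> oO; elim: m f g => [|m IH] f g.
  by move=> Hf Hg x Ox; apply: cvgM; [exact: Hf|exact: Hg].
move=> Hf Hg; have [Hf1 Hf2] := Hf; have [Hg1 Hg2] := Hg; split=> [x Ox|v].
  by apply: differentiableM; [exact: Hf1|exact: Hg1].
have H : Ck m O (fun x => f x * 'd g x v + g x * 'd f x v).
  apply: (CkD oO).
    by apply: (IH _ _ (CkS Hf)); exact: Hg2.
  by apply: (IH _ _ (CkS Hg)); exact: Hf2.
apply: Ck_ext H => // x Ox.
by rewrite [RHS](congr1 (@^~ v) (diffM (Hf1 _ Ox) (Hg1 _ Ox))).
Qed.

Lemma smooth_sub O U f : U `<=` O -> smooth O f -> smooth U f.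
Proof. by move=> UO H m; exact: Ck_sub (H m). Qed.

Lemma smooth_ext O f g : open O -> (forall x, O x -> f x = g x) ->
  smooth O f -> smooth O g.
Proof. by move=> oO fg H m; exact: Ck_ext (H m). Qed.

Lemma smooth_local O f :
  (forall x, O x -> exists2 U, U x & smooth U f) -> smooth O f.
Proof. by move=> H m; apply: Ck_local => x /H[U Ux Uf]; exists U. Qed.

Lemma smooth_cst O (c : R) : smooth O (cst c).
Proof. by move=> m; exact: Ck_cst. Qed.

Lemma smoothD O f g : open O -> smooth O f -> smooth O g ->
  smooth O (fun x => f x + g x).
Proof. by move=> oO Hf Hg m; exact: CkD. Qed.

Lemma smoothM O f g : open O -> smooth O f -> smooth O g ->
  smooth O (fun x => f x * g x).
Proof. by move=> oO Hf Hg m; exact: CkM. Qed.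

Lemma smoothN O f : open O -> smooth O f -> smooth O (fun x => - f x).
Proof.
move=> oO Hf; have := smoothM oO (@smooth_cst O (-1)) Hf.
by apply: smooth_ext => // x _; rewrite mulN1r.
Qed.

Lemma smooth_sum (I : Type) (r : seq I) (P : pred I) O (F : I -> V -> R) :
  open O -> (forall i, P i -> smooth O (F i)) ->
  smooth O (fun x => \sum_(i <- r | P i) F i x).
Proof.
move=> oO HF; elim: r => [|i r IH].
  by apply: smooth_ext (@smooth_cst O 0) => // x _; rewrite big_nil.
have [Pi|Pi] := boolP (P i); last first.
  by apply: smooth_ext IH => // x _; rewrite big_cons (negbTE Pi).
apply: smooth_ext (smoothD oO (HF i Pi) IH) => // x _.
by rewrite big_cons Pi.
Qed.

Lemma smooth_prod (I : Type) (r : seq I) (P : pred I) O (F : I -> V -> R) :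
  open O -> (forall i, P i -> smooth O (F i)) ->
  smooth O (fun x => \prod_(i <- r | P i) F i x).
Proof.
move=> oO HF; elim: r => [|i r IH].
  by apply: smooth_ext (@smooth_cst O 1) => // x _; rewrite big_nil.
have [Pi|Pi] := boolP (P i); last first.
  by apply: smooth_ext IH => // x _; rewrite big_cons (negbTE Pi).
apply: smooth_ext (smoothM oO (HF i Pi) IH) => // x _.
by rewrite big_cons Pi.
Qed.

Lemma smooth_differentiable O f x : smooth O f -> O x -> differentiable f x.
Proof. by move=> /(_ 1%N)[H _]; exact: H. Qed.

Lemma smooth_diff O f v : smooth O f -> smooth O (fun x => 'd f x v).
Proof. by move=> H m; have [_] := H m.+1; apply. Qed.

Lemma smooth_continuous O f x : smooth O f -> O x -> {for x, continuous f}.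
Proof. by move=> /(_ 0%N); apply. Qed.

(** The derivative $-f^{-2}\,df$ is a polynomial in $1/f$ and $df$, so the order of
    differentiability of $1/f$ bootstraps itself. *)
Lemma smooth_inv O f : open O -> (forall x, O x -> f x != 0) -> smooth O f ->
  smooth O (fun x => (f x)^-1).
Proof.
move=> oO f0 Hf; elim=> [|m IH].
  move=> x Ox; apply: cvgV; first exact: f0.
  exact: smooth_continuous Hf Ox.
split=> [x Ox|v].
  by apply: differentiableV; [exact: smooth_differentiable Hf Ox|exact: f0].
have H : Ck m O (fun x => - 1 * ((f x)^-1 * (f x)^-1) * 'd f x v).
  apply: CkM => //; last exact: smooth_diff.
  by apply: CkM => //; [exact: Ck_cst|exact: CkM].
apply: Ck_ext H => // x Ox.
have dfx := smooth_differentiable Hf Ox.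
rewrite [RHS](congr1 (@^~ v) (diffV dfx (f0 _ Ox))).
by rewrite /= expr2 invfM mulN1r.
Qed.

End CkTheory.

(** * Smooth matrix-valued functions *)

Section SmoothMatrices.
Context {R : realType} {V : normedModType R}.

Lemma diff_coord m n (M v : 'M[R]_(m, n)) i j :
  'd (fun N : 'M[R]_(m, n) => N i j : R) M v = v i j.
Proof.
have @f : {linear 'M[R]_(m, n) -> R}.
  by exists (fun N : 'M[R]_(_, _) => N i j); do 2![eexists]; do ?[constructor];
     rewrite ?mxE// => ? *; rewrite ?mxE//; move=> ?; rewrite !mxE.
rewrite (_ : (fun _ => _) = f) //.
have cf : continuous f by exact: coord_continuous.
by rewrite (diff_lin M cf).
Qed.

Lemma differentiable_mx p q (g : V -> 'M[R]_(p, q)) x :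
  (forall i j, differentiable (fun y => g y i j) x) -> differentiable g x.
Proof.
move=> H.
have E : g = \sum_i \sum_j (fun y => g y i j *: delta_mx i j).
  apply/funext => y; rewrite [LHS]matrix_sum_delta fct_sumE.
  by apply: eq_bigr => i _; rewrite fct_sumE.
rewrite E; apply: differentiable_sum => i; apply: differentiable_sum => j.
exact: differentiableZl.
Qed.

Lemma diff_mxE p q (g : V -> 'M[R]_(p, q)) x v i j :
  differentiable g x -> 'd g x v i j = 'd (fun y => g y i j) x v.
Proof.
move=> dg.
have := diff_comp dg (@differentiable_coord R p q (g x) i j).
move=> /(congr1 (@^~ v)) /= E.
by rewrite -(diff_coord (g x)) -E.
Qed.

Definition smooth_mx (O : set V) p q (g : V -> 'M[R]_(p, q)) : Prop :=
  forall i j, smooth O (fun x => g x i j).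

Lemma smooth_mx_differentiable O p q (g : V -> 'M[R]_(p, q)) x :
  smooth_mx O g -> O x -> differentiable g x.
Proof.
by move=> Hg Ox; apply: differentiable_mx => i j; exact: smooth_differentiable (Hg i j) Ox.
Qed.

Lemma smooth_mx_continuous O p q (g : V -> 'M[R]_(p, q)) x :
  smooth_mx O g -> O x -> {for x, continuous g}.
Proof.
move=> Hg Ox; apply: differentiable_continuous.
exact: smooth_mx_differentiable Hg Ox.
Qed.

(** By the chain rule a derivative of [f \o g] is a sum of derivatives of entries of [g] times
    [D \o g], where [D] is a partial derivative of [f]. The factor [D \o g] is again a composition
    with the same [g], so the induction varies only [f]. *)
Lemma smooth_comp p q (O : set V) (U : set 'M[R]_(p, q)) (f : 'M[R]_(p, q) -> R)
    (g : V -> 'M[R]_(p, q)) : open O ->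
  smooth U f -> smooth_mx O g -> (forall x, O x -> U (g x)) ->
  smooth O (f \o g).
Proof.
move=> oO Hf Hg OU m; elim: m f Hf => [|m IH] f Hf.
  move=> x Ox; apply: continuous_comp.
    exact: smooth_mx_continuous Hg Ox.
  exact: smooth_continuous Hf (OU _ Ox).
split=> [x Ox|v].
  apply: differentiable_comp; first exact: smooth_mx_differentiable Hg Ox.
  exact: smooth_differentiable Hf (OU _ Ox).
have H : Ck m O (fun x => \sum_i \sum_j
    'd (fun y => g y i j) x v * 'd f (g x) (delta_mx i j)).
  have sumCk (I : finType) (F : I -> V -> R) : (forall i, Ck m O (F i)) ->
      Ck m O (fun x => \sum_i F i x).
    move=> HF; elim: (index_enum I) => [|i r IHr].
      by apply: Ck_ext (@Ck_cst _ _ m O 0) => // x _; rewrite big_nil.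
    by apply: Ck_ext (CkD oO (HF i) IHr) => // x _; rewrite big_cons.
  apply: (sumCk) => i; apply: (sumCk) => j; apply: CkM => //.
    exact: (smooth_diff v (Hg i j)).
  exact: (IH _ (smooth_diff _ Hf)).
apply: Ck_ext H => // x Ox.
have dg := smooth_mx_differentiable Hg Ox.
have df := smooth_differentiable Hf (OU _ Ox).
rewrite [RHS](congr1 (@^~ v) (diff_comp dg df)) /=.
rewrite [in RHS](matrix_sum_delta ('d g x v)) linear_sum.
apply: eq_bigr => i _; rewrite linear_sum; apply: eq_bigr => j _.
by rewrite linearZ -diff_mxE.
Qed.

Section Closure.
Variables (O : set V) (oO : open O).

Lemma smooth_mx_cst p q (A : 'M[R]_(p, q)) : smooth_mx O (fun=> A).
Proof. by move=> i j; exact: smooth_cst. Qed.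

Lemma smooth_mxD p q (f g : V -> 'M[R]_(p, q)) : smooth_mx O f ->
  smooth_mx O g -> smooth_mx O (fun x => f x + g x).
Proof.
move=> Hf Hg i j; apply: smooth_ext (smoothD oO (Hf i j) (Hg i j)) => // x _.
by rewrite mxE.
Qed.

Lemma smooth_mxN p q (f : V -> 'M[R]_(p, q)) : smooth_mx O f ->
  smooth_mx O (fun x => - f x).
Proof.
move=> Hf i j; apply: smooth_ext (smoothN oO (Hf i j)) => // x _.
by rewrite mxE.
Qed.

Lemma smooth_mxB p q (f g : V -> 'M[R]_(p, q)) : smooth_mx O f ->
  smooth_mx O g -> smooth_mx O (fun x => f x - g x).
Proof. by move=> Hf Hg; apply: smooth_mxD => //; exact: smooth_mxN. Qed.

Lemma smooth_mxM p q r (f : V -> 'M[R]_(p, q)) (g : V -> 'M[R]_(q, r)) :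
  smooth_mx O f -> smooth_mx O g -> smooth_mx O (fun x => f x *m g x).
Proof.
move=> Hf Hg i j.
have H : smooth O (fun x => \sum_k f x i k * g x k j).
  by apply: smooth_sum => // k _; exact: (smoothM oO (Hf i k) (Hg k j)).
by apply: smooth_ext H => // x _; rewrite mxE.
Qed.

Lemma smooth_mxZ p q (c : V -> R) (f : V -> 'M[R]_(p, q)) :
  smooth O c -> smooth_mx O f -> smooth_mx O (fun x => c x *: f x).
Proof.
move=> Hc Hf i j; apply: smooth_ext (smoothM oO Hc (Hf i j)) => // x _.
by rewrite mxE.
Qed.

Lemma smooth_mxT p q (f : V -> 'M[R]_(p, q)) : smooth_mx O f ->
  smooth_mx O (fun x => (f x)^T).
Proof.
by move=> Hf i j; apply: smooth_ext (Hf j i) => // x _; rewrite mxE.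
Qed.

Lemma smooth_det p (f : V -> 'M[R]_p) : smooth_mx O f ->
  smooth O (fun x => \det (f x)).
Proof.
move=> Hf; rewrite /determinant; apply: smooth_sum => // s _.
apply: smoothM => //; first exact: smooth_cst.
by apply: smooth_prod => // i _; exact: Hf.
Qed.

(** Cramer's rule: an entry of the inverse is a cofactor divided by the determinant. *)
Lemma smooth_mxV p (f : V -> 'M[R]_p) : (forall x, O x -> \det (f x) != 0) ->
  smooth_mx O f -> smooth_mx O (fun x => invmx (f x)).
Proof.
move=> f0 Hf i j.
have H : smooth O (fun x => (\det (f x))^-1 * ((-1) ^+ (j + i) *
    \det (row' j (col' i (f x))))).
  apply: smoothM => //.
    by apply: smooth_inv => //; exact: smooth_det.
  apply: smoothM => //; first exact: smooth_cst.
  apply: smooth_det => a b.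
  by apply: smooth_ext (Hf (lift j a) (lift i b)) => // x _; rewrite !mxE.
apply: smooth_ext H => // x Ox.
by rewrite /invmx unitmxE unitfE f0 // !mxE /cofactor.
Qed.

Lemma smooth_mx_lin1 p q r s (f : {linear 'M[R]_(p, q) -> 'M[R]_(r, s)})
    (g : V -> 'M[R]_(p, q)) :
  smooth_mx O g -> smooth_mx O (fun x => f (g x)).
Proof.
move=> Hg i j.
have H : smooth O (fun x => \sum_a \sum_b g x a b * f (delta_mx a b) i j).
  apply: smooth_sum => // a _; apply: smooth_sum => // b _.
  exact: (smoothM oO (Hg a b) (@smooth_cst _ _ O (f (delta_mx a b) i j))).
apply: smooth_ext H => // x Ox.
rewrite {2}(matrix_sum_delta (g x)) linear_sum summxE.
apply: eq_bigr => a _; rewrite linear_sum summxE.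
by apply: eq_bigr => b _; rewrite linearZ mxE.
Qed.

(** As for the inverse: $h=f^{-1/2}$ has derivative $-\frac12h^3\,df$, a polynomial in $h$ and
    $df$. *)
Lemma smooth_rsqrt (f : V -> R) : (forall x, O x -> 0 < f x) ->
  smooth O f -> smooth O (fun x => (Num.sqrt (f x))^-1).
Proof.
move=> f0 Hf.
have sdiff (r : R) : 0 < r -> differentiable (Num.sqrt : R -> R) r /\
    'd (Num.sqrt : R -> R) r = (fun h => h * (2 * Num.sqrt r)^-1) :> (R -> R).
  move=> r0; have [D E] := is_derive1_sqrt r0.
  have Df : differentiable (Num.sqrt : R -> R) r by exact/derivable1_diffP.
  split=> //; apply/funext => h; rewrite diff1E // derive1E E.
  by rewrite /GRing.scale.
have s0 x : O x -> Num.sqrt (f x) != 0.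
  by move=> Ox; rewrite gt_eqF // sqrtr_gt0; exact: f0.
have dcomp x : O x -> differentiable (Num.sqrt \o f) x.
  move=> Ox; apply: differentiable_comp; first exact: smooth_differentiable Hf Ox.
  by have [] := sdiff _ (f0 _ Ox).
pose h x := (Num.sqrt (f x))^-1.
elim=> [|m IH].
  move=> x Ox; apply: cvgV; first exact: s0.
  exact: (differentiable_continuous (dcomp _ Ox)).
split=> [x Ox|v].
  by apply: differentiableV; [exact: dcomp|exact: s0].
have H : Ck m O (fun x => - 2^-1 * (h x * (h x * h x)) * 'd f x v).
  apply: CkM => //; last exact: (smooth_diff v Hf).
  by apply: CkM => //; [exact: Ck_cst|apply: CkM => //; exact: CkM].
apply: Ck_ext H => // x Ox.
rewrite [RHS](congr1 (@^~ v) (diffV (dcomp _ Ox) (s0 _ Ox))) /=.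
have [Ds Es] := sdiff _ (f0 _ Ox).
have df := smooth_differentiable Hf Ox.
rewrite [in RHS](congr1 (@^~ v) (diff_comp df Ds)) /= Es /h.
by have s0x := s0 _ Ox; rewrite /GRing.scale /=; field.
Qed.

End Closure.

Lemma smooth_mx_sub O U p q (f : V -> 'M[R]_(p, q)) : U `<=` O ->
  smooth_mx O f -> smooth_mx U f.
Proof. by move=> UO Hf i j; exact: smooth_sub (Hf i j). Qed.

Lemma open_neq0 O (f : V -> R) : open O -> smooth O f ->
  open [set x | O x /\ f x != 0].
Proof.
move=> oO Hf; rewrite openE => x [Ox fx0]; rewrite /interior /=.
have c := smooth_continuous Hf Ox.
have : \forall y \near x, f y != 0.
  have : nbhs (f x) [set y | y != 0].
    apply: open_nbhs_nbhs; split=> //; exact: open_neq.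
  exact: c.
by move: (open_nbhs_nbhs (conj oO Ox)); apply: filterS2 => y.
Qed.

Lemma open_gt0 O (f : V -> R) : open O -> smooth O f ->
  open [set x | O x /\ 0 < f x].
Proof.
move=> oO Hf; rewrite openE => x [Ox fx0]; rewrite /interior /=.
have c := smooth_continuous Hf Ox.
have : \forall y \near x, 0 < f y.
  have : nbhs (f x) [set y | 0 < y].
    apply: open_nbhs_nbhs; split=> //; exact: open_gt.
  exact: c.
by move: (open_nbhs_nbhs (conj oO Ox)); apply: filterS2 => y.
Qed.

Lemma open_preim O p q (f : V -> 'M[R]_(p, q)) (U : set 'M[R]_(p, q)) :
  open O -> smooth_mx O f -> open U -> open [set x | O x /\ U (f x)].
Proof.
move=> oO Hf oU; rewrite openE => x [Ox fx0]; rewrite /interior /=.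
have c := smooth_mx_continuous Hf Ox.
have : \forall y \near x, U (f y) by exact: c (open_nbhs_nbhs (conj oU fx0)).
by move: (open_nbhs_nbhs (conj oO Ox)); apply: filterS2 => y.
Qed.

End SmoothMatrices.

Lemma smooth_mx_id (R : realType) p q (O : set 'M[R]_(p, q)) :
  smooth_mx O (@id 'M[R]_(p, q)).
Proof.
move=> i j; case=> [|m].
  by move=> x _; exact: coord_continuous.
split=> [x _|v]; first exact: differentiable_coord.
rewrite (_ : (fun x => _) = cst (v i j)); first exact: Ck_cst.
by apply/funext => x; rewrite diff_coord.
Qed.

Lemma smooth_id (R : realType) (O : set R) : smooth O (@id R).
Proof.
case=> [|m]; first by move=> x _; exact: cvg_id.
split=> [x _|v]; first exact: ex_diff.
rewrite (_ : (fun x => _) = cst v); first exact: Ck_cst.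
by apply/funext => x; rewrite (@diff_val _ _ _ _ _ _ _ (is_diff_id x)).
Qed.

(** * Cayley transforms and slices *)

Lemma mxDE (R : nzRingType) p q (A B : 'M[R]_(p, q)) i j : (A + B) i j = A i j + B i j.
Proof. by rewrite mxE. Qed.

Lemma mxNE (R : nzRingType) p q (A : 'M[R]_(p, q)) i j : (- A) i j = - A i j.
Proof. by rewrite mxE. Qed.

Lemma mxZE (R : nzRingType) p q a (A : 'M[R]_(p, q)) i j : (a *: A) i j = a * A i j.
Proof. by rewrite mxE. Qed.

Lemma mx0E (R : nzRingType) p q i j : (0 : 'M[R]_(p, q)) i j = 0.
Proof. by rewrite mxE. Qed.

Lemma mxTE (R : nzRingType) p q (A : 'M[R]_(p, q)) i j : A^T i j = A j i.
Proof. by rewrite mxE. Qed.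

Lemma mx1E (R : nzRingType) p i j : (1%:M : 'M[R]_p) i j = (i == j)%:R.
Proof. by rewrite mxE. Qed.

Lemma trD (R : nzRingType) p q (A B : 'M[R]_(p, q)) : (A + B)^T = A^T + B^T.
Proof. exact: linearD. Qed.

Lemma trB (R : nzRingType) p q (A B : 'M[R]_(p, q)) : (A - B)^T = A^T - B^T.
Proof. exact: linearB. Qed.

Lemma trZ (R : nzRingType) p q a (A : 'M[R]_(p, q)) : (a *: A)^T = a *: A^T.
Proof. exact: linearZ. Qed.

(* Decides identities of matrices in which all products are atoms. *)
Ltac mx_lin := apply/matrixP => ? ?; rewrite !(mxDE, mxNE, mxZE, mx0E); ring.

Section Cayley.
Context {R : realFieldType}.

Lemma tr_mulmx_eq0 p q (A : 'M[R]_(p, q)) : A^T *m A = 0 -> A = 0.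
Proof.
move=> H; apply/matrixP => i j.
move/matrixP: H => /(_ j j); rewrite !mxE => /eqP.
rewrite psumr_eq0 => [|l _]; last by rewrite mxE -expr2 sqr_ge0.
move=> /allP/(_ i); rewrite mem_index_enum => /(_ isT).
by rewrite mxE mulf_eq0 orbb => /eqP.
Qed.

Lemma mx_eq_opp p q (A : 'M[R]_(p, q)) : A = - A -> A = 0.
Proof.
move=> /matrixP H; apply/matrixP => i j; have := H i j.
by rewrite !mxE => ?; lra.
Qed.

(** The matrix $w^TWw$ is skew and $w^Tw$ is symmetric, so a common value is its own negative.
    Applied to vectors this shows that a skew matrix does not have the eigenvalue 1. *)
Lemma skew_quad0 p q (W : 'M[R]_p) (w : 'M[R]_(p, q)) : W^T = - W ->
  w^T *m w = w^T *m W *m w -> w = 0.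
Proof.
move=> sW E; apply: tr_mulmx_eq0; apply: mx_eq_opp.
have := congr1 trmx E; rewrite !trmx_mul trmxK sW mulNmx mulmxN mulmxA -E.
by [].
Qed.

Lemma unitmx_inj p (A : 'M[R]_p) :
  (forall w : 'cV[R]_p, A *m w = 0 -> w = 0) -> A \in unitmx.
Proof.
move=> H; rewrite -unitmx_tr -row_free_unit -kermx_eq0; apply/eqP.
apply/row_matrixP => i; rewrite row0; apply: trmx_inj; rewrite trmx0.
apply: H; apply: trmx_inj; rewrite trmx_mul trmxK trmx0.
by rewrite -row_mul mulmx_ker row0.
Qed.

Lemma skew_unit p (W : 'M[R]_p) : W^T = - W -> 1%:M - W \in unitmx.
Proof.
move=> sW; apply: unitmx_inj => w /eqP; rewrite mulmxBl mul1mx subr_eq0 => /eqP E.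
by apply: (skew_quad0 sW); rewrite -mulmxA -E.
Qed.

(** The Cayley transform: orthogonal for skew [W], rational in [W], and with a rational inverse. It
    is $1+2W+\cdots$ near 0. *)
Definition cay p (W : 'M[R]_p) : 'M[R]_p := invmx (1%:M - W) *m (1%:M + W).

Lemma mul_cay p (W : 'M[R]_p) : W^T = - W -> (1%:M - W) *m cay W = 1%:M + W.
Proof. by move=> /skew_unit uW; rewrite /cay mulmxA mulmxV // mul1mx. Qed.

Lemma cay_uniq p q (W : 'M[R]_p) (v z : 'M[R]_(p, q)) : W^T = - W ->
  (1%:M - W) *m z = (1%:M + W) *m v -> z = cay W *m v.
Proof. by move=> /skew_unit uW E; rewrite /cay -mulmxA -E mulKmx. Qed.

Lemma cay_orth p (W : 'M[R]_p) : W^T = - W -> (cay W)^T *m cay W = 1%:M.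
Proof.
move=> sW; have uW := skew_unit sW; set C := cay W.
have CW : C *m (1%:M - W) = 1%:M + W.
  apply: (can_inj (mulKmx uW)); rewrite mulmxA mul_cay //.
  by rewrite !(mulmxBl, mulmxBr, mulmxDr, mulmxDl) !mulmx1 !mul1mx; mx_lin.
have CtW : C^T *m (1%:M + W) = 1%:M - W.
  have := congr1 trmx (mul_cay sW).
  by rewrite trmx_mul trB trD trmx1 sW opprK.
by apply: (can_inj (mulmxK uW)); rewrite -mulmxA CW CtW mul1mx.
Qed.

Variables (n m : nat).
Implicit Types v X z : 'M[R]_(n, m).

Definition tang v X := v^T *m X + X^T *m v = 0.

(* The skew matrix that extends X: it maps v to X when X is tangent at v. *)
Definition sk v X : 'M[R]_n :=
  X *m v^T - v *m X^T - v *m (v^T *m X) *m v^T.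

Lemma tangE v X : tang v X -> X^T *m v = - (v^T *m X).
Proof. by move=> /eqP; rewrite addrC addr_eq0 => /eqP. Qed.

Lemma sk_skew v X : tang v X -> (sk v X)^T = - sk v X.
Proof.
move=> tX; rewrite /sk !trB !trmx_mul !trmxK.
by rewrite (tangE tX) mulNmx mulmxN !mulmxA; mx_lin.
Qed.

Lemma sk_mul v X : v^T *m v = 1%:M -> tang v X -> sk v X *m v = X.
Proof.
move=> vv tX; rewrite /sk !mulmxBl -!mulmxA vv (tangE tX) !mulmx1.
by rewrite !mulmxN opprK addrK.
Qed.

Lemma tangZ v X (a : R) : tang v X -> tang v (a *: X).
Proof.
by move=> tX; rewrite /tang trZ -scalemxAr -scalemxAl -scalerDr tX scaler0.
Qed.

(** The solution [X] of [cay (sk v X) *m v = z]. Write $X=vA+b$ with $A$ skew and $v^Tb=0$, and $W$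
    for [sk v X]; the equation becomes $W(z+v)=z-v$. With $a=v^Tz$ and $N=1+a$, its part orthogonal
    to $v$ is $bN=z-va$, and its part along $v$ is $AN=a-1+b^Tz$, where $b^Tz=N^{-T}(1-a^Ta)$. Hence
    $A=N^{-T}(a-a^T)N^{-1}$. *)
Definition cayinv v z : 'M[R]_(n, m) :=
  let a := v^T *m z in let Ni := invmx (1%:M + a) in
  v *m (Ni^T *m (a - a^T) *m Ni) + (z - v *m a) *m Ni.

Lemma sk_split v (A : 'M[R]_m) (b : 'M[R]_(n, m)) : v^T *m v = 1%:M ->
  A^T = - A -> v^T *m b = 0 ->
  sk v (v *m A + b) = v *m A *m v^T + b *m v^T - v *m b^T.
Proof.
move=> vv sA vb; rewrite /sk mulmxDr mulmxA vv mul1mx vb addr0.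
by rewrite mulmxDl trD trmx_mul sA mulNmx mulmxDr mulmxN mulmxA; mx_lin.
Qed.

Section Inverse.
Variables (v z : 'M[R]_(n, m)).
Hypotheses (vv : v^T *m v = 1%:M) (zz : z^T *m z = 1%:M).
Hypothesis uN : 1%:M + v^T *m z \in unitmx.
Let a := v^T *m z.
Let N := 1%:M + a.
Let Ni := invmx N.

Let NiN : Ni *m N = 1%:M. Proof. by rewrite /Ni mulVmx. Qed.
Let NtNi : Ni^T *m N^T = 1%:M.
Proof. by rewrite -trmx_mul /Ni mulmxV // trmx1. Qed.

(** The product $N^T(a-1)$ expands to $(a-a^T)-(1-a^Ta)$. *)
Let key : Ni^T *m (a - a^T) - Ni^T *m (1%:M - a^T *m a) = a - 1%:M.
Proof.
have -> : a - 1%:M = Ni^T *m N^T *m (a - 1%:M) by rewrite NtNi mul1mx.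
rewrite -mulmxBr -mulmxA; congr (_ *m _).
by rewrite /N trD trmx1 mulmxDl mul1mx mulmxBr mulmx1; mx_lin.
Qed.

Let vb : v^T *m ((z - v *m a) *m Ni) = 0.
Proof. by rewrite mulmxA mulmxBr mulmxA vv mul1mx subrr mul0mx. Qed.

Let sA : (Ni^T *m (a - a^T) *m Ni)^T = - (Ni^T *m (a - a^T) *m Ni).
Proof.
by rewrite 2!trmx_mul trB !trmxK -[a^T - a]opprB mulNmx mulmxN mulmxA.
Qed.

Lemma cayinv_tang : tang v (cayinv v z).
Proof.
have vX : v^T *m cayinv v z = Ni^T *m (a - a^T) *m Ni.
  by rewrite /cayinv mulmxDr mulmxA vv mul1mx vb addr0.
rewrite /tang vX.
have -> : (cayinv v z)^T *m v = (v^T *m cayinv v z)^T by rewrite trmx_mul trmxK.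
by rewrite vX sA subrr.
Qed.

Lemma cay_cayinv : cay (sk v (cayinv v z)) *m v = z.
Proof.
apply/esym/cay_uniq; first exact/sk_skew/cayinv_tang.
set W := sk _ _.
(* Rewriting the Cayley equation in this form lets [W] act only on $z+v$, for which $v^T(z+v)=N$. *)
suff E : W *m (z + v) = z - v.
  have {}E : W *m z = z - v - W *m v by rewrite -E mulmxDr addrK.
  by rewrite mulmxBl mulmxDl !mul1mx E; mx_lin.
rewrite /W /cayinv sk_split //.
have vzv : v^T *m (z + v) = N by rewrite mulmxDr vv addrC.
rewrite mulmxBl mulmxDl -!mulmxA vzv mulmxA -/a -/N -/Ni.
rewrite NiN !mulmx1.
have -> : ((z - v *m a) *m Ni)^T *m (z + v) = Ni^T *m (1%:M - a^T *m a).
  rewrite mulmxDr -[X in _ + X = _]trmxK [in X in _ + X = _]trmx_mul trmxK vb.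
  rewrite trmx0 addr0 trmx_mul -mulmxA; congr (_ *m _).
  by rewrite trB trmx_mul mulmxBl zz -mulmxA.
rewrite addrAC -[v *m _ *m _]mulmxA -mulmxBr key mulmxBr mulmx1.
by mx_lin.
Qed.

(** Both $a$ and $a^T$ fix such an $e$, so $N^{-1}e=e/2$; then $a-a^T$ and $z-va$ kill it. This
    keeps the Cayley part of the slice coordinates away from [e2]. *)
Lemma cayinv_fix (e : 'cV[R]_m) : z *m e = v *m e -> cayinv v z *m e = 0.
Proof.
move=> ze.
have ae : a *m e = e by rewrite /a -mulmxA ze mulmxA vv mul1mx.
have ate : a^T *m e = e.
  by rewrite /a trmx_mul trmxK -mulmxA -ze mulmxA zz mul1mx.
have Nie : Ni *m e = 2^-1 *: e.
  apply: (can_inj (mulKmx uN)); rewrite mulmxA mulmxV // mul1mx -scalemxAr.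
  rewrite mulmxDl mul1mx -/a ae; apply/matrixP => i j.
  by rewrite !(mxZE, mxDE); field.
rewrite /cayinv -/a -/N -/Ni mulmxDl -!mulmxA Nie -!scalemxAr.
by rewrite !mulmxBl ate ae -mulmxA ae ze !subrr !mulmx0 scaler0 addr0.
Qed.

End Inverse.

Lemma cay_stiefel v (W : 'M[R]_n) : v^T *m v = 1%:M -> W^T = - W ->
  (cay W *m v)^T *m (cay W *m v) = 1%:M.
Proof.
by move=> vv sW; rewrite trmx_mul mulmxA -(mulmxA v^T) cay_orth // mulmx1.
Qed.

(** If $(1+v^Tz)e=0$, then $w=(z+v)e$ is orthogonal to the columns of $v$, while $(1-W)(z+v)=2v$
    puts $w-Ww$ in their span. Hence $w^Tw=w^TWw$, so $w=0$ because $W$ is skew, and then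
    $2ve=0$. *)
Lemma cay_unit v X : v^T *m v = 1%:M -> tang v X ->
  1%:M + v^T *m (cay (sk v X) *m v) \in unitmx.
Proof.
move=> vv /sk_skew; move: (sk v X) => W sW.
set z := cay W *m v; apply: unitmx_inj => e He.
have E : (1%:M - W) *m (z + v) = v + v.
  rewrite mulmxDr mulmxA mul_cay // mulmxDl mulmxBl mul1mx.
  by mx_lin.
have vw : v^T *m ((z + v) *m e) = 0 by rewrite mulmxA mulmxDr vv addrC.
have w0 : (z + v) *m e = 0.
  apply: (skew_quad0 sW); apply/eqP; rewrite -mulmxA -subr_eq0 -mulmxBr.
  set w := (z + v) *m e in vw *.
  have -> : w - W *m w = v *m (2 *: e).
    by rewrite -[X in X - _]mul1mx -mulmxBl mulmxA E mulmxDl scaler_nat mulr2n mulmxDr.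
  by rewrite mulmxA -[w^T *m v]trmxK trmx_mul trmxK vw trmx0 mul0mx.
have : (v + v) *m e = 0 by rewrite -E -mulmxA w0 mulmx0.
move=> /(congr1 (mulmx v^T)); rewrite mulmx0 mulmxA mulmxDr vv mulmxDl mul1mx.
by move=> /eqP; rewrite addr_eq0 => /eqP/mx_eq_opp.
Qed.

Lemma cayinvK v X : v^T *m v = 1%:M -> tang v X ->
  cayinv v (cay (sk v X) *m v) = X.
Proof.
move=> vv tX; have uN := cay_unit vv tX; have sW := sk_skew tX.
have zz := cay_stiefel vv sW.
set z := cay _ *m v in uN zz *.
have X_split (Y : 'M[R]_(n, m)) : Y = v *m (v^T *m Y) + (Y - v *m (v^T *m Y)).
  by rewrite addrC subrK.
have E : sk v X *m (z + v) = z - v.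
  have : (1%:M - sk v X) *m z = (1%:M + sk v X) *m v.
    by rewrite /z mulmxA mul_cay.
  rewrite mulmxBl mulmxDl !mul1mx mulmxDr => /eqP.
  by rewrite subr_eq addrAC -addrA addrC -subr_eq => /eqP <-; rewrite addrC.
set A := v^T *m X; set b := X - v *m A.
have vb : v^T *m b = 0 by rewrite mulmxBr mulmxA vv mul1mx subrr.
have sA : A^T = - A by rewrite /A trmx_mul trmxK (tangE tX).
set a := v^T *m z; set N := 1%:M + a; pose Ni := invmx N.
have NiN : Ni *m N = 1%:M by rewrite /Ni mulVmx.
have NNi : N *m Ni = 1%:M by rewrite /Ni mulmxV.
have vzv : v^T *m (z + v) = N by rewrite mulmxDr vv addrC.
have bv : b^T *m v = 0 by rewrite -[LHS]trmxK trmx_mul trmxK vb trmx0.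
have XE : X = v *m A + b by rewrite -X_split.
clearbody z.
have skE : sk v X = v *m A *m v^T + b *m v^T - v *m b^T.
  by rewrite -sk_split // -XE.
have NE : N = 1%:M + a by [].
clearbody b A N.
have {}E : v *m (A *m N) + b *m N - v *m (b^T *m z) = z - v.
  rewrite -E skE mulmxBl mulmxDl -!mulmxA vzv.
  by rewrite [b^T *m (z + v)]mulmxDr bv addr0.
have AN : A *m N = a - 1%:M + b^T *m z.
  have := congr1 (mulmx v^T) E.
  rewrite !mulmxBr !mulmxDr !mulmxA vv !mul1mx vb mul0mx addr0 => /eqP.
  by rewrite subr_eq => /eqP.
have bN : b *m N = z - v *m a.
  have -> : b *m N = z - v - v *m (A *m N - b^T *m z).
    by rewrite -E mulmxBr; mx_lin.
  by rewrite AN addrK mulmxBr mulmx1; mx_lin.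
have bE : b = (z - v *m a) *m Ni by rewrite -bN -mulmxA NNi mulmx1.
have bz : b^T *m z = Ni^T *m (1%:M - a^T *m a).
  rewrite bE trmx_mul -mulmxA; congr (_ *m _).
  by rewrite trB trmx_mul mulmxBl zz -mulmxA.
have AE : A = Ni^T *m (a - a^T) *m Ni.
  have -> : A = A *m N *m Ni by rewrite -mulmxA NNi mulmx1.
  congr (_ *m _); rewrite AN bz.
  have NtNi : Ni^T *m N^T = 1%:M by rewrite -trmx_mul NNi trmx1.
  have -> : a - 1%:M = Ni^T *m N^T *m (a - 1%:M) by rewrite NtNi mul1mx.
  rewrite -mulmxA -mulmxDr; congr (_ *m _).
  rewrite NE trD trmx1 mulmxDl mul1mx mulmxBr mulmx1.
  by mx_lin.
by rewrite [in RHS]XE /cayinv -/a -NE AE bE.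
Qed.

Lemma cay_fix v X (e : 'cV[R]_m) : v^T *m v = 1%:M -> tang v X -> X *m e = 0 ->
  cay (sk v X) *m (v *m e) = v *m e.
Proof.
move=> vv tX Xe; apply/esym/cay_uniq; first exact: sk_skew.
have E : sk v X *m (v *m e) = 0 by rewrite mulmxA sk_mul.
by rewrite mulmxBl mulmxDl E subr0 addr0.
Qed.

End Cayley.

(** * Inner products and half-turns *)

Section Reflections.
Context {R : realFieldType}.

Definition dot n (u w : 'cV[R]_n) : R := (u^T *m w) 0 0.

Section Dot.
Variable n : nat.
Implicit Types u w x : 'cV[R]_n.

Lemma dotE u w : u^T *m w = (dot u w)%:M.
Proof. exact: mx11_scalar. Qed.

Lemma dotC u w : dot u w = dot w u.
Proof. by rewrite /dot !mxE; apply: eq_bigr => i _; rewrite !mxE mulrC. Qed.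

Lemma dotDl u w x : dot (u + w) x = dot u x + dot w x.
Proof. by rewrite /dot trD mulmxDl mxE. Qed.

Lemma dotDr u w x : dot x (u + w) = dot x u + dot x w.
Proof. by rewrite /dot mulmxDr mxE. Qed.

Lemma dotNr u x : dot x (- u) = - dot x u.
Proof. by rewrite /dot mulmxN mxE. Qed.

Lemma dotZl a u w : dot (a *: u) w = a * dot u w.
Proof. by rewrite /dot trZ -scalemxAl mxE. Qed.

Lemma dotZr a u w : dot u (a *: w) = a * dot u w.
Proof. by rewrite /dot -scalemxAr mxE. Qed.

Lemma dot0r u : dot u 0 = 0.
Proof. by rewrite /dot mulmx0 mxE. Qed.

Lemma dot_eq0 u : dot u u = 0 -> u = 0.
Proof. by move=> H; apply: tr_mulmx_eq0; rewrite dotE H raddf0. Qed.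

Lemma dot_ge0 u : 0 <= dot u u.
Proof. by rewrite /dot mxE sumr_ge0 // => i _; rewrite mxE -expr2 sqr_ge0. Qed.

Lemma mul_outer q (u : 'cV[R]_q) w x : u *m w^T *m x = dot w x *: u.
Proof. by rewrite -mulmxA dotE mul_mx_scalar. Qed.

(** The half-turn about the line of [u]: it fixes [u] and negates its orthogonal complement, so it
    is minus the usual hyperplane reflection. The half-turn about the sum of two unit vectors
    exchanges them. *)
Definition refl u : 'M[R]_n := (2 / dot u u) *: (u *m u^T) - 1%:M.

Lemma refl_tr u : (refl u)^T = refl u.
Proof. by rewrite /refl trB trZ trmx_mul trmxK trmx1. Qed.

Lemma refl_mul u x : refl u *m x = (2 * dot u x / dot u u) *: u - x.
Proof. by rewrite mulmxBl mul1mx -scalemxAl mul_outer scalerA mulrAC. Qed.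

Lemma reflK u : dot u u != 0 -> refl u *m refl u = 1%:M.
Proof.
move=> u0; rewrite /refl mulmxBr mulmx1 mulmxBl mul1mx -scalemxAl -scalemxAr.
have -> : u *m u^T *m (u *m u^T) = dot u u *: (u *m u^T).
  by rewrite mulmxA -(mulmxA u) dotE mul_mx_scalar -scalemxAl.
rewrite !scalerA.
have -> : 2 / dot u u * (2 / dot u u) * dot u u = 2 / dot u u + 2 / dot u u by field.
by mx_lin.
Qed.

End Dot.

Lemma dot_isom n m (v : 'M[R]_(n, m)) (u w : 'cV_m) : v^T *m v = 1%:M ->
  dot (v *m u) (v *m w) = dot u w.
Proof. by move=> vv; rewrite /dot trmx_mul mulmxA -(mulmxA u^T) vv mulmx1. Qed.

Lemma dot_adj n m (v : 'M[R]_(n, m)) (u : 'cV_m) (w : 'cV_n) :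
  dot u (v^T *m w) = dot (v *m u) w.
Proof. by rewrite /dot trmx_mul mulmxA. Qed.

End Reflections.

(** * The slice of the circle action and its coordinates *)

Section Slice.
Context {R : rcfType} (n m : nat).
Variables (J : 'M[R]_m) (e1 e2 : 'cV[R]_m).
Hypotheses (sJ : J^T = - J) (JJ : J *m J = - 1%:M) (Je1 : J *m e1 = e2).
Hypotheses (e11 : dot e1 e1 = 1) (e22 : dot e2 e2 = 1) (e12 : dot e1 e2 = 0).
Variable v : 'M[R]_(n, m).
Hypothesis vv : v^T *m v = 1%:M.

Let Je2 : J *m e2 = - e1.
Proof. by rewrite -Je1 mulmxA JJ mulNmx mul1mx. Qed.

Definition rotJ (a b : R) : 'M[R]_m := a *: 1%:M + b *: J.

Let p := v *m e1.
Let c := v *m e2.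
Let cc : dot c c = 1. Proof. by rewrite dot_isom. Qed.
Let pp : dot p p = 1. Proof. by rewrite dot_isom. Qed.
Let pc : dot p c = 0. Proof. by rewrite dot_isom. Qed.

(** [slice_re] and [slice_im] form a complex number, which the action of [rotJ a b] with $a^2+b^2=1$
    multiplies by $a-ib$. The slice consists of the [u] for which this number is real and
    positive. *)
Definition slice_re (u : 'M[R]_(n, m)) : R := dot (v *m e1) (u *m e1).
Definition slice_im (u : 'M[R]_(n, m)) : R := dot (v *m e1) (u *m e2).
Definition slice_rho u : R := slice_re u * slice_re u + slice_im u * slice_im u.
(* The point of the slice in the orbit of u. *)
Definition slice_norm u : 'M[R]_(n, m) :=
  (Num.sqrt (slice_rho u))^-1 *: (slice_re u *: u + slice_im u *: (u *m J)).

Lemma slice_normE u : slice_norm u =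
  u *m rotJ (slice_re u / Num.sqrt (slice_rho u)) (slice_im u / Num.sqrt (slice_rho u)).
Proof.
rewrite /slice_norm /rotJ mulmxDr -!scalemxAr mulmx1 scalerDr !scalerA.
by rewrite ![_^-1 * _]mulrC.
Qed.

Lemma slice_rho_unit u : 0 < slice_rho u ->
  (slice_re u / Num.sqrt (slice_rho u)) ^+ 2 +
  (slice_im u / Num.sqrt (slice_rho u)) ^+ 2 = 1.
Proof.
move=> r0; rewrite !expr_div_n sqr_sqrtr ?ltW // -mulrDl.
by rewrite 2!expr2 divff // gt_eqF.
Qed.

Section Rotate.
Variables (a b : R) (u : 'M[R]_(n, m)).

Lemma slice_re_rot : slice_re (u *m rotJ a b) = a * slice_re u + b * slice_im u.
Proof.
rewrite /slice_re /slice_im -mulmxA /rotJ mulmxDl -!scalemxAl mul1mx Je1.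
by rewrite mulmxDr -!scalemxAr dotDr !dotZr.
Qed.

Lemma slice_im_rot : slice_im (u *m rotJ a b) = a * slice_im u - b * slice_re u.
Proof.
rewrite /slice_re /slice_im -mulmxA /rotJ mulmxDl -!scalemxAl mul1mx Je2.
by rewrite mulmxDr scalerN mulmxN -!scalemxAr dotDr dotNr !dotZr.
Qed.

Lemma slice_rho_rot : a ^+ 2 + b ^+ 2 = 1 ->
  slice_rho (u *m rotJ a b) = slice_rho u.
Proof.
move=> ab; rewrite /slice_rho slice_re_rot slice_im_rot.
rewrite -[RHS]mul1r -ab; ring.
Qed.

Lemma slice_norm_rot : a ^+ 2 + b ^+ 2 = 1 ->
  slice_norm (u *m rotJ a b) = slice_norm u.
Proof.
move=> ab; rewrite /slice_norm slice_rho_rot // slice_re_rot slice_im_rot.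
congr (_ *: _); rewrite /rotJ mulmxDr -!scalemxAr mulmx1 mulmxDl -!scalemxAl.
rewrite -[u *m J *m J]mulmxA JJ mulmxN mulmx1.
apply/matrixP => i j; rewrite !(mxDE, mxNE, mxZE).
by rewrite -[RHS]mul1r -ab; ring.
Qed.

End Rotate.

Lemma slice_re_norm u : 0 < slice_rho u -> slice_re (slice_norm u) = Num.sqrt (slice_rho u).
Proof.
move=> r0; rewrite slice_normE slice_re_rot.
have s0 : 0 < Num.sqrt (slice_rho u) by rewrite sqrtr_gt0.
apply: (can_inj (mulfK (lt0r_neq0 s0))); rewrite -[RHS]expr2 sqr_sqrtr ?ltW //.
by rewrite /slice_rho; field; exact: lt0r_neq0.
Qed.

Lemma slice_im_norm u : slice_im (slice_norm u) = 0.
Proof. by rewrite slice_normE slice_im_rot; ring. Qed.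

Lemma slice_norm_id u : slice_im u = 0 -> 0 < slice_re u -> slice_norm u = u.
Proof.
move=> i0 r0; rewrite /slice_norm /slice_rho i0 mulr0 addr0 scale0r addr0.
by rewrite -expr2 sqrtr_sqr gtr0_norm // scalerA mulVf ?scale1r // gt_eqF.
Qed.

Definition slice_tang X := tang v X /\ dot (v *m e1) (X *m e2) = 0.

(** The second term makes the image of [e2] vanish; the third restores the skewness of $v^TX$, so
    that the result is tangent at [v] again. *)
Definition slice_rest (X : 'M[R]_(n, m)) : 'M[R]_(n, m) :=
  X - X *m e2 *m e2^T + v *m e2 *m (X *m e2)^T *m v.

(* The image of e2 must stay orthogonal to v e1, which the Cayley transform of X
   does not respect.  So use a Cayley transform which fixes c = v e2, and then two
   half-turns: these map c into the span of c and X e2. *)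
Definition slice_param (X : 'M[R]_(n, m)) : 'M[R]_(n, m) :=
  refl (v *m e2 + X *m e2) *m (refl (v *m e2) *m
    (cay (sk v (slice_rest X)) *m v)).

(** Stereographic projection, from the pole $-c$ with $c=$ [v *m e2], of the unit vector into which
    the normalised [u] maps [e2]. It recovers [X *m e2] from the image of [X] under
    [slice_param]. *)
Definition slice_beta (u : 'M[R]_(n, m)) : 'cV[R]_n :=
  let t := slice_norm u *m e2 in
  (1 + dot (v *m e2) t)^-1 *: (t + v *m e2) - v *m e2.

Definition slice_back (u : 'M[R]_(n, m)) : 'M[R]_(n, m) :=
  refl (v *m e2) *m (refl (v *m e2 + slice_beta u) *m slice_norm u).

Definition slice_coord (u : 'M[R]_(n, m)) : 'M[R]_(n, m) :=
  cayinv v (slice_back u) + slice_beta u *m e2^T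
    - v *m e2 *m (slice_beta u)^T *m v.

(** Where the three stages of [slice_coord] are defined: normalisation to the slice, stereographic
    projection (the pole is excluded), and the inverse Cayley transform. *)
Definition slice_dom (u : 'M[R]_(n, m)) : Prop :=
  [/\ 0 < slice_rho u, 1 + dot (v *m e2) (slice_norm u *m e2) != 0 &
      1%:M + v^T *m slice_back u \in unitmx].

(** The quadratic form of the skew matrix $v^TX$ vanishes at [e2]. *)
Lemma slice_tang_beta X : slice_tang X -> dot c (X *m e2) = 0.
Proof.
move=> [tX _]; have := congr1 (fun M => dot e2 (M *m e2)) tX.
rewrite mulmxDl mul0mx dot0r dotDr -!mulmxA !dot_adj (dotC (X *m e2)) -/c.
by move=> H; lra.
Qed.

Lemma slice_rest_tang X : slice_tang X -> tang v (slice_rest X).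
Proof.
move=> tX; have := slice_tang_beta tX; have [{}tX _] := tX.
rewrite /tang /slice_rest; move: (X *m e2) => b cb.
rewrite trD trB !trmx_mul !trmxK !(mulmxDr, mulmxDl, mulmxN, mulNmx) (tangE tX).
rewrite !mulmxA vv mul1mx -[_ *m v^T *m v]mulmxA vv mulmx1.
mx_lin.
Qed.

Lemma slice_rest_fix X : slice_tang X -> slice_rest X *m e2 = 0.
Proof.
move=> tX; have cb := slice_tang_beta tX.
rewrite /slice_rest mulmxDl mulmxBl mul_outer e22 scale1r subrr add0r.
by rewrite -mulmxA mul_outer dotC cb scale0r.
Qed.

Lemma refl_isom q (w : 'cV[R]_n) (A : 'M[R]_(n, q)) : dot w w != 0 ->
  (refl w *m A)^T *m (refl w *m A) = A^T *m A.
Proof.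
by move=> w0; rewrite trmx_mul refl_tr mulmxA -(mulmxA A^T) reflK // mulmx1.
Qed.

Let center_neq0 (b : 'cV[R]_n) : dot c b = 0 -> dot (c + b) (c + b) != 0.
Proof.
move=> cb; rewrite dotDl !dotDr cc cb (dotC b c) cb addr0 add0r.
by rewrite gt_eqF // ltr_pwDl // dot_ge0.
Qed.

Let c_neq0 : dot c c != 0. Proof. by rewrite cc oner_neq0. Qed.

Let refl_c : refl c *m c = c.
Proof. by rewrite refl_mul cc mulr1 divr1 scaler_nat mulr2n addrK. Qed.

Lemma slice_param_stiefel X : slice_tang X ->
  (slice_param X)^T *m slice_param X = 1%:M.
Proof.
move=> tX; have cb := slice_tang_beta tX.
rewrite refl_isom ?center_neq0 // refl_isom ?c_neq0 //.
by apply: cay_stiefel => //; exact/sk_skew/slice_rest_tang.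
Qed.

(** The Cayley factor and the first half-turn both fix $c=$ [v *m e2], so only the half-turn about
    $c+Xe_2$ moves it. The result is the inverse stereographic projection of $Xe_2$; it stays
    orthogonal to [v *m e1] because $c$ and $Xe_2$ both are. *)
Lemma slice_param_e2 X : slice_tang X ->
  slice_param X *m e2 =
  (2 / dot (c + X *m e2) (c + X *m e2)) *: (c + X *m e2) - c.
Proof.
move=> tX; rewrite /slice_param -(mulmxA (refl _)) -(mulmxA (refl _)).
rewrite -(mulmxA (cay _)) cay_fix //; last 2 first.
- exact: slice_rest_tang.
- exact: slice_rest_fix.
rewrite refl_c refl_mul; congr (_ / _ *: _ - _).
by rewrite dotDl cc dotC slice_tang_beta // addr0 mulr1.
Qed.

Lemma slice_param_im X : slice_tang X -> slice_im (slice_param X) = 0.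
Proof.
move=> tX; have [_ pX] := tX.
rewrite /slice_im slice_param_e2 // dotDr dotNr dotZr -/c.
by rewrite [dot (v *m e1) (c + _)]dotDr pX -/p pc addr0 mulr0 subr0.
Qed.

Lemma slice_paramK X : slice_tang X -> 0 < slice_re (slice_param X) ->
  slice_coord (slice_param X) = X.
Proof.
move=> tX X0; have cb := slice_tang_beta tX.
have nX : slice_norm (slice_param X) = slice_param X.
  by rewrite slice_norm_id ?slice_param_im.
have bX : slice_beta (slice_param X) = X *m e2.
  rewrite /slice_beta nX slice_param_e2 // -/c.
  have := center_neq0 cb; move: cb; move: (X *m e2) => b cb.
  move: (dot (c + b) (c + b)) => D D0.
  rewrite dotDr dotNr dotZr dotDr cc cb addr0 mulr1 subrK scalerA.
  have -> : (1 + (2 / D - 1))^-1 * (2 / D) = 1.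
    by rewrite addrC subrK mulVf // mulf_neq0 ?invr_eq0 ?pnatr_eq0.
  by rewrite scale1r; mx_lin.
have kX : slice_back (slice_param X) = cay (sk v (slice_rest X)) *m v.
  rewrite /slice_back bX nX /slice_param -/c.
  rewrite (mulmxA (refl (c + _))) reflK ?center_neq0 // mul1mx.
  by rewrite mulmxA reflK ?c_neq0 // mul1mx.
rewrite /slice_coord kX bX cayinvK //; last exact: slice_rest_tang.
by rewrite /slice_rest; mx_lin.
Qed.

Lemma rotJ_orth a b : a ^+ 2 + b ^+ 2 = 1 -> (rotJ a b)^T *m rotJ a b = 1%:M.
Proof.
move=> ab; rewrite /rotJ trD !trZ trmx1 sJ !(mulmxDl, mulmxDr).
rewrite -!scalemxAl -!scalemxAr !mulNmx JJ !mulmx1 !mul1mx opprK.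
apply/matrixP => i j; rewrite !(mxDE, mxNE, mxZE).
by rewrite -[RHS]mul1r -ab; ring.
Qed.

Section Coord.
Variable u : 'M[R]_(n, m).
Hypotheses (uu : u^T *m u = 1%:M) (du : slice_dom u).

Let w := slice_norm u.
Let t := w *m e2.
Let b := slice_beta u.
Let r0 : 0 < slice_rho u. Proof. by case: du. Qed.
Let ct : 1 + dot c t != 0. Proof. by case: du. Qed.

Lemma slice_norm_stiefel : w^T *m w = 1%:M.
Proof.
rewrite /w slice_normE trmx_mul mulmxA -(mulmxA _ u^T) uu mulmx1.
by rewrite rotJ_orth // slice_rho_unit.
Qed.

Let tt : dot t t = 1. Proof. by rewrite dot_isom ?slice_norm_stiefel. Qed.
Let pt : dot p t = 0. Proof. exact: slice_im_norm. Qed.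

Let cb : dot c b = 0.
Proof.
rewrite /b /slice_beta dotDr dotNr dotZr dotDr -/c cc -/w -/t.
by rewrite [dot c t + 1]addrC mulVf // subrr.
Qed.

Let pb : dot p b = 0.
Proof.
by rewrite /b /slice_beta dotDr dotNr dotZr dotDr -/c -/w -/t pc pt addr0 mulr0 subrr.
Qed.

Let cbE : c + b = (1 + dot c t)^-1 *: (t + c).
Proof. by rewrite /b /slice_beta -/c -/w -/t addrC subrK. Qed.

(** Here $c+b$ is a multiple of the sum of the unit vectors $t$ and $c$, so the half-turn about it
    exchanges them. *)
Let reflt : refl (c + b) *m t = c.
Proof.
have D1 : dot (c + b) t = 1 by rewrite cbE dotZl dotDl tt mulVf.
have D2 : dot (c + b) (c + b) = 2 / (1 + dot c t).
  by rewrite {2}cbE dotZr [dot (c + b) (t + c)]dotDr D1 dotDl cc (dotC b) cb; field.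
rewrite refl_mul D1 D2 cbE scalerA mulr1.
have -> : 2 / (2 / (1 + dot c t)) / (1 + dot c t) = 1.
  by rewrite invf_div mulrA mulrAC mulfK // divff // pnatr_eq0.
by rewrite scale1r; mx_lin.
Qed.

Let back_e2 : slice_back u *m e2 = c.
Proof. by rewrite /slice_back -!mulmxA -/w -/t -/c reflt refl_c. Qed.

Let back_stiefel : (slice_back u)^T *m slice_back u = 1%:M.
Proof.
rewrite /slice_back refl_isom ?c_neq0 // refl_isom ?center_neq0 //.
exact: slice_norm_stiefel.
Qed.

Let cay_e2 : cayinv v (slice_back u) *m e2 = 0.
Proof. by apply: cayinv_fix => //; case: du. Qed.

Let coord_e2 : slice_coord u *m e2 = b.
Proof.
rewrite /slice_coord mulmxBl mulmxDl cay_e2 add0r mul_outer e22 scale1r.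
by rewrite -[_ *m v *m e2]mulmxA mul_outer dotC cb scale0r subr0.
Qed.

Lemma slice_coord_tang : slice_tang (slice_coord u).
Proof.
split; last by rewrite coord_e2.
have : tang v (cayinv v (slice_back u)) by apply: cayinv_tang => //; case: du.
rewrite /slice_coord -/b /tang; move: (cayinv v _) => X tX; clearbody b.
rewrite trB trD !trmx_mul !trmxK !(mulmxDr, mulmxDl, mulmxN, mulNmx) (tangE tX).
rewrite !mulmxA vv mul1mx -[_ *m v^T *m v]mulmxA vv mulmx1.
by mx_lin.
Qed.

Lemma slice_coordK : slice_param (slice_coord u) = slice_norm u.
Proof.
rewrite /slice_param coord_e2.
have -> : slice_rest (slice_coord u) = cayinv v (slice_back u).
  by rewrite /slice_rest coord_e2 /slice_coord -/b; mx_lin.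
rewrite cay_cayinv //; last by case: du.
rewrite /slice_back -/b -/c (mulmxA (refl c)) reflK ?c_neq0 // mul1mx mulmxA.
by rewrite reflK ?center_neq0 // mul1mx.
Qed.

End Coord.

Lemma slice_dom_rot a b u : a ^+ 2 + b ^+ 2 = 1 ->
  slice_dom u -> slice_dom (u *m rotJ a b).
Proof.
move=> ab [H1 H2 H3].
have E := slice_norm_rot u ab.
have Eb : slice_beta (u *m rotJ a b) = slice_beta u by rewrite /slice_beta E.
have Ek : slice_back (u *m rotJ a b) = slice_back u by rewrite /slice_back Eb E.
by split; rewrite ?slice_rho_rot ?E ?Ek.
Qed.

Lemma slice_coord_rot a b u : a ^+ 2 + b ^+ 2 = 1 ->
  slice_coord (u *m rotJ a b) = slice_coord u.
Proof.
move=> ab; have E := slice_norm_rot u ab.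
have Eb : slice_beta (u *m rotJ a b) = slice_beta u by rewrite /slice_beta E.
have Ek : slice_back (u *m rotJ a b) = slice_back u by rewrite /slice_back Eb E.
by rewrite /slice_coord Eb Ek.
Qed.

Lemma slice_dom_center : slice_dom v.
Proof.
have re1 : slice_re v = 1 by exact: pp.
have im0 : slice_im v = 0 by exact: pc.
have vE : slice_norm v = v by rewrite slice_norm_id // re1.
have b0 : slice_beta v = 0.
  rewrite /slice_beta vE -/c cc; apply/matrixP => i j.
  by rewrite !(mxDE, mxNE, mxZE, mx0E); field.
have kE : slice_back v = v.
  by rewrite /slice_back b0 addr0 vE mulmxA reflK ?mul1mx.
split; first by rewrite /slice_rho re1 im0 mulr1 mulr0 addr0.
  by rewrite vE -/c cc -[1 + 1]/(2%:R) pnatr_eq0.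
have -> : 1%:M + v^T *m slice_back v = 2 *: 1%:M.
  by rewrite kE vv; apply/matrixP => i j; rewrite !(mxDE, mxZE); ring.
rewrite unitmxE detZ det1 mulr1 unitfE.
by rewrite expf_neq0 // pnatr_eq0.
Qed.

End Slice.

(** * Operations on vector bundles *)

Section MatrixContinuity.
Context {K : numFieldType} {T : topologicalType}.
Implicit Type y : T.

Lemma mx_continuousP p q (f : T -> 'M[K]_(p, q)) y :
  {for y, continuous f} <-> forall i j, {for y, continuous (fun x => f x i j)}.
Proof.
split=> [Hf i j|Hf].
  by apply: (@continuous_comp _ _ _ f (fun M : 'M[K]_(p, q) => M i j));
    [exact: Hf|exact: coord_continuous].
move=> A [P nP sPA]; rewrite /nbhs /=.
have : \forall x \near y, forall i j, P i j (f x i j).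
  by apply: filter_forall => i; apply: filter_forall => j; exact: Hf (nP i j).
by apply: filterS => x Hx; exact: sPA.
Qed.

Lemma continuous_near_eq (U : topologicalType) (f g : T -> U) y :
  (\forall x \near y, f x = g x) -> {for y, continuous f} -> {for y, continuous g}.
Proof.
move=> fg cf; have fgy : f y = g y by exact: nbhs_singleton fg.
have E : g @ y --> f y.
  by apply: cvg_trans (cf : f @ y --> f y); exact: near_eq_cvg.
by rewrite fgy in E.
Qed.

Lemma continuous_fun_ext (U : topologicalType) (f g : T -> U) y :
  f =1 g -> {for y, continuous f} -> {for y, continuous g}.
Proof. by move=> /funext ->. Qed.

Lemma continuous_sumr (I : Type) (r : seq I) (P : pred I) (F : I -> T -> K) y :
  (forall i, P i -> {for y, continuous (F i)}) ->
  {for y, continuous (fun x => \sum_(i <- r | P i) F i x)}.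
Proof.
move=> HF; elim: r => [|i r IH].
  by apply: (continuous_fun_ext (f := fun=> 0)) (@cvg_cst _ _ _ _ _) => x; rewrite big_nil.
have [Pi|Pi] := boolP (P i); last first.
  by apply: continuous_fun_ext IH => x; rewrite big_cons (negbTE Pi).
apply: (continuous_fun_ext (f := fun x => F i x + \sum_(i <- r | P i) F i x)).
  by move=> x; rewrite big_cons Pi.
by apply: cvgD; [exact: HF|exact: IH].
Qed.

Lemma continuous_cstmx p q (A : 'M[K]_(p, q)) y : {for y, continuous (fun=> A)}.
Proof. exact: cvg_cst. Qed.

Lemma continuous_mulmx p q r (f : T -> 'M[K]_(p, q)) (g : T -> 'M[K]_(q, r)) y :
  {for y, continuous f} -> {for y, continuous g} ->
  {for y, continuous (fun x => f x *m g x)}.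
Proof.
move=> /mx_continuousP Hf /mx_continuousP Hg; apply/mx_continuousP => i j.
apply: (continuous_fun_ext (f := fun x => \sum_k f x i k * g x k j)).
  by move=> x; rewrite mxE.
by apply: continuous_sumr => k _; apply: cvgM; [exact: Hf|exact: Hg].
Qed.

Lemma continuous_addmx p q (f g : T -> 'M[K]_(p, q)) y :
  {for y, continuous f} -> {for y, continuous g} ->
  {for y, continuous (fun x => f x + g x)}.
Proof. by move=> Hf Hg; apply: cvgD; [exact: Hf|exact: Hg]. Qed.

Lemma continuous_oppmx p q (f : T -> 'M[K]_(p, q)) y :
  {for y, continuous f} -> {for y, continuous (fun x => - f x)}.
Proof. by move=> Hf; apply: cvgN; exact: Hf. Qed.

Lemma continuous_scalemx p q (c : T -> K) (f : T -> 'M[K]_(p, q)) y :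
  {for y, continuous c} -> {for y, continuous f} ->
  {for y, continuous (fun x => c x *: f x)}.
Proof. by move=> Hc Hf; apply: cvgZ; [exact: Hc|exact: Hf]. Qed.

Lemma continuous_invr (f : T -> K) y : f y != 0 ->
  {for y, continuous f} -> {for y, continuous (fun x => (f x)^-1)}.
Proof. by move=> f0 cf; apply: cvgV => //; exact: cf. Qed.

Lemma continuous_summx (I : Type) (r : seq I) (P : pred I) p q
    (F : I -> T -> 'M[K]_(p, q)) y :
  (forall i, P i -> {for y, continuous (F i)}) ->
  {for y, continuous (fun x => \sum_(i <- r | P i) F i x)}.
Proof.
move=> HF; apply/mx_continuousP => a b.
apply: (continuous_fun_ext (f := fun x => \sum_(i <- r | P i) F i x a b)).
  by move=> x; rewrite summxE.
by apply: continuous_sumr => i Pi; move/mx_continuousP: (HF i Pi); apply.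
Qed.

Lemma continuous_trmx p q (f : T -> 'M[K]_(p, q)) y :
  {for y, continuous f} -> {for y, continuous (fun x => (f x)^T)}.
Proof.
move=> /mx_continuousP Hf; apply/mx_continuousP => i j.
by apply: continuous_fun_ext (Hf j i) => x; rewrite mxE.
Qed.

Lemma continuous_tensmx p q r s (f : T -> 'M[K]_(p, q)) (g : T -> 'M[K]_(r, s)) y :
  {for y, continuous f} -> {for y, continuous g} ->
  {for y, continuous (fun x => tensmx (f x) (g x))}.
Proof.
move=> /mx_continuousP Hf /mx_continuousP Hg; apply/mx_continuousP => i j.
case: (mxtens_indexP i) => a b; case: (mxtens_indexP j) => a' b'.
apply: (continuous_fun_ext (f := fun x => f x a a' * g x b b')).
  by move=> x; rewrite tensmxE.
by apply: cvgM; [exact: Hf|exact: Hg].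
Qed.

Lemma continuous_block_mx p1 p2 q1 q2 (f : T -> 'M[K]_(p1, q1))
    (g : T -> 'M[K]_(p2, q2)) y :
  {for y, continuous f} -> {for y, continuous g} ->
  {for y, continuous (fun x => block_mx (f x) 0 0 (g x))}.
Proof.
move=> /mx_continuousP Hf /mx_continuousP Hg; apply/mx_continuousP => i j.
case: (split_ordP i) => a ->; case: (split_ordP j) => b ->.
- by apply: continuous_fun_ext (Hf a b) => x; rewrite block_mxEul.
- apply: (continuous_fun_ext (f := fun=> 0)) (@cvg_cst _ _ _ _ _) => x.
  by rewrite block_mxEur mxE.
- apply: (continuous_fun_ext (f := fun=> 0)) (@cvg_cst _ _ _ _ _) => x.
  by rewrite block_mxEdl mxE.
- by apply: continuous_fun_ext (Hg a b) => x; rewrite block_mxEdr.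
Qed.

End MatrixContinuity.

Lemma mul_block_diag_mx (R : pzRingType) p1 q1 r1 p2 q2 r2 (A : 'M[R]_(p1, q1))
    (B : 'M[R]_(p2, q2)) (C : 'M[R]_(q1, r1)) (D : 'M[R]_(q2, r2)) :
  block_mx A 0 0 B *m block_mx C 0 0 D = block_mx (A *m C) 0 0 (B *m D).
Proof. by rewrite mulmx_block !mulmx0 !mul0mx !addr0 !add0r. Qed.

Lemma tensmx11 (R : comNzRingType) p q :
  tensmx (1%:M : 'M[R]_p) (1%:M : 'M[R]_q) = 1%:M.
Proof.
apply/matrixP => i j.
case: (mxtens_indexP i) => a b; case: (mxtens_indexP j) => a' b'.
rewrite tensmxE !mxE -natrM mulnb; congr (nat_of_bool _)%:R.
by rewrite (can_eq (@mxtens_indexK _ _)) xpair_eqE.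
Qed.

(** * Sums, tensor products and composition of isomorphisms *)

Section BundleTheory.
Context {K : numFieldType} {B : topologicalType}.
Implicit Types E F G : vbundle K B.

Lemma trivial_is_vbundle r : is_vbundle (@trivial_bundle K B r).
Proof.
split=> [i|y|i j y _ _|//|i j l y _ _ _] /=; first exact: openT.
- by exists tt.
- exact: cvg_cst.
- by rewrite mulmx1.
Qed.

Lemma whitney_is_vbundle E F : is_vbundle E -> is_vbundle F ->
  is_vbundle (whitney E F).
Proof.
move=> [E1 E2 E3 E4 E5] [F1 F2 F3 F4 F5].
split=> [[i i']|y|[i i'] [j j'] y /= [? ?] [? ?]|[i i'] y /= [? ?]|
    [i i'] [j j'] [l l'] y /= [? ?] [? ?] [? ?]].
- exact: openI.
- by have [i Ei] := E2 y; have [j Fj] := F2 y; exists (i, j).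
- by apply: continuous_block_mx; [exact: E3|exact: F3].
- by rewrite E4 // F4 // -scalar_mx_block.
- by rewrite mul_block_diag_mx E5 // F5.
Qed.

Lemma tensor_is_vbundle E F : is_vbundle E -> is_vbundle F ->
  is_vbundle (tensor E F).
Proof.
move=> [E1 E2 E3 E4 E5] [F1 F2 F3 F4 F5].
split=> [[i i']|y|[i i'] [j j'] y /= [? ?] [? ?]|[i i'] y /= [? ?]|
    [i i'] [j j'] [l l'] y /= [? ?] [? ?] [? ?]].
- exact: openI.
- by have [i Ei] := E2 y; have [j Fj] := F2 y; exists (i, j).
- by apply: continuous_tensmx; [exact: E3|exact: F3].
- by rewrite E4 // F4 // tensmx11.
- by rewrite tensmx_mul E5 // F5.
Qed.

Lemma bundle_iso_sym E F : bundle_iso E F -> bundle_iso F E.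
Proof.
move=> [vE vF [h [h' [Hh Hh' H]]]]; split=> //; exists h', h; split=> //.
by move=> i j y Ey Fy; have [] := H j i y Fy Ey.
Qed.

(** Composing coordinate matrices requires a trivialisation of [F] at each point; [ch] chooses one
    with no continuity. The product is independent of the choice, so near a given point it may be
    computed with one fixed trivialisation, which yields continuity. *)
Lemma bundle_iso_trans E F G : bundle_iso E F -> bundle_iso F G -> bundle_iso E G.
Proof.
move=> [vE vF [h [h' [[Hh1 Hh2] [Hh'1 Hh'2] H]]]].
move=> [_ vG [k [k' [[Hk1 Hk2] [Hk'1 Hk'2] Hk]]]].
have [oF cF _ oneF _] := vF; have [oE _ _ oneE _] := vE; have [oG _ _ oneG _] := vG.
have [ch Hch] := choice cF.
have kh i j l y : vdom i y -> vdom j y -> vdom l y ->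
    k i (ch y) y *m h (ch y) l y = k i j y *m h j l y.
  move=> Gi Fj El.
  rewrite (Hk2 i i j (ch y) y) ?(Hh2 j (ch y) l l y) //.
  rewrite (oneG _ _ Gi) (oneE _ _ El) mul1mx mulmx1 -!mulmxA; congr (_ *m _).
  have [_ _ _ _ cocF] := vF.
  by rewrite !mulmxA cocF // oneF // mul1mx.
have h'k' i j l y : vdom i y -> vdom j y -> vdom l y ->
    h' l (ch y) y *m k' (ch y) i y = h' l j y *m k' j i y.
  move=> Gi Fj El.
  rewrite (Hk'2 j (ch y) i i y) ?(Hh'2 l l j (ch y) y) //.
  rewrite (oneG _ _ Gi) (oneE _ _ El) mul1mx mulmx1 -!mulmxA; congr (_ *m _).
  have [_ _ _ _ cocF] := vF.
  by rewrite !mulmxA cocF // oneF // mul1mx.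
split=> //; exists (fun i l y => k i (ch y) y *m h (ch y) l y),
  (fun l i y => h' l (ch y) y *m k' (ch y) i y); split.
- split=> [i l y Gi El|i i' l l' y Gi Gi' El El'].
    apply: (continuous_near_eq (f := fun x => k i (ch y) x *m h (ch y) l x)).
      have nF := open_nbhs_nbhs (conj (oF (ch y)) (Hch y)).
      have nE := open_nbhs_nbhs (conj (oE l) El).
      have nG := open_nbhs_nbhs (conj (oG i) Gi).
      apply: filterS3 nF nE nG => x Fx Ex Gx.
      by rewrite -(kh i (ch y) l).
    by apply: continuous_mulmx; [exact: Hk1|exact: Hh1].
  rewrite (Hk2 i i' (ch y) (ch y)) // (Hh2 (ch y) (ch y) l l') //.
  by rewrite oneF // mulmx1 mul1mx !mulmxA.
- split=> [l i y El Gi|l l' i i' y El El' Gi Gi'].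
    apply: (continuous_near_eq (f := fun x => h' l (ch y) x *m k' (ch y) i x)).
      have nF := open_nbhs_nbhs (conj (oF (ch y)) (Hch y)).
      have nE := open_nbhs_nbhs (conj (oE l) El).
      have nG := open_nbhs_nbhs (conj (oG i) Gi).
      apply: filterS3 nF nE nG => x Fx Ex Gx.
      by rewrite -(h'k' i (ch y) l).
    by apply: continuous_mulmx; [exact: Hh'1|exact: Hk'1].
  rewrite (Hh'2 l l' (ch y) (ch y)) // (Hk'2 (ch y) (ch y) i i') //.
  by rewrite oneF // mulmx1 mul1mx !mulmxA.
- move=> i l y Gi El; have [H1 H2] := H (ch y) l y (Hch y) El.
  have [H3 H4] := Hk i (ch y) y Gi (Hch y); split.
    by rewrite mulmxA -(mulmxA _ (k' _ _ _)) H3 mulmx1.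
  by rewrite mulmxA -(mulmxA _ (h _ _ _)) H2 mulmx1.
Qed.

Lemma whitney_isol E F G : is_vbundle G -> bundle_iso E F ->
  bundle_iso (whitney E G) (whitney F G).
Proof.
move=> vG [vE vF [h [h' [[Hh1 Hh2] [Hh'1 Hh'2] H]]]].
have [oG _ cG oneG cocG] := vG.
split; [exact: whitney_is_vbundle|exact: whitney_is_vbundle|].
exists (fun i j y => block_mx (h i.1 j.1 y) 0 0 (vtrans i.2 j.2 y)),
  (fun j i y => block_mx (h' j.1 i.1 y) 0 0 (vtrans j.2 i.2 y)); split.
- split=> [[i a] [j b] y /= [? ?] [? ?]|
      [i a] [i' a'] [j b] [j' b'] y /= [? ?] [? ?] [? ?] [? ?]].
    by apply: continuous_block_mx; [exact: Hh1|exact: cG].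
  by rewrite !mul_block_diag_mx -Hh2 // !cocG.
- split=> [[i a] [j b] y /= [? ?] [? ?]|
      [i a] [i' a'] [j b] [j' b'] y /= [? ?] [? ?] [? ?] [? ?]].
    by apply: continuous_block_mx; [exact: Hh'1|exact: cG].
  by rewrite !mul_block_diag_mx -Hh'2 // !cocG.
- move=> [i a] [j b] y /= [? ?] [? ?]; rewrite !mul_block_diag_mx !cocG // !oneG //.
  by have [] := H i j y => // -> ->; rewrite -!scalar_mx_block.
Qed.

End BundleTheory.

Lemma pullback_is_vbundle (K : numFieldType) (B B' : topologicalType)
    (f : B' -> B) (E : vbundle K B) : continuous f -> is_vbundle E ->
  is_vbundle (pullback f E).
Proof.
move=> cf [E1 E2 E3 E4 E5]; split=> [i|y|i j y Ei Ej|i y|i j l y] /=.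
- by apply: open_comp => // x _; exact: cf.
- exact: E2.
- exact: (@continuous_comp _ _ _ f (@vtrans _ _ E i j) y (cf y) (E3 _ _ _ Ei Ej)).
- exact: E4.
- exact: E5.
Qed.

Section Subbundle.
Context {R : realType} {B : topologicalType} (N r : nat).
Variable fib : B -> set 'cV[R]_N.

Lemma frame_fib (e : local_frame r fib) y c : frame_dom e y -> fib y (e y *m c).
Proof. by move=> ey; apply/(frame_span ey); exists c. Qed.

Lemma frame_proj (e e' : local_frame r fib) y : frame_dom e y ->
  frame_dom e' y -> e y *m ((e y)^T *m e' y) = e' y.
Proof.
move=> ey ey'; apply/trmx_inj/row_matrixP => j; rewrite -!tr_col; congr trmx.
rewrite !colE -!mulmxA.
have [c ->] := (frame_span ey _).1 (frame_fib (delta_mx j 0) ey').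
by rewrite (mulmxA _ _ c) (frame_orthonormal ey) mul1mx.
Qed.

Lemma subbundle_is_vbundle :
  (forall y, exists e : local_frame r fib, frame_dom e y) ->
  is_vbundle (subbundle r fib).
Proof.
move=> cov; split=> [i|y|i j y Ei Ej|i y Ei|i j l y Ei Ej El] /=.
- exact: frame_open.
- exact: cov.
- apply: continuous_mulmx; last exact: frame_continuous.
  by apply: continuous_trmx; exact: frame_continuous.
- exact: frame_orthonormal.
- by rewrite -mulmxA frame_proj.
Qed.

End Subbundle.

(** * Orbit spaces *)

Section OrbitSpaces.
Context {R : realType} (n m : nat).
Implicit Types v w : stiefel R n m.

Lemma stiefelP v : (\val v)^T *m \val v = 1%:M.
Proof. by case: v => M /= /set_mem. Qed.

Definition to_stiefel (M : 'M[R]_(n, m)) (h : M^T *m M = 1%:M) : stiefel R n m :=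
  exist _ M (mem_set h).

Lemma val_continuous : continuous (fun v => \val v).
Proof. exact: initial_continuous. Qed.

Lemma stiefel_continuous (T : topologicalType) (f : T -> stiefel R n m) y :
  {for y, continuous (fun x => \val (f x))} -> {for y, continuous f}.
Proof.
move=> cf A /= [U [[W oW <-] /= Wfy] sUA].
apply: (@filterS _ _ _ (f @^-1` (val @^-1` W))); first by move=> x /sUA.
exact: cf (open_nbhs_nbhs (conj oW Wfy)).
Qed.

Variable G : osubgroup (R := R) m.

Local Notation pi := (orbit_proj G).

Lemma orbit_projP v w :
  pi v = pi w <-> exists2 g, oset G g & \val w = \val v *m g.
Proof.
split=> H; last exact/(@eqmodP _ (same_orbit_equiv n G) v w)/asboolP.
exact/asboolP/(@eqmodP _ (same_orbit_equiv n G) v w).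
Qed.

Lemma orbit_projK (y : orbit_space n G) : pi (repr y) = y.
Proof. exact: reprK. Qed.

Lemma orbit_proj_continuous :
  continuous (pi : stiefel R n m -> orbit_space n G).
Proof. exact: pi_continuous. Qed.

Lemma act_stiefel v g : oset G g -> (\val v *m g)^T *m (\val v *m g) = 1%:M.
Proof.
by move=> Gg; rewrite trmx_mul mulmxA -(mulmxA g^T) stiefelP mulmx1 (osetO Gg).
Qed.

Definition act v g (Gg : oset G g) : stiefel R n m := to_stiefel (act_stiefel v Gg).

Lemma orbit_proj_act v g (Gg : oset G g) : pi (act v Gg) = pi v.
Proof. by apply/esym/orbit_projP; exists g. Qed.

Lemma orbit_proj_open (O : set (stiefel R n m)) : open O -> open (pi @` O).
Proof.
move=> oO; rewrite /open /= /quotient_open /=.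
rewrite openE => w [v Ov /orbit_projP[g Gg wE]]; rewrite /interior.
have Gt := osetV Gg.
have cact : {for w, continuous (fun u => act u Gt)}.
  apply: stiefel_continuous => /=.
  by apply: continuous_mulmx; [exact: val_continuous|exact: continuous_cstmx].
have actw : act w Gt = v.
  apply: val_inj => /=; rewrite wE -mulmxA (mulmx1C (osetO Gg)) ?mulmx1 //.
have : nbhs (act w Gt) O by rewrite actw; exact: open_nbhs_nbhs.
move=> /cact nw.
apply: (@filterS _ (nbhs w) _ (fun u => O (act u Gt))) nw => u Ou.
by exists (act u Gt) => //; exact: orbit_proj_act.
Qed.

(** Continuity at a single point does not descend along an arbitrary quotient map; it does here
    because the orbit projection is open. *)
Lemma orbit_continuous (T : topologicalType) (f : orbit_space n G -> T) v :
  {for v, continuous (f \o pi)} -> {for pi v, continuous f}.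
Proof.
move=> cf A nA; have : nbhs v ((f \o pi) @^-1` A) by exact: cf nA.
rewrite nbhsE => -[U [oU Uv] sU].
apply: (@filterS _ (nbhs (pi v)) _ (pi @` U) (f @^-1` A)).
  by move=> _ [u Uu <-]; exact: sU.
by apply: open_nbhs_nbhs; split; [exact: orbit_proj_open|exists v].
Qed.

Lemma orbit_near v (P : set (orbit_space n G)) : open P -> P (pi v) ->
  \forall u \near v, P (pi u).
Proof.
by move=> oP Pv; apply: orbit_proj_continuous; exact: open_nbhs_nbhs.
Qed.

End OrbitSpaces.

(** * Inverses and left inverses that depend continuously on the matrix *)

Section Inverses.
Context {R : realType}.

Lemma continuous_invmx (T : topologicalType) p (f : T -> 'M[R]_p) y :
  f y \in unitmx -> {for y, continuous f} -> {for y, continuous (fun x => invmx (f x))}.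
Proof.
move=> fy cf; apply: (@continuous_comp _ _ _ f invmx); first exact: cf.
have sid : smooth_mx setT (@id 'M[R]_p) by exact: smooth_mx_id.
have oD := open_neq0 openT (smooth_det openT sid).
apply: (smooth_mx_continuous (O := [set M : 'M[R]_p | setT M /\ \det M != 0])).
  apply: (smooth_mxV oD) => [x []//|].
  exact: smooth_mx_id.
by split=> //=; rewrite -unitfE -unitmxE.
Qed.

Lemma open_unitmx p : open [set A : 'M[R]_p | A \in unitmx].
Proof.
have oD := open_neq0 openT (smooth_det openT (@smooth_mx_id R p p setT)).
rewrite (_ : [set A | _] = [set A : 'M[R]_p | setT A /\ \det A != 0]) //.
by apply/seteqP; split=> A /=; rewrite unitmxE unitfE => // -[].
Qed.

Lemma mulmx1_eqdim p q (A : 'M[R]_(p, q)) (C : 'M[R]_(q, p)) :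
  p = q -> A *m C = 1%:M -> C *m A = 1%:M.
Proof. by move=> pq; move: A C; rewrite pq => A C; exact: mulmx1C. Qed.

(** The Gram matrix formula for a left inverse. It stands in for [invmx] because the ranks of two
    bundles are equal only propositionally, and it is continuous where [A] is injective. *)
Definition linv p q (A : 'M[R]_(p, q)) : 'M[R]_(q, p) := invmx (A^T *m A) *m A^T.

Lemma gram_unit p q (A : 'M[R]_(p, q)) :
  (forall x : 'cV_q, A *m x = 0 -> x = 0) -> A^T *m A \in unitmx.
Proof.
move=> Ai; apply: unitmx_inj => w Hw; apply: Ai; apply: tr_mulmx_eq0.
by rewrite trmx_mul -mulmxA (mulmxA A^T) Hw mulmx0.
Qed.

Lemma linvK p q (A : 'M[R]_(p, q)) :
  (forall x : 'cV_q, A *m x = 0 -> x = 0) -> linv A *m A = 1%:M.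
Proof. by move=> /gram_unit U; rewrite /linv -mulmxA mulVmx. Qed.

End Inverses.

(** * Descent of isomorphisms to the orbit space *)

Section Gluing.
Context {R : realType} (n m : nat) (G : osubgroup (R := R) m).
Local Notation B := (orbit_space n G).
Local Notation pi := (orbit_proj G).

(* An isomorphism over the orbit space from an invariant family of isomorphisms
   over the total space. *)
Lemma bundle_iso_glue (E F : vbundle R B)
    (H : stiefel R n m -> vidx F -> vidx E -> 'M[R]_(vrank F, vrank E)) :
  is_vbundle E -> is_vbundle F -> vrank F = vrank E ->
  (forall i j v, vdom i (pi v) -> vdom j (pi v) ->
     {for v, continuous (fun u => H u i j)}) ->
  (forall i j v w, vdom i (pi v) -> vdom j (pi v) -> pi v = pi w ->
     H v i j = H w i j) ->
  (forall i i' j j' v, vdom i (pi v) -> vdom i' (pi v) -> vdom j (pi v) ->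
     vdom j' (pi v) ->
     H v i' j' = vtrans i' i (pi v) *m H v i j *m vtrans j j' (pi v)) ->
  (forall i j v (x : 'cV_(vrank E)), vdom i (pi v) -> vdom j (pi v) ->
     H v i j *m x = 0 -> x = 0) ->
  bundle_iso E F.
Proof.
move=> vE vF rEF cH iH tH inj.
have [oE _ _ oneE cocE] := vE; have [oF _ _ oneF cocF] := vF.
pose h i j (y : B) := H (repr y) i j.
have hE (i : vidx F) (j : vidx E) v : vdom i (pi v) -> vdom j (pi v) -> h i j (pi v) = H v i j.
  by move=> Fi Ej; rewrite /h; apply: iH; rewrite orbit_projK.
have linvh (i : vidx F) (j : vidx E) y : vdom i y -> vdom j y ->
    linv (h i j y) *m h i j y = 1%:M.
  move=> Fi Ej; apply: linvK => x.
  by rewrite -(orbit_projK y) in Fi Ej *; rewrite hE //; exact: inj.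
have hlinv (i : vidx F) (j : vidx E) y : vdom i y -> vdom j y ->
    h i j y *m linv (h i j y) = 1%:M.
  by move=> Fi Ej; apply: mulmx1_eqdim; [|exact: linvh].
have ch (i : vidx F) (j : vidx E) y : vdom i y -> vdom j y -> {for y, continuous (h i j)}.
  rewrite -(orbit_projK y) => Fi Ej; apply: orbit_continuous.
  apply: (continuous_near_eq (f := fun u => H u i j)); last exact: cH.
  have nF := orbit_near (oF i) Fi; have nE := orbit_near (oE j) Ej.
  by apply: filterS2 nF nE => u Fu Eu; rewrite /= hE.
have th (i i' : vidx F) (j j' : vidx E) y : vdom i y -> vdom i' y -> vdom j y -> vdom j' y ->
    h i' j' y = vtrans i' i y *m h i j y *m vtrans j j' y.
  by rewrite -(orbit_projK y) => Fi Fi' Ej Ej'; rewrite !hE //; exact: tH.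
split=> //; exists h, (fun j i y => linv (h i j y)); split.
- by split; [exact: ch|exact: th].
- split=> [j i y Ej Fi|j j' i i' y Ej Ej' Fi Fi'].
    have ct : {for y, continuous (fun x => (h i j x)^T)}.
      by apply: continuous_trmx; exact: ch.
    apply: (continuous_mulmx _ ct); apply: continuous_invmx.
      apply: gram_unit => x Hx; rewrite -[x]mul1mx -(linvh i j y Fi Ej).
      by rewrite -mulmxA Hx mulmx0.
    by apply: (continuous_mulmx ct); exact: ch.
  set C := _ *m _ *m _.
  (* A left inverse of an invertible matrix is unique, so the transformation law of the inverses
     follows from that of [h]. *)
  suff E1 : C *m h i' j' y = 1%:M.
    by rewrite -[LHS]mul1mx -E1 -mulmxA hlinv // mulmx1.
  rewrite (th i i' j j') // /C {C}.
  have := linvh i j y Fi Ej; move: (linv (h i j y)) => L LE.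
  rewrite !mulmxA -(mulmxA _ (vtrans i i' y)) cocF //.
  rewrite oneF // mulmx1 -(mulmxA _ L) LE mulmx1.
  by rewrite cocE // oneE.
- by move=> i j y Fi Ej; rewrite linvh // hlinv.
Qed.

End Gluing.

(** * The projection to the flag manifold *)

Section FlagProjection.
Context {R : realType} (n k : nat).

Lemma circle_blocks (r : 'M[R]_2) : diag_circle k r = diag_blocks (fun=> r).
Proof.
rewrite /diag_circle /diag_blocks; apply/matrixP => i j.
case: (mxtens_indexP i) => a b; case: (mxtens_indexP j) => a' b'.
rewrite -[RHS]/(diag_blocks _ _ _) diag_blocksE tensmxE mxE.
by case: eqP; rewrite ?mul1r ?mul0r.
Qed.

Lemma q_proj (v : stiefel R n (k * 2)) :
  q (orbit_proj (circle R k) v) = orbit_proj (O2_power R k) v.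
Proof.
apply/orbit_projP; have /orbit_projP[_ [r [rO _] <-] ->] :=
  orbit_projK (orbit_proj (circle R k) v).
by exists (diag_blocks (fun=> r)); [exists (fun=> r)|rewrite circle_blocks].
Qed.

Lemma q_continuous : continuous (@q R n k).
Proof.
move=> y; rewrite -(orbit_projK y); apply: orbit_continuous.
apply: (continuous_fun_ext (f := orbit_proj (O2_power R k))).
  by move=> v; rewrite /= q_proj.
exact: orbit_proj_continuous.
Qed.

End FlagProjection.

(** * Gram-Schmidt orthonormalisation and its continuity *)

Section GramSchmidt.
Context {R : realType} (N : nat).

Fixpoint gram_schmidt (r : nat) : 'M[R]_(N, r) -> 'M[R]_(N, r) :=
  if r is s.+1 return 'M[R]_(N, r) -> 'M[R]_(N, r) then
    fun A : 'M[R]_(N, 1 + s) =>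
      let u := (Num.sqrt (dot (lsubmx A) (lsubmx A)))^-1 *: lsubmx A in
      row_mx u (gram_schmidt (rsubmx A - u *m (u^T *m rsubmx A)))
  else id.

(** Injectivity of [A] keeps the norms in the denominators nonzero. The factorisation through [A] is
    carried along because it gives the orthogonality of the later columns to the first one, and
    because it keeps the result inside the column space of [A]. *)
Lemma gram_schmidtP r (A : 'M[R]_(N, r)) :
  (forall x : 'cV_r, A *m x = 0 -> x = 0) ->
  [/\ (gram_schmidt A)^T *m gram_schmidt A = 1%:M,
      exists C, gram_schmidt A = A *m C &
      {for A, continuous (@gram_schmidt r)}].
Proof.
elim: r A => [|r IH] A inj.
  split; first by apply/matrixP => -[].
    by exists 0; apply/matrixP => ? -[].
  exact: cvg_id.
rewrite -[r.+1]/(1 + r)%N in A inj *.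
rewrite /=; set a := lsubmx A; set B := rsubmx A.
have AE : A = row_mx a B by rewrite hsubmxK.
have aa0 : 0 < dot a a.
  rewrite lt_neqAle dot_ge0 andbT; apply/negP => /eqP/esym/dot_eq0 a0.
  have := inj (col_mx 1%:M 0).
  rewrite AE mul_row_col a0 mul0mx mulmx0 addr0 => /(_ erefl).
  move=> /(congr1 usubmx); rewrite col_mxKu linear0 => /matrixP/(_ 0 0).
  by rewrite !mxE => /eqP; rewrite oner_eq0.
pose u (X : 'M[R]_(N, 1 + r)) :=
  (Num.sqrt (dot (lsubmx X) (lsubmx X)))^-1 *: lsubmx X.
pose B' (X : 'M[R]_(N, 1 + r)) := rsubmx X - u X *m ((u X)^T *m rsubmx X).
rewrite -/(u A) -/(B' A).
have uu : (u A)^T *m u A = 1%:M.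
  rewrite dotE /u dotZl dotZr mulrA -invfM -expr2 sqr_sqrtr ?ltW //.
  by rewrite mulVf // gt_eqF.
(* Since the lower part of [c1] vanishes, that of [c2] below is the identity; this passes
   injectivity on to the remaining columns. *)
have [c1 [uC c1d]] : exists c1, u A = A *m c1 /\ dsubmx c1 = 0.
  exists (col_mx (Num.sqrt (dot a a))^-1%:M 0); rewrite col_mxKd; split=> //.
  by rewrite {2}AE mul_row_col mulmx0 addr0 mul_mx_scalar.
have AB : A *m col_mx 0 1%:M = B.
  by rewrite {1}AE mul_row_col mulmx0 add0r mulmx1.
pose c2 := col_mx 0 1%:M - c1 *m ((u A)^T *m B).
have BC : B' A = A *m c2 by rewrite mulmxBr AB (mulmxA A) -uC.
have injB (x : 'cV_r) : B' A *m x = 0 -> x = 0.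
  rewrite BC -mulmxA => /inj /(congr1 dsubmx).
  rewrite mulmxBl linearB /= -[c1 *m _ *m _]mulmxA -!mul_dsub_mx c1d mul0mx subr0.
  by rewrite col_mxKd mul1mx linear0.
have [gg [C gC] cg] := IH _ injB.
split.
- rewrite tr_row_mx mul_col_row uu gg.
  have ug : (u A)^T *m gram_schmidt (B' A) = 0.
    have uB : (u A)^T *m B' A = 0.
      by rewrite [B' A]/(_ - _) mulmxBr (mulmxA _ (u A)) uu mul1mx subrr.
    by rewrite gC mulmxA uB mul0mx.
  have -> : (gram_schmidt (B' A))^T *m u A = 0.
    by rewrite -[LHS]trmxK trmx_mul trmxK ug trmx0.
  rewrite ug.
  by rewrite -scalar_mx_block.
- by exists (row_mx c1 (c2 *m C)); rewrite mul_mx_row -uC mulmxA -BC -gC.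
- have cl : {for A, continuous (fun X : 'M[R]_(N, 1 + r) => lsubmx X)}.
    exact: continuous_lsubmx.
  have cr : {for A, continuous (fun X : 'M[R]_(N, 1 + r) => rsubmx X)}.
    exact: continuous_rsubmx.
  have cu : {for A, continuous u}.
    apply: (continuous_scalemx _ cl); apply: continuous_invr.
      by rewrite gt_eqF // sqrtr_gt0.
    apply: (@continuous_comp _ _ _
      (fun X : 'M[R]_(N, 1 + r) => dot (lsubmx X) (lsubmx X)) Num.sqrt).
      have ct := continuous_mulmx (continuous_trmx cl) cl.
      by move/mx_continuousP: ct; apply.
    exact: sqrt_continuous.
  have cB : {for A, continuous B'}.
    apply: (continuous_addmx cr); apply: continuous_oppmx.
    by apply: (continuous_mulmx cu); exact: (continuous_mulmx (continuous_trmx cu) cr).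
  have cgB : {for A, continuous (fun X => gram_schmidt (B' X))}.
    exact: (@continuous_comp _ _ _ B' (@gram_schmidt r) A cB cg).
  apply/mx_continuousP => i j; case: (split_ordP j) => l ->.
    move/mx_continuousP: cu => /(_ i l); apply: continuous_fun_ext => X.
    by rewrite row_mxEl.
  move/mx_continuousP: cgB => /(_ i l); apply: continuous_fun_ext => X.
  by rewrite row_mxEr.
Qed.

End GramSchmidt.

(** * Local frames of the last canonical bundle *)

Section Flags.
Context {R : realType} (n k : nat).
Hypothesis kn : (k * 2 <= n)%N.
Local Notation pi := (orbit_proj (O2_power R k)).
Local Notation fib := (fun y : flags R n k => [set x : 'cV[R]_n |
  forall v : stiefel R n (k * 2), pi v = y -> (\val v)^T *m x = 0]).

Lemma orthocomplement_basis (v : 'M[R]_(n, k * 2)) : v^T *m v = 1%:M ->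
  exists e0 : 'M[R]_(n, n - k * 2), v^T *m e0 = 0 /\
    (forall x : 'cV_(n - k * 2), e0 *m x = 0 -> x = 0).
Proof.
move=> vv; have rv : \rank v = (k * 2)%N.
  rewrite -mxrank_tr; apply/eqP; rewrite -[_ == _]/(row_free v^T).
  by apply/row_freeP; exists v.
have rk : \rank (kermx v) = (n - k * 2)%N by rewrite mxrank_ker rv.
exists (castmx (rk, erefl n) (row_base (kermx v)))^T; split.
  apply: trmx_inj; rewrite trmx_mul !trmxK trmx0.
  have : row_base (kermx v) *m v = 0 by apply/sub_kermxP; rewrite eq_row_base.
  by move: (row_base _) rk => A; case: _ / => A0; rewrite castmx_id.
move=> x /(congr1 trmx); rewrite trmx_mul trmxK trmx0.
have : row_free (row_base (kermx v)) by exact: row_base_free.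
move: (row_base _) x; case: _ / rk => A x fA; rewrite castmx_id.
by rewrite -(mul0mx _ A) => /(row_free_inj fA) /(congr1 trmx); rewrite trmxK trmx0.
Qed.

Lemma orthonormal_split (v : 'M[R]_(n, k * 2)) (e : 'M[R]_(n, n - k * 2)) :
  v^T *m v = 1%:M -> e^T *m e = 1%:M -> v^T *m e = 0 ->
  v *m v^T + e *m e^T = 1%:M.
Proof.
move=> vv ee ve.
have ev : e^T *m v = 0 by rewrite -[LHS]trmxK trmx_mul trmxK ve trmx0.
have : row_mx v e *m (row_mx v e)^T = 1%:M.
  apply: mulmx1_eqdim; first by rewrite subnKC.
  by rewrite tr_row_mx mul_col_row vv ee ve ev -scalar_mx_block.
by rewrite tr_row_mx mul_row_col.
Qed.

Lemma orbit_outer (v w : stiefel R n (k * 2)) : pi v = pi w ->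
  \val w *m (\val w)^T = \val v *m (\val v)^T.
Proof.
move=> /orbit_projP[g Gg ->]; rewrite trmx_mul mulmxA -(mulmxA _ g).
by rewrite (mulmx1C (osetO Gg)) mulmx1.
Qed.

(** The projection $1-vv^T$ onto the fibre depends only on the flag. Applied to a fixed basis [e0]
    of the fibre over [y], it gives a continuous family which stays independent near [y] and is then
    orthonormalised. *)
Lemma xi_frame_exists (y : flags R n k) :
  exists e : local_frame (n - k * 2) fib, frame_dom e y.
Proof.
pose v0 := \val (repr y); have vv0 := stiefelP (repr y).
have [e0 [ve0 inj0]] := orthocomplement_basis vv0.
pose P (z : flags R n k) := 1%:M - \val (repr z) *m (\val (repr z))^T.
pose f z := P z *m e0.
have cf z : {for z, continuous f}.
  rewrite -(orbit_projK z); apply: orbit_continuous.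
  apply: (continuous_fun_ext
      (f := fun v : stiefel R n (k * 2) => (1%:M - \val v *m (\val v)^T) *m e0)).
    move=> v; rewrite /f /P /=; congr ((_ - _) *m _).
    by apply/esym/orbit_outer; rewrite orbit_projK.
  have cv := @val_continuous R n (k * 2) (repr z).
  apply: continuous_mulmx; last exact: continuous_cstmx.
  apply: continuous_addmx; first exact: continuous_cstmx.
  exact: (continuous_oppmx (continuous_mulmx cv (continuous_trmx cv))).
pose D := [set z | (f z)^T *m f z \in unitmx].
have oD : open D.
  apply: (open_comp (f := fun z => (f z)^T *m f z)) (@open_unitmx R _).
  by move=> z _; exact: (continuous_mulmx (continuous_trmx (cf z)) (cf z)).
have inj z : D z -> forall x : 'cV_(n - k * 2), f z *m x = 0 -> x = 0.
  move=> Dz x Hx; rewrite -[x](mulKmx Dz) -[_ *m x]mulmxA Hx.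
  by rewrite !mulmx0.
have fP z : (\val (repr z))^T *m f z = 0.
  rewrite /f /P mulmxBl mul1mx mulmxBr mulmxA mulmxA stiefelP.
  by rewrite mul1mx subrr.
pose e z := gram_schmidt (f z).
have ce z : D z -> {for z, continuous e}.
  move=> /inj /gram_schmidtP[_ _ cg].
  exact: (@continuous_comp _ _ _ f (@gram_schmidt R n _) z (cf z) cg).
have oe z : D z -> (e z)^T *m e z = 1%:M by move=> /inj /gram_schmidtP[].
have ve z : D z -> (\val (repr z))^T *m e z = 0.
  move=> /inj /gram_schmidtP[_ [C eC] _].
  by rewrite /e eC mulmxA fP mul0mx.
have se z : D z -> forall x, fib z x <-> exists c, x = e z *m c.
  move=> Dz x; split=> [H|[c ->] v vz].
    exists ((e z)^T *m x); rewrite -[LHS]mul1mx.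
    rewrite -(orthonormal_split (stiefelP (repr z)) (oe _ Dz) (ve _ Dz)).
    by rewrite mulmxDl -!mulmxA (H (repr z)) ?orbit_projK // mulmx0 add0r.
  have /orbit_projP[g _ ->] : pi (repr z) = pi v by rewrite orbit_projK.
  by rewrite trmx_mul mulmxA -(mulmxA _ _ (e z)) ve // mulmx0 mul0mx.
exists (LocalFrame oD ce oe se) => /=; rewrite /D /=.
apply: gram_unit => x Hx; apply: inj0.
by move: Hx; rewrite /f /P mulmxBl mul1mx -(mulmxA _ _^T) ve0 mulmx0 subr0.
Qed.

Lemma xi_last_is_vbundle : is_vbundle (xi_last R n k).
Proof. exact/subbundle_is_vbundle/xi_frame_exists. Qed.

End Flags.

(** * The circle action *)

Section RotationAlgebra.
Context {R : realType}.

Lemma rot90E (i j : 'I_2) :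
  rot90 R i j = if i == j then 0 else if i == 0 then -1 else 1.
Proof.
rewrite /rot90; case: (@split_ordP 1 1 i) => a ->; case: (@split_ordP 1 1 j) => b ->.
- by rewrite (@block_mxEul _ 1 1 1 1) mxE !ord1.
- by rewrite (@block_mxEur _ 1 1 1 1) !mxE !ord1.
- by rewrite (@block_mxEdl _ 1 1 1 1) !mxE !ord1.
- by rewrite (@block_mxEdr _ 1 1 1 1) mxE !ord1.
Qed.

Lemma ord2P (i : 'I_2) : i = 0 \/ i = 1.
Proof. by case: i => [[|[|//]] Hi]; [left|right]; exact: val_inj. Qed.

Lemma mx2P (A B : 'M[R]_2) : A 0 0 = B 0 0 -> A 0 1 = B 0 1 -> A 1 0 = B 1 0 ->
  A 1 1 = B 1 1 -> A = B.
Proof.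
move=> ? ? ? ?; apply/matrixP => i j.
by case: (ord2P i) => ->; case: (ord2P j) => ->.
Qed.

Lemma rot90_tr : (rot90 R)^T = - rot90 R.
Proof. by apply: mx2P; rewrite mxTE mxNE !rot90E /= ?oppr0 ?opprK. Qed.

Lemma mul2E p q (A : 'M[R]_(p, 2)) (B : 'M[R]_(2, q)) i j :
  (A *m B) i j = A i 0 * B 0 j + A i 1 * B 1 j.
Proof.
rewrite mxE !big_ord_recl big_ord0 addr0.
by rewrite (_ : lift ord0 ord0 = 1 :> 'I_2) //; exact: val_inj.
Qed.

Lemma det2E (A : 'M[R]_2) : \det A = A 0 0 * A 1 1 - A 0 1 * A 1 0.
Proof.
rewrite (expand_det_row _ 0) !big_ord_recl big_ord0 addr0.
rewrite (_ : lift ord0 ord0 = 1 :> 'I_2); last exact: val_inj.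
rewrite /cofactor !det_mx11 !mxE /=.
rewrite (_ : lift 0 0 = 1 :> 'I_2); last exact: val_inj.
rewrite (_ : lift 1 0 = 0 :> 'I_2); last exact: val_inj.
by rewrite expr0 expr1; ring.
Qed.

Lemma rot90_sqr : rot90 R *m rot90 R = - 1%:M.
Proof.
by apply: mx2P; rewrite mul2E mxNE mx1E !rot90E /=; ring.
Qed.

Definition rot2 (a b : R) : 'M[R]_2 := a *: 1%:M + b *: rot90 R.

Lemma SO2_rot2 (r : 'M[R]_2) : SO2 r ->
  r = rot2 (r 0 0) (r 1 0) /\ r 0 0 ^+ 2 + r 1 0 ^+ 2 = 1.
Proof.
move=> [rO r1]; have /matrixP H := rO.
have := r1; rewrite det2E => d.
have := H 0 0; have := H 0 1; have := H 1 1.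
rewrite !mul2E !mxTE !mx1E /= => H11 H01 H00.
have e11 : r 1 1 = r 0 0.
  have -> : r 1 1 = r 1 1 * (r 0 0 * r 0 0 + r 1 0 * r 1 0) by rewrite H00 mulr1.
  have -> : r 1 1 * (r 0 0 * r 0 0 + r 1 0 * r 1 0) =
    r 0 0 * (r 0 0 * r 1 1 - r 0 1 * r 1 0) + r 1 0 * (r 0 0 * r 0 1 + r 1 0 * r 1 1) by ring.
  by rewrite d H01; ring.
have e01 : r 0 1 = - r 1 0.
  have -> : r 0 1 = r 0 1 * (r 0 0 * r 0 0 + r 1 0 * r 1 0) by rewrite H00 mulr1.
  have -> : r 0 1 * (r 0 0 * r 0 0 + r 1 0 * r 1 0) =
    - r 1 0 * (r 0 0 * r 1 1 - r 0 1 * r 1 0) + r 0 0 * (r 0 0 * r 0 1 + r 1 0 * r 1 1) by ring.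
  by rewrite d H01; ring.
split; last by rewrite !expr2.
by apply: mx2P; rewrite mxDE !mxZE mx1E rot90E /= ?e01 ?e11; ring.
Qed.

Lemma rot2_SO2 a b : a ^+ 2 + b ^+ 2 = 1 -> SO2 (rot2 a b).
Proof.
move=> ab; split; last first.
  by rewrite det2E /rot2 !(mxDE, mxZE, mx1E) !rot90E /= -[RHS]ab; ring.
rewrite /rot2 trD !trZ trmx1 rot90_tr !(mulmxDl, mulmxDr).
rewrite -!scalemxAl -!scalemxAr !mulNmx rot90_sqr !mulmx1 !mul1mx opprK.
apply/matrixP => i j; rewrite !(mxDE, mxNE, mxZE).
by rewrite -[RHS]mul1r -ab; ring.
Qed.

Lemma SO2_orth (r : 'M[R]_2) : SO2 r -> r^T *m r = 1%:M.
Proof. by case. Qed.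

Lemma SO2_orthr (r : 'M[R]_2) : SO2 r -> r *m r^T = 1%:M.
Proof. by move=> /SO2_orth/mulmx1C. Qed.

End RotationAlgebra.

(** * Rotations between points of an orbit, local sections and the bundle [zeta_r] *)

Section Circle.
Context {R : realType} (n k : nat).
Hypothesis hk : (0 < k)%N.
Local Notation m := (k * 2)%N.
Local Notation pi := (orbit_proj (circle R k)).
Implicit Types u v w : stiefel R n m.

Definition cstr : 'M[R]_m := diag_circle k (rot90 R).

Lemma diag_circleE (r : 'M[R]_2) (a a' : 'I_k) b b' :
  diag_circle k r (mxtens_index (a, b)) (mxtens_index (a', b')) =
  (a == a')%:R * r b b'.
Proof. by rewrite tensmxE mxE. Qed.

Lemma cstr_tr : cstr^T = - cstr.
Proof.
rewrite /cstr diag_circleT rot90_tr; apply/matrixP => i j.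
case: (mxtens_indexP i) => a b; case: (mxtens_indexP j) => a' b'.
by rewrite mxNE !diag_circleE mxNE mulrN.
Qed.

Lemma cstr_sqr : cstr *m cstr = - 1%:M.
Proof.
rewrite /cstr diag_circleM rot90_sqr -[in RHS](@diag_circle1 R k).
apply/matrixP => i j.
case: (mxtens_indexP i) => a b; case: (mxtens_indexP j) => a' b'.
by rewrite mxNE !diag_circleE mxNE mulrN.
Qed.

Lemma diag_circle_rot2 a b : diag_circle k (rot2 a b) = rotJ cstr a b :> 'M[R]_m.
Proof.
rewrite /rotJ -(@diag_circle1 R k); apply/matrixP => i j.
case: (mxtens_indexP i) => c d; case: (mxtens_indexP j) => c' d'.
by rewrite mxDE !mxZE !diag_circleE /rot2 mxDE !mxZE; ring.
Qed.

Lemma diag_circle_SO2 r : SO2 r -> diag_circle k r = rotJ cstr (r 0 0) (r 1 0) :> 'M[R]_m.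
Proof. by move=> /SO2_rot2[rE _]; rewrite -diag_circle_rot2 -rE. Qed.

Let o0 : 'I_k := Ordinal hk.

(** Reading a rotation off the first diagonal block of $v^Tw$ makes it polynomial in the entries,
    hence continuous, which is not visible from the choice by [xget] in [zeta]. *)
Definition corner (M : 'M[R]_m) : 'M[R]_2 :=
  \matrix_(b, b') M (mxtens_index (o0, b)) (mxtens_index (o0, b')).

Lemma corner_diag r : corner (diag_circle k r) = r.
Proof. by apply/matrixP => i j; rewrite mxE diag_circleE eqxx mul1r. Qed.

(* The rotation taking v to w when they lie in the same orbit. *)
Definition rotm v w : 'M[R]_2 := corner ((\val v)^T *m \val w).

Lemma rotm_diag v w r : \val w = \val v *m diag_circle k r -> rotm v w = r.
Proof. by move=> E; rewrite /rotm E mulmxA stiefelP mul1mx corner_diag. Qed.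

Lemma rotmP v w : pi v = pi w ->
  SO2 (rotm v w) /\ \val w = \val v *m diag_circle k (rotm v w).
Proof. by move=> /orbit_projP[_ [r rSO <-] E]; rewrite (rotm_diag E). Qed.

Lemma rotm_tr v w : rotm w v = (rotm v w)^T.
Proof.
by apply/matrixP => i j; rewrite !mxE; apply: eq_bigr => l _; rewrite !mxE mulrC.
Qed.

Lemma rotmM u v w : pi u = pi v -> pi v = pi w -> rotm u v *m rotm v w = rotm u w.
Proof.
move=> uv vw; apply/esym/rotm_diag; have [_ ->] := rotmP vw.
by have [_ {1}->] := rotmP uv; rewrite -mulmxA diag_circleM.
Qed.

Lemma rotm_continuous (T : topologicalType) (f g : T -> stiefel R n m) y :
  {for y, continuous f} -> {for y, continuous g} ->
  {for y, continuous (fun x => rotm (f x) (g x))}.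
Proof.
move=> cf cg.
have cf' : {for y, continuous (fun x => \val (f x))}.
  exact: (continuous_comp cf (@val_continuous R n m (f y))).
have cg' : {for y, continuous (fun x => \val (g x))}.
  exact: (continuous_comp cg (@val_continuous R n m (g y))).
have := continuous_mulmx (continuous_trmx cf') cg'.
move=> /mx_continuousP c; apply/mx_continuousP => i j.
have E x : ((\val (f x))^T *m \val (g x)) (mxtens_index (o0, i)) (mxtens_index (o0, j)) =
  rotm (f x) (g x) i j by rewrite [RHS]mxE.
exact: continuous_fun_ext E (c _ _).
Qed.

Definition unit_vec (b : 'I_2) : 'cV[R]_m := delta_mx (mxtens_index (o0, b)) 0.

Lemma cstr_unit0 : cstr *m unit_vec 0 = unit_vec 1.
Proof.
rewrite /unit_vec -colE; apply/matrixP => i j; rewrite [LHS]mxE [RHS]mxE ord1 andbT.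
case: (mxtens_indexP i) => a b; rewrite diag_circleE.
rewrite (can_eq (@mxtens_indexK _ _)) xpair_eqE.
case: (a =P o0) => _; last by rewrite mul0r.
by rewrite mul1r rot90E; case: (ord2P b) => ->.
Qed.

Lemma dot_unit b b' : dot (unit_vec b) (unit_vec b') = (b == b')%:R.
Proof.
rewrite /dot /unit_vec trmx_delta mul_delta_mx_cond.
rewrite (can_eq (@mxtens_indexK _ _)) xpair_eqE eqxx /=.
by case: (b =P b') => _; rewrite ?mulr1n ?mulr0n mxE ?eqxx.
Qed.

(** The default value [v] makes this total, so that sections and curves given by matrix formulas can
    be defined before orthonormality is known. *)
Definition stiefel_of (v : stiefel R n m) (M : 'M[R]_(n, m)) : stiefel R n m :=
  if pselect (M^T *m M = 1%:M) is left h then to_stiefel h else v.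

Lemma stiefel_ofE v (M : 'M[R]_(n, m)) : M^T *m M = 1%:M -> \val (stiefel_of v M) = M.
Proof. by rewrite /stiefel_of; case: pselect. Qed.

Local Notation e1 := (unit_vec 0).
Local Notation e2 := (unit_vec 1).

Lemma smooth_dot (V : normedModType R) (O : set V) p (f g : V -> 'cV[R]_p) :
  open O -> smooth_mx O f -> smooth_mx O g -> smooth O (fun x => dot (f x) (g x)).
Proof. by move=> oO sf sg; exact: (smooth_mxM oO (smooth_mxT oO sf) sg). Qed.

Section SliceSmooth.
Variable v : stiefel R n m.
Local Notation v0 := (\val v).

Lemma smooth_slice_re O : open O -> smooth O (@slice_re R n m e1 v0).
Proof.
move=> oO; apply: smooth_dot => //; first exact: smooth_mx_cst.
by apply: smooth_mxM => //; [exact: smooth_mx_id|exact: smooth_mx_cst].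
Qed.

Lemma smooth_slice_im O : open O -> smooth O (@slice_im R n m e1 e2 v0).
Proof.
move=> oO; apply: smooth_dot => //; first exact: smooth_mx_cst.
by apply: smooth_mxM => //; [exact: smooth_mx_id|exact: smooth_mx_cst].
Qed.

Lemma smooth_slice_rho O : open O -> smooth O (@slice_rho R n m e1 e2 v0).
Proof.
move=> oO; apply: smoothD => //; apply: smoothM => //;
  by [exact: smooth_slice_re|exact: smooth_slice_im].
Qed.

Definition rho_dom : set 'M[R]_(n, m) :=
  [set u | setT u /\ 0 < slice_rho e1 e2 v0 u].

Lemma open_rho_dom : open rho_dom.
Proof. by apply: open_gt0; [exact: openT|exact: (smooth_slice_rho openT)]. Qed.

Lemma smooth_slice_norm : smooth_mx rho_dom (slice_norm cstr e1 e2 v0).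
Proof.
have oD := open_rho_dom.
apply: smooth_mxZ => //.
  by apply: smooth_rsqrt => // [x []//|]; exact: smooth_slice_rho.
apply: smooth_mxD => //; apply: smooth_mxZ => //.
- exact: smooth_slice_re.
- exact: smooth_mx_id.
- exact: smooth_slice_im.
- by apply: smooth_mxM => //; [exact: smooth_mx_id|exact: smooth_mx_cst].
Qed.

End SliceSmooth.

Lemma open_orbit_set (U : set 'M[R]_(n, m)) : open U ->
  (forall v w, pi v = pi w -> U (\val v) -> U (\val w)) ->
  open [set y : Y R n k | U (\val (repr y))].
Proof.
move=> oU invU; rewrite /open /= /quotient_open /=.
rewrite (_ : _ @^-1` _ = [set v : stiefel R n m | U (\val v)]).
  by apply: open_comp => // v _; exact: val_continuous.
have E v : pi (repr (pi v)) = pi v by rewrite orbit_projK.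
by apply/seteqP; split=> v /=; apply: invU; rewrite E.
Qed.

Section SliceSection.
Variable v : stiefel R n m.
Local Notation v0 := (\val v).
Local Notation rho := (slice_rho e1 e2 v0).
Local Notation norm := (slice_norm cstr e1 e2 v0).

Lemma slice_normP u : 0 < rho (\val u) -> exists r : 'M[R]_2,
  SO2 r /\ norm (\val u) = \val u *m diag_circle k r.
Proof.
move=> r0; exists (rot2 (slice_re e1 v0 (\val u) / Num.sqrt (rho (\val u)))
   (slice_im e1 e2 v0 (\val u) / Num.sqrt (rho (\val u)))); split.
  by apply: rot2_SO2; exact: slice_rho_unit.
by rewrite slice_normE diag_circle_rot2.
Qed.

Lemma slice_norm_val u : 0 < rho (\val u) ->
  \val (stiefel_of u (norm (\val u))) = norm (\val u).
Proof.
move=> /slice_normP[r [rS E]]; apply: stiefel_ofE; rewrite E.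
by apply: (@act_stiefel _ _ _ (circle R k)); exists r.
Qed.

Lemma slice_rho_orbit u w : pi u = pi w -> rho (\val u) = rho (\val w).
Proof.
move=> /orbit_projP[_ [r rS <-] ->]; have [_ r1] := SO2_rot2 rS.
by rewrite diag_circle_SO2 // slice_rho_rot //; [exact: cstr_sqr|exact: cstr_unit0].
Qed.

Lemma slice_norm_orbit u w : pi u = pi w -> norm (\val u) = norm (\val w).
Proof.
move=> /orbit_projP[_ [r rS <-] ->]; have [_ r1] := SO2_rot2 rS.
by rewrite diag_circle_SO2 // slice_norm_rot //; [exact: cstr_sqr|exact: cstr_unit0].
Qed.

(** The normalised point is constant on orbits, so it descends to the orbits on which [rho] is
    positive; continuity is then checked on the Stiefel manifold. *)
Lemma slice_section_exists : exists s : local_section n (circle R k),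
  section_dom s (pi v).
Proof.
pose D := [set y : Y R n k | rho_dom v (\val (repr y))].
pose s (y : orbit_space n (circle R k)) := stiefel_of (repr y) (norm (\val (repr y))).
have oD : open D.
  apply: open_orbit_set; first exact: open_rho_dom.
  by move=> u w uw [_ u0]; split=> //; rewrite -(slice_rho_orbit uw).
have sK y : D y -> pi (s y) = y.
  move=> [_ r0]; rewrite -[RHS]orbit_projK; apply/esym/orbit_projP.
  have [r [rS E]] := slice_normP r0.
  by exists (diag_circle k r); [exists r|rewrite slice_norm_val].
have cs y : D y -> {for y, continuous s}.
  move=> Dy; have [_ r0] := Dy; rewrite -(orbit_projK y).
  apply: orbit_continuous; apply: stiefel_continuous.
  have cn : {for repr y, continuous (fun u : stiefel R n m => norm (\val u))}.
    apply: (@continuous_comp _ _ _ (fun u : stiefel R n m => \val u) norm).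
      exact: val_continuous.
    exact: (smooth_mx_continuous (@smooth_slice_norm v) Dy).
  apply: continuous_near_eq cn.
  have : \forall u \near repr y, D (pi u).
    by apply: orbit_near => //; rewrite orbit_projK.
  apply: filterS => u [_ Du] /=.
  rewrite slice_norm_val //; apply: slice_norm_orbit.
  by rewrite orbit_projK.
exists (@LocalSection _ _ _ _ D s oD cs sK) => /=; split=> //.
rewrite -(@slice_rho_orbit v) ?orbit_projK //.
rewrite /slice_rho /slice_re /slice_im !dot_isom ?stiefelP // !dot_unit /=.
by rewrite mulr1 mulr0 addr0.
Qed.

End SliceSection.

Lemma section_pi (s : local_section n (circle R k)) v : section_dom s (pi v) ->
  pi v = pi (s (pi v)).
Proof. by move=> sv; rewrite sectionK. Qed.

Lemma diag_circle_1 (r : 'M[R]_2) : diag_circle 1 r = r.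
Proof.
apply/matrixP => i j.
have E (l : 'I_2) : l = mxtens_index (ord0 : 'I_1, l) by exact: val_inj.
by rewrite (E i) (E j) tensmxE mxE mul1r -(E i) -(E j).
Qed.

Lemma realify_rot2 a b : realify_mx ((a +i* b)%C%:M : 'M[R[i]]_1) = rot2 a b.
Proof.
rewrite -[RHS]diag_circle_1 /realify_mx /rot2 /diag_circle; apply/matrixP => i j.
case: (mxtens_indexP i) => c d; case: (mxtens_indexP j) => c' d'.
rewrite mxDE !tensmxE [LHS]/= !ord1 mxDE !mxZE.
rewrite ![map_mx _ _ _ _]mxE [_%:M _ _]mxE eqxx /=.
by rewrite [1%:M 0 0]mxE mul1r.
Qed.

(** Orthonormality determines the rotation between two points of an orbit, so the choice made by
    [xget] in [zeta] can only return [rotm]; the realification of its complex number is the rotation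
    itself. *)
Lemma zeta_r_trans (s t : local_section n (circle R k)) y :
  section_dom s y -> section_dom t y ->
  @vtrans _ _ (zeta_r R n k) s t y = rotm (s y) (t y) :> 'M[R]_2.
Proof.
move=> sy ty; have st : pi (s y) = pi (t y) by rewrite !sectionK.
rewrite /zeta_r /zeta /=; case: xgetP => [r _ [rS E]|H].
  by rewrite (rotm_diag E) realify_rot2; case: (SO2_rot2 rS).
by have := H (rotm (s y) (t y)) (rotmP st).
Qed.

Lemma zeta_r_is_vbundle : is_vbundle (zeta_r R n k).
Proof.
split=> [s|y|s t y sy ty|s y sy|s t l y sy ty ly].
- exact: section_open.
- by rewrite -(orbit_projK y); exact: slice_section_exists.
- have c : {for y, continuous (fun x => rotm (s x) (t x))}.
    by apply: rotm_continuous; exact: section_continuous.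
  have near_st : \forall x \near y, section_dom s x /\ section_dom t x.
    apply: filterS2 (open_nbhs_nbhs (conj (section_open s) sy))
      (open_nbhs_nbhs (conj (section_open t) ty)) => x sx tx.
    by split.
  apply: continuous_near_eq c; apply: filterS near_st => x [sx tx].
  by rewrite zeta_r_trans.
- by rewrite zeta_r_trans //; apply: rotm_diag; rewrite diag_circle1 mulmx1.
- rewrite !zeta_r_trans //; apply: rotmM; by rewrite !sectionK.
Qed.

End Circle.

(** * Equivariant framings *)

Section Multiples.
Context {R : comNzRingType}.

(** Mirrors the recursion of [multiple], so that block matrices of this size fit iterated Whitney
    sums without casts. *)
Fixpoint multdim (a N : nat) : nat := if a is b.+1 then (N + multdim b N)%N else 0%N.

Fixpoint multmx (a p q : nat) (A : 'M[R]_(p, q)) : 'M[R]_(multdim a p, multdim a q) :=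
  if a is b.+1 return 'M[R]_(multdim a p, multdim a q)
  then block_mx A 0 0 (multmx b A) else 1%:M.

Fixpoint compmx (a N l : nat) : 'M[R]_(N, multdim a N) :=
  if a is b.+1 return 'M[R]_(N, multdim a N)
  then if l is l'.+1 then row_mx 0 (compmx b N l') else row_mx 1%:M 0
  else 0.

Fixpoint joinmx (a N : nat) (F : nat -> 'cV[R]_N) : 'cV[R]_(multdim a N) :=
  if a is b.+1 return 'cV[R]_(multdim a N)
  then col_mx (F 0%N) (joinmx b (fun l => F l.+1)) else 0.

Lemma multdimE a N : multdim a N = (a * N)%N.
Proof. by elim: a => //= a ->; rewrite mulSn. Qed.

Lemma multmxT a p q (A : 'M[R]_(p, q)) : (multmx a A)^T = multmx a A^T.
Proof.
elim: a => [|a IH] /=; first by rewrite trmx1.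
by rewrite tr_block_mx !trmx0 IH.
Qed.

Lemma multmx1 a p : multmx a (1%:M : 'M[R]_p) = 1%:M.
Proof. by elim: a => //= a ->; rewrite -scalar_mx_block. Qed.

Lemma compmx_mult a p q l (A : 'M[R]_(p, q)) :
  compmx a p l *m multmx a A = A *m compmx a q l.
Proof.
elim: a l => [|a IH] [|l] /=; rewrite ?mul0mx ?mulmx0 //.
  by rewrite mul_row_block !mul0mx !mulmx0 !addr0 mul1mx mul_mx_row mulmx1 mulmx0.
by rewrite mul_row_block !mul0mx !mulmx0 !add0r IH mul_mx_row mulmx0.
Qed.

Lemma comp_eq0 a N (x : 'cV[R]_(multdim a N)) :
  (forall l, (l < a)%N -> compmx a N l *m x = 0) -> x = 0.
Proof.
elim: a x => [|a IH] x H; first by apply/matrixP => -[].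
rewrite -[x]vsubmxK; have := H 0%N isT; rewrite /= -{1}[x]vsubmxK mul_row_col mul1mx.
rewrite mul0mx addr0 => ->; rewrite (IH (dsubmx x)) ?col_mx0 // => l la.
have := H l.+1 la; rewrite /= -{1}[x]vsubmxK mul_row_col mul0mx.
by rewrite add0r.
Qed.

Lemma comp_join a N F l : (l < a)%N -> compmx a N l *m joinmx a F = F l.
Proof.
elim: a F l => [//|a IH] F [|l] /= la.
  by rewrite mul_row_col mul1mx mul0mx addr0.
by rewrite mul_row_col mul0mx add0r IH.
Qed.

End Multiples.

Section Framings.
Context {R : realType} (n k : nat).
Hypothesis hk : (0 < k)%N.
Local Notation m := (k * 2)%N.
Local Notation pi := (orbit_proj (circle R k)).
Local Notation rot := (rotm hk).
Implicit Types u v w : stiefel R n m.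

(* A trivialisation of the pullback of E to the Stiefel manifold inside the
   trivial bundle of rank N, equivariant for the orthogonal representation rho. *)
Record framing (E : vbundle R (Y R n k)) (N : nat) (rho : 'M[R]_2 -> 'M[R]_N) := Framing {
  frm : stiefel R n m -> vidx E -> 'M[R]_(N, vrank E);
  frm_vbundle : is_vbundle E;
  frm_continuous : forall i v, vdom i (pi v) -> {for v, continuous (fun u => frm u i)};
  frm_orth : forall i v, vdom i (pi v) -> (frm v i)^T *m frm v i = 1%:M;
  frm_trans : forall i j v, vdom i (pi v) -> vdom j (pi v) ->
    frm v i *m vtrans i j (pi v) = frm v j;
  frm_equiv : forall i v w, vdom i (pi v) -> pi v = pi w ->
    frm w i = (rho (rot v w))^T *m frm v i;
  frm_rho : forall r, SO2 r -> (rho r)^T *m rho r = 1%:M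
}.

Lemma frm_rhoV E N rho (fE : @framing E N rho) r : SO2 r -> rho r *m (rho r)^T = 1%:M.
Proof. by move=> /(frm_rho fE)/mulmx1C. Qed.

Program Definition trivial_framing (r : nat) :
    framing (trivial_bundle r) (fun=> 1%:M : 'M[R]_r) :=
  @Framing _ r _ (fun _ _ => 1%:M) _ _ _ _ _ _.
Next Obligation. by move=> r; exact: trivial_is_vbundle. Qed.
Next Obligation. by move=> r i v _; exact: continuous_cstmx. Qed.
Next Obligation. by move=> r i v _; rewrite trmx1 mulmx1. Qed.
Next Obligation. by move=> r i j v _ _; rewrite mulmx1. Qed.
Next Obligation. by move=> r i v w _ _; rewrite trmx1 mulmx1. Qed.
Next Obligation. by move=> r t _; rewrite trmx1 mulmx1. Qed.

Program Definition zeta_framing : framing (zeta_r R n k) (@id 'M[R]_2) :=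
  @Framing _ 2 _ (fun v (s : local_section n (circle R k)) => rot v (s (pi v)))
    _ _ _ _ _ _.
Next Obligation. exact: zeta_r_is_vbundle. Qed.
Next Obligation.
move=> s v sv; apply: rotm_continuous; first exact: cvg_id.
apply: (@continuous_comp _ _ _ pi s); first exact: orbit_proj_continuous.
exact: section_continuous.
Qed.
Next Obligation. by move=> s v sv; case: (rotmP hk (section_pi sv)) => /SO2_orth. Qed.
Next Obligation.
move=> s t v sv tv; rewrite (zeta_r_trans hk) //.
by apply: rotmM; rewrite !sectionK.
Qed.
Next Obligation.
move=> s v w sv vw; rewrite /= -vw -rotm_tr.
by rewrite rotmM ?(sectionK sv).
Qed.
Next Obligation. by move=> r /SO2_orth. Qed.

Section Whitney.
Variables (E F : vbundle R (Y R n k)) (N M : nat).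
Variables (rho : 'M[R]_2 -> 'M[R]_N) (sigma : 'M[R]_2 -> 'M[R]_M).
Variables (fE : framing E rho) (fF : framing F sigma).

Program Definition whitney_framing :
    framing (whitney E F) (fun r => block_mx (rho r) 0 0 (sigma r)) :=
  @Framing _ (N + M) _ (fun v i => block_mx (frm fE v i.1) 0 0 (frm fF v i.2))
    _ _ _ _ _ _.
Next Obligation.
by apply: whitney_is_vbundle; [exact: frm_vbundle fE|exact: frm_vbundle fF].
Qed.
Next Obligation.
move=> [i j] v [/= Ei Fj].
by apply: continuous_block_mx; exact: frm_continuous.
Qed.
Next Obligation.
move=> [i j] v [/= Ei Fj]; rewrite tr_block_mx !trmx0 mul_block_diag_mx.
by rewrite !frm_orth // -scalar_mx_block.
Qed.
Next Obligation.
move=> [i j] [i' j'] v [/= Ei Fj] [/= Ei' Fj'].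
by rewrite mul_block_diag_mx !frm_trans.
Qed.
Next Obligation.
move=> [i j] v w [/= Ei Fj] vw; rewrite tr_block_mx !trmx0 mul_block_diag_mx.
by rewrite -!frm_equiv.
Qed.
Next Obligation.
move=> r rS; rewrite tr_block_mx !trmx0 mul_block_diag_mx.
by rewrite (frm_rho fE) // (frm_rho fF) // -scalar_mx_block.
Qed.

Program Definition tensor_framing :
    framing (tensor E F) (fun r => tensmx (rho r) (sigma r)) :=
  @Framing _ (N * M) _ (fun v i => tensmx (frm fE v i.1) (frm fF v i.2))
    _ _ _ _ _ _.
Next Obligation.
by apply: tensor_is_vbundle; [exact: frm_vbundle fE|exact: frm_vbundle fF].
Qed.
Next Obligation.
move=> [i j] v [/= Ei Fj].
by apply: continuous_tensmx; exact: frm_continuous.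
Qed.
Next Obligation.
move=> [i j] v [/= Ei Fj]; rewrite trmx_tens tensmx_mul.
by rewrite !frm_orth // tensmx11.
Qed.
Next Obligation.
move=> [i j] [i' j'] v [/= Ei Fj] [/= Ei' Fj'].
by rewrite tensmx_mul !frm_trans.
Qed.
Next Obligation.
move=> [i j] v w [/= Ei Fj] vw; rewrite trmx_tens tensmx_mul.
by rewrite -!frm_equiv.
Qed.
Next Obligation.
move=> r rS; rewrite trmx_tens tensmx_mul.
by rewrite (frm_rho fE) // (frm_rho fF) // tensmx11.
Qed.

End Whitney.

Fixpoint multiple_framing E N (rho : 'M[R]_2 -> 'M[R]_N) (fE : framing E rho) (a : nat) :
    framing (multiple a E) (fun r => multmx a (rho r)) :=
  if a is b.+1 return framing (multiple a E) (fun r => multmx a (rho r))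
  then whitney_framing fE (multiple_framing fE b) else trivial_framing 0.

(** Carries a linear condition on the fibres over to every summand of a multiple. It is used for the
    orthogonality of the fibres of the pulled back canonical bundle to the columns of [v]. *)
Lemma multiple_framing_annihil E N (rho : 'M[R]_2 -> 'M[R]_N) (fE : framing E rho)
    a p (A : 'M[R]_(p, N)) v i :
  (forall j, vdom j (pi v) -> A *m frm fE v j = 0) ->
  vdom i (pi v) -> forall l, (l < a)%N ->
  forall x : 'cV[R]_(vrank (multiple a E)),
  A *m (compmx a N l *m (frm (multiple_framing fE a) v i *m x)) = 0.
Proof.
move=> HA; elim: a i => [//|a IH] [i j] [/= Ei Ej] [|l] la x.
  rewrite !mulmxA -[A *m _ *m _]mulmxA mul_row_block mul1mx !mul0mx mulmx0 !addr0.
  by rewrite mul_mx_row HA // mulmx0 row_mx0 mul0mx.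
have := IH j Ej l la (dsubmx x); rewrite !mulmxA => H.
rewrite -[A *m _ *m _]mulmxA mul_row_block !mul0mx !add0r mul_mx_row mulmx0.
by rewrite -[x]vsubmxK mul_row_col mulmx0 mul0mx add0r !mulmxA H.
Qed.

(** Since [M] is the rank of [F], the frames of [F] are square orthogonal matrices and can be undone
    by transposition. On the side of [E] the fibre may be a proper subspace of the ambient space, so
    [L] is only asked to be injective on that subspace. *)
Lemma framing_iso E F N M (rho : 'M[R]_2 -> 'M[R]_N) (sigma : 'M[R]_2 -> 'M[R]_M)
    (fE : framing E rho) (fF : framing F sigma) (L : stiefel R n m -> 'M[R]_(M, N)) :
  vrank E = vrank F -> M = vrank F ->
  (forall v, {for v, continuous L}) ->
  (forall v w, pi v = pi w ->
     L w *m (rho (rot v w))^T = (sigma (rot v w))^T *m L v) ->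
  (forall v i (x : 'cV_(vrank E)), vdom i (pi v) -> L v *m (frm fE v i *m x) = 0 ->
     frm fE v i *m x = 0 :> 'cV_N) ->
  bundle_iso E F.
Proof.
move=> rEF MF cL eL iL.
pose H v (i : vidx F) (j : vidx E) := (frm fF v i)^T *m L v *m frm fE v j.
have [vE vF] := (frm_vbundle fE, frm_vbundle fF).
have fr i v : vdom i (pi v) -> frm fF v i *m (frm fF v i)^T = 1%:M.
  by move=> Fi; apply: mulmx1_eqdim; [symmetry|exact: frm_orth].
apply: (bundle_iso_glue vE vF (esym rEF) (H := H)).
- move=> i j v Fi Ej; apply: continuous_mulmx; last exact: frm_continuous.
  by apply: (continuous_mulmx _ (cL v)); apply: continuous_trmx; exact: frm_continuous.
- move=> i j v w Fi Ej vw; have [rS _] := rotmP hk vw.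
  rewrite /H (frm_equiv fF Fi vw) (frm_equiv fE Ej vw) trmx_mul trmxK.
  rewrite -!mulmxA (mulmxA (L w)) eL // !mulmxA -(mulmxA _ (sigma _)).
  by rewrite (frm_rhoV fF) // mulmx1.
- move=> i i' j j' v Fi Fi' Ej Ej'.
  have K : vtrans i' i (pi v) *m (frm fF v i)^T = (frm fF v i')^T.
    have -> : vtrans i' i (pi v) = (frm fF v i')^T *m frm fF v i.
      by rewrite -(frm_trans fF Fi' Fi) mulmxA frm_orth // mul1mx.
    by rewrite -mulmxA fr // mulmx1.
  by rewrite /H -(frm_trans fE Ej Ej') -K -!mulmxA.
- move=> i j v x Fi Ej Hx.
  suff H0 : frm fE v j *m x = 0.
    by rewrite -[x]mul1mx -(frm_orth fE Ej) -mulmxA H0 mulmx0.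
  apply: iL => //; rewrite -[LHS]mul1mx -(fr _ _ Fi) -mulmxA.
  by move: Hx; rewrite /H -!mulmxA => ->; rewrite mulmx0.
Qed.

End Framings.

(** * The pulled back canonical bundle inside a trivial bundle *)

Section XiFraming.
Context {R : realType} (n k : nat).
Hypotheses (hk : (0 < k)%N) (kn : (k * 2 <= n)%N).
Local Notation m := (k * 2)%N.
Local Notation pi := (orbit_proj (circle R k)).
Definition qxi : vbundle R (Y R n k) := pullback (@q R n k) (xi_last R n k).

Definition qxi_mat (v : stiefel R n m) (e : vidx qxi) : 'M[R]_(n, vrank qxi) :=
  @frame _ _ _ _ _ e (q (pi v)).

Lemma qxi_is_vbundle : is_vbundle qxi.
Proof.
by apply: pullback_is_vbundle; [exact: q_continuous|exact: xi_last_is_vbundle].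
Qed.

Lemma qxi_mat_continuous e v : vdom e (pi v) ->
  {for v, continuous (fun u => qxi_mat u e)}.
Proof.
move=> ev.
apply: (@continuous_comp _ _ _ pi (fun y => @frame _ _ _ _ _ e (q y))).
  exact: orbit_proj_continuous.
apply: (@continuous_comp _ _ _ (@q R n k) (@frame _ _ _ _ _ e)).
  exact: q_continuous.
exact: frame_continuous.
Qed.

Lemma qxi_mat_orth e v : vdom e (pi v) -> (qxi_mat v e)^T *m qxi_mat v e = 1%:M.
Proof. by move=> ev; exact: frame_orthonormal. Qed.

Lemma qxi_mat_trans e e' v : vdom e (pi v) -> vdom e' (pi v) ->
  qxi_mat v e *m vtrans e e' (pi v) = qxi_mat v e'.
Proof. by move=> ev ev'; exact: frame_proj. Qed.

Lemma qxi_mat_equiv e v w : vdom e (pi v) -> pi v = pi w ->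
  qxi_mat w e = 1%:M^T *m qxi_mat v e.
Proof. by move=> ev vw; rewrite /qxi_mat vw trmx1 mul1mx. Qed.

(** The circle acts trivially on the ambient $\mathbb R^n$, because moving [v] along its orbit does
    not change the flag. *)
Definition qxi_framing : framing hk qxi (fun=> 1%:M : 'M[R]_n) :=
  @Framing R n k hk qxi n (fun=> 1%:M) qxi_mat qxi_is_vbundle qxi_mat_continuous
    qxi_mat_orth qxi_mat_trans qxi_mat_equiv
    (fun r _ => etrans (congr1 (mulmx^~ 1%:M) (@trmx1 R n)) (mulmx1 _)).

Lemma qxi_mat_ortho (v : stiefel R n m) e : vdom e (pi v) ->
  (\val v)^T *m qxi_mat v e = 0.
Proof.
move=> ev; apply: trmx_inj; apply/row_matrixP => j.
rewrite -tr_col trmx0 row0 -[RHS]trmx0; congr trmx.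
rewrite colE -mulmxA.
by have := frame_fib (delta_mx j 0) ev; apply; rewrite q_proj.
Qed.

End XiFraming.

(** * The linear model of the tangent spaces *)

Section LinearFunctions.
Context {R : comNzRingType}.

Definition mxof (p q : nat) (f : 'cV[R]_p -> 'cV[R]_q) : 'M[R]_(q, p) :=
  \matrix_(i, j) f (delta_mx j 0) i 0.

Lemma mxofE p q (f : 'cV[R]_p -> 'cV[R]_q) x : linear f -> mxof f *m x = f x.
Proof.
move=> lf; pose fM := GRing.isLinear.Build _ _ _ _ _ lf.
pose fL : {linear 'cV[R]_p -> 'cV[R]_q} := HB.pack f fM.
rewrite -[f]/(fL : _ -> _) {2}(matrix_sum_delta x) linear_sum.
apply/matrixP => i j; rewrite ord1 mxE summxE; apply: eq_bigr => l _.
by rewrite big_ord1 linearZ !mxE mulrC.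
Qed.

Section Combinators.
Variables (U : lmodType R) (p q : nat).
Implicit Types f g : U -> 'M[R]_(p, q).

Lemma lin_add f g : linear f -> linear g -> linear (fun x => f x + g x).
Proof. by move=> lf lg a x y; rewrite lf lg scalerDr addrACA. Qed.

Lemma lin_opp f : linear f -> linear (fun x => - f x).
Proof. by move=> lf a x y; rewrite lf opprD scalerN. Qed.

Lemma lin_mull r (A : 'M[R]_(r, p)) f : linear f -> linear (fun x => A *m f x).
Proof. by move=> lf a x y; rewrite lf mulmxDr scalemxAr. Qed.

Lemma lin_mulr r (A : 'M[R]_(q, r)) f : linear f -> linear (fun x => f x *m A).
Proof. by move=> lf a x y; rewrite lf mulmxDl scalemxAl. Qed.

Lemma lin_tr f : linear f -> linear (fun x => (f x)^T).
Proof. by move=> lf a x y; rewrite lf trD trZ. Qed.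

Lemma lin_sum (I : finType) (P : pred I) (F : I -> U -> 'M[R]_(p, q)) :
  (forall i, linear (F i)) -> linear (fun x => \sum_(i | P i) F i x).
Proof.
move=> lF a x y; rewrite scaler_sumr -big_split /=.
by apply: eq_bigr => i _; exact: lF.
Qed.

Lemma lin_scal (c : U -> R) (A : 'M[R]_(p, q)) :
  (forall a x y, c (a *: x + y) = a * c x + c y) -> linear (fun x => c x *: A).
Proof. by move=> lc a x y; rewrite lc scalerDl scalerA. Qed.

End Combinators.

Lemma lin_cVmul p q (A : 'M[R]_(q, p)) : linear (fun x : 'cV[R]_p => A *m x).
Proof. by move=> a x y; rewrite mulmxDr scalemxAr. Qed.

Lemma lin_usub p q : linear (fun x : 'cV[R]_(p + q) => usubmx x).
Proof. by move=> a x y; rewrite linearP. Qed.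

Lemma lin_dsub p q : linear (fun x : 'cV[R]_(p + q) => dsubmx x).
Proof. by move=> a x y; rewrite linearP. Qed.

Lemma lin_comp (U W W' : lmodType R) (f : W -> W') (g : U -> W) :
  linear f -> linear g -> linear (fun x => f (g x)).
Proof. by move=> lf lg a x y; rewrite lg lf. Qed.

Lemma lin_join (U : lmodType R) a N (F : U -> nat -> 'cV[R]_N) :
  (forall l, linear (F ^~ l)) -> linear (fun x => joinmx a (F x)).
Proof.
elim: a F => [|a IH] F lF c x y /=; first by rewrite scaler0 addr0.
rewrite lF (IH (fun x l => F x l.+1)) => [|l]; last exact: lF.
by rewrite scale_col_mx add_col_mx.
Qed.

Lemma lin_col (U : lmodType R) p q (f : U -> 'cV[R]_p) (g : U -> 'cV[R]_q) :
  linear f -> linear g -> linear (fun x => col_mx (f x) (g x)).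
Proof. by move=> lf lg a x y; rewrite lf lg scale_col_mx add_col_mx. Qed.

Lemma joinmx_mult a p q (A : 'M[R]_(p, q)) F :
  multmx a A *m joinmx a F = joinmx a (fun l => A *m F l).
Proof.
elim: a F => [|a IH] F /=; first by rewrite mulmx0.
by rewrite mul_block_col !mul0mx addr0 add0r IH.
Qed.

Lemma joinmx_eq0 a N (F : nat -> 'cV[R]_N) :
  joinmx a F = 0 -> forall l, (l < a)%N -> F l = 0.
Proof. by move=> H l la; rewrite -(comp_join F la) H mulmx0. Qed.

(** Identifies $\mathbb R^p\otimes\mathbb R^q$ with $p\times q$ matrices. A tensor square of
    rotations then acts on $2\times2$ blocks by conjugation. *)
Definition unt p q (x : 'cV[R]_(p * q)) : 'M[R]_(p, q) :=
  \matrix_(a, b) x (mxtens_index (a, b)) 0.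

Lemma lin_unt p q : linear (@unt p q).
Proof. by move=> a x y; apply/matrixP => i j; rewrite !mxE. Qed.

Lemma unt_eq0 p q (x : 'cV[R]_(p * q)) : unt x = 0 -> x = 0.
Proof.
move=> /matrixP H; apply/matrixP => i j; rewrite ord1.
by case: (mxtens_indexP i) => a b; have := H a b; rewrite !mxE.
Qed.

Lemma unt_tens p q r s (A : 'M[R]_(r, p)) (B : 'M[R]_(s, q)) x :
  unt (tensmx A B *m x) = A *m unt x *m B^T.
Proof.
apply/matrixP => a b; rewrite !mxE.
rewrite (reindex (@mxtens_index p q)) /=; last first.
  by exists (@mxtens_unindex p q) => ? _; rewrite ?mxtens_indexK ?mxtens_unindexK.
under [RHS]eq_bigr do rewrite !mxE mulr_suml.
rewrite exchange_big pair_bigA /=; apply: eq_bigr => -[c d] _ /=.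
by rewrite tensmxE !mxE mulrAC.
Qed.

End LinearFunctions.

(** * Enumeration of block positions *)

Section PairEnumeration.
Variable k : nat.

Lemma enum_pred_fun (T : finType) (x0 : T) (P : pred T) : exists f : nat -> T,
  [/\ forall l, (l < #|P|)%N -> P (f l),
      forall l l', (l < #|P|)%N -> (l' < #|P|)%N -> f l = f l' -> l = l' &
      forall x, P x -> exists2 l, (l < #|P|)%N & f l = x].
Proof.
exists (fun l => nth x0 (enum P) l); rewrite cardE; split.
- by move=> l ls; have := mem_nth x0 ls; rewrite mem_enum.
- by move=> l l' ls ls' /eqP; rewrite nth_uniq ?enum_uniq // => /eqP.
- move=> x Px; exists (index x (enum P)); rewrite ?index_mem ?mem_enum //.
  by rewrite nth_index // mem_enum.
Qed.

Lemma card_pair_lt : #|[pred p : 'I_k * 'I_k | (p.2 < p.1)%N]| = 'C(k, 2).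
Proof.
rewrite -sum1_card -bin2_sum big_mkord.
rewrite -(pair_big_dep xpredT (fun i j : 'I_k => (j < i)%N) (fun _ _ => 1%N)) /=.
apply: eq_bigr => i _.
by rewrite -(big_ord_widen k (fun=> 1%N)) ?sum1_card ?card_ord // ltnW.
Qed.

Lemma card_pair_le : #|[pred p : 'I_k * 'I_k | (p.2 <= p.1)%N]| = 'C(k.+1, 2).
Proof.
rewrite -sum1_card -bin2_sum big_mkord big_ord_recl add0n.
rewrite -(pair_big_dep xpredT (fun i j : 'I_k => (j <= i)%N) (fun _ _ => 1%N)) /=.
apply: eq_bigr => i _; rewrite /bump /= add1n.
under eq_bigl => j do rewrite -ltnS.
by rewrite -(big_ord_widen k (fun=> 1%N)) ?sum1_card ?card_ord.
Qed.

End PairEnumeration.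

(** * Cutting matrices into blocks of size two *)

Section Blocks.
Context {R : realType} (k : nat).
Local Notation m := (k * 2)%N.

Definition sel (j : 'I_k) : 'M[R]_(2, m) := rowsub (fun b => mxtens_index (j, b)) 1%:M.

Lemma selE q (j : 'I_k) (M : 'M[R]_(m, q)) b c :
  (sel j *m M) b c = M (mxtens_index (j, b)) c.
Proof. by rewrite /sel mul_rowsub_mx mul1mx mxE. Qed.

Lemma sel_selT (a b : 'I_k) : sel a *m (sel b)^T = (a == b)%:R%:M.
Proof.
apply/matrixP => i j; rewrite selE mxTE /sel mxE mx1E mxE.
rewrite (can_eq (@mxtens_indexK _ _)) xpair_eqE eq_sym [j == i]eq_sym.
by case: (a == b); case: (i == j).
Qed.

Lemma sel_diag (a : 'I_k) (r : 'M[R]_2) : sel a *m diag_circle k r = r *m sel a.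
Proof.
apply/matrixP => i c; rewrite selE; case: (mxtens_indexP c) => c1 c2.
rewrite diag_circleE mxE (bigD1 c2) //= big1 ?addr0 => [|l lc].
  rewrite /sel mxE mx1E (can_eq (@mxtens_indexK _ _)) xpair_eqE eqxx andbT.
  by rewrite mulrC.
rewrite /sel mxE mx1E (can_eq (@mxtens_indexK _ _)) xpair_eqE (negbTE lc) andbF.
by rewrite mulr0.
Qed.

Lemma sel_diagT (a : 'I_k) (r : 'M[R]_2) :
  (diag_circle k r)^T *m (sel a)^T = (sel a)^T *m r^T.
Proof. by rewrite -!trmx_mul sel_diag. Qed.

Lemma diag_selT (a : 'I_k) (r : 'M[R]_2) :
  diag_circle k r *m (sel a)^T = (sel a)^T *m r.
Proof. by have := sel_diagT a r^T; rewrite diag_circleT trmxK. Qed.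

Lemma sel_eq0 p (M : 'M[R]_(p, m)) : (forall j, M *m (sel j)^T = 0) -> M = 0.
Proof.
move=> H; apply/matrixP => i c; case: (mxtens_indexP c) => c1 c2.
have /matrixP/(_ i c2) := H c1; rewrite -[M in M *m _]trmxK -trmx_mul mxTE selE mxTE.
by rewrite !mxE.
Qed.

Definition emb (a b : 'I_k) (B : 'M[R]_2) : 'M[R]_m := (sel a)^T *m B *m sel b.
Definition blk (a b : 'I_k) (M : 'M[R]_m) : 'M[R]_2 := sel a *m M *m (sel b)^T.

Lemma emb_tr a b B : (emb a b B)^T = emb b a B^T.
Proof. by rewrite /emb !trmx_mul trmxK mulmxA. Qed.

Lemma lin_emb a b : linear (emb a b).
Proof. by move=> c x y; rewrite /emb mulmxDr mulmxDl -scalemxAr -scalemxAl. Qed.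

Lemma blkD a b M M' : blk a b (M + M') = blk a b M + blk a b M'.
Proof. by rewrite /blk mulmxDr mulmxDl. Qed.

Lemma blkN a b M : blk a b (- M) = - blk a b M.
Proof. by rewrite /blk mulmxN mulNmx. Qed.

Lemma blkZ a b c M : blk a b (c *: M) = c *: blk a b M.
Proof. by rewrite /blk -scalemxAr -scalemxAl. Qed.

Lemma blk0 a b : blk a b 0 = 0.
Proof. by rewrite /blk mulmx0 mul0mx. Qed.

Lemma blk_sum (I : Type) (r : seq I) (P : pred I) a b (F : I -> 'M[R]_m) :
  blk a b (\sum_(i <- r | P i) F i) = \sum_(i <- r | P i) blk a b (F i).
Proof. by rewrite /blk mulmx_sumr mulmx_suml. Qed.

Lemma blk_emb a b c d B : blk a b (emb c d B) = ((a == c) && (d == b))%:R *: B.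
Proof.
rewrite /blk /emb !mulmxA sel_selT mul_scalar_mx -!mulmxA sel_selT mul_mx_scalar.
by rewrite scalerA -natrM mulnb andbC.
Qed.

Lemma emb_diag a b (r B : 'M[R]_2) :
  (diag_circle k r)^T *m emb a b B *m diag_circle k r = emb a b (r^T *m B *m r).
Proof. by rewrite /emb !mulmxA sel_diagT -!mulmxA sel_diag. Qed.

Lemma blk_cstr a b : blk a b (@cstr R k) = (a == b)%:R *: rot90 R.
Proof. by rewrite /blk /cstr sel_diag -mulmxA sel_selT mul_mx_scalar. Qed.

End Blocks.

(** * The linear models of the horizontal space and of its complement *)

Section TangentModel.
Context {R : realType} (n k : nat).
Hypothesis hk : (0 < k)%N.
Local Notation m := (k * 2)%N.
Local Notation c2 := 'C(k, 2).
Local Notation c3 := 'C(k.+1, 2).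
Let o0 : 'I_k := Ordinal hk.

Definition pairs_lt : nat -> 'I_k * 'I_k :=
  projT1 (cid (enum_pred_fun (o0, o0) [pred p : 'I_k * 'I_k | (p.2 < p.1)%N])).
Definition pairs_le : nat -> 'I_k * 'I_k :=
  projT1 (cid (enum_pred_fun (o0, o0) [pred p : 'I_k * 'I_k | (p.2 <= p.1)%N])).

Lemma pairs_ltP : [/\ forall l, (l < c2)%N -> ((pairs_lt l).2 < (pairs_lt l).1)%N &
  forall l l', (l < c2)%N -> (l' < c2)%N -> pairs_lt l = pairs_lt l' -> l = l'].
Proof.
by rewrite /pairs_lt; case: cid => f []; rewrite card_pair_lt.
Qed.

Lemma pairs_leP : [/\ forall l, (l < c3)%N -> ((pairs_le l).2 <= (pairs_le l).1)%N &
  forall l l', (l < c3)%N -> (l' < c3)%N -> pairs_le l = pairs_le l' -> l = l'].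
Proof.
by rewrite /pairs_le; case: cid => f []; rewrite card_pair_le.
Qed.

(** The shift by one reserves block 0: its scalar is determined by the vanishing sum in the first
    model and is the coefficient of the circle direction in the second. The default [o0] is taken
    only out of range. *)
Definition dg (l : nat) : 'I_k := insubd o0 l.+1.

Lemma dgE l : (l < k - 1)%N -> dg l = l.+1 :> nat.
Proof. by move=> lk; rewrite /dg val_insubd ifT // -[l.+1]add1n -ltn_subRL. Qed.

Lemma dg_surj (j : 'I_k) : j != o0 -> exists2 l, (l < k - 1)%N & dg l = j.
Proof.
move=> j0; have j0' : (0 < j)%N by rewrite lt0n.
have jk : (j.-1 < k - 1)%N by rewrite ltn_subRL add1n prednK.
by exists j.-1 => //; apply: val_inj; rewrite /= dgE // prednK.
Qed.

Lemma dg_neq0 l : (l < k - 1)%N -> dg l != o0.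
Proof. by move=> lk; rewrite -val_eqE /= dgE. Qed.

Definition entry2 (a : nat) (x : 'cV[R]_(multdim a (2 * 2))) (l : nat) : 'M[R]_2 :=
  unt (compmx a (2 * 2) l *m x).

Definition skw (x : 'cV[R]_(multdim c2 (2 * 2))) : 'M[R]_m :=
  \sum_(l < c2) (emb (pairs_lt l).1 (pairs_lt l).2 (entry2 x l) -
                 (emb (pairs_lt l).1 (pairs_lt l).2 (entry2 x l))^T).

(** Subtracting [rot90] in block 0 from each generator makes the coefficients $b_j$ sum to zero. *)
Definition dia (x : 'cV[R]_(multdim (k - 1) 1)) : 'M[R]_m :=
  \sum_(l < k - 1) (compmx (k - 1) 1 l *m x) 0 0 *:
    (emb (dg l) (dg l) (rot90 R) - emb o0 o0 (rot90 R)).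

Definition hor (x : 'cV[R]_(multdim k (2 * n))) : 'M[R]_(n, m) :=
  \sum_(j < k) (unt (compmx k (2 * n) j *m x))^T *m sel j.

Definition symm (x : 'cV[R]_(multdim c3 (2 * 2))) : 'M[R]_m :=
  \sum_(l < c3) (emb (pairs_le l).1 (pairs_le l).2 (entry2 x l) +
                 (emb (pairs_le l).1 (pairs_le l).2 (entry2 x l))^T).

Definition skpart (B : 'M[R]_2) : R := B 1 0 - B 0 1.

(** A diagonal block $B$ enters [symm] only through $B+B^T$; this scalar records the skew part lost
    there. For positions in range the enumeration is injective, so at most one term occurs. *)
Definition tau (j : 'I_k) (x : 'cV[R]_(multdim c3 (2 * 2))) : R :=
  \sum_(l < c3 | pairs_le l == (j, j)) skpart (entry2 x l).

(** The factor [2 * n], and not [2 * (n - k * 2)], is the rank of the ambient trivial bundle; the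
    framing cuts out the fibre by orthogonality to the columns of [v]. *)
Definition ambient1 := (multdim c2 (2 * 2) + multdim k (2 * n) + multdim (k - 1) 1)%N.

Definition algpart (w : 'cV[R]_ambient1) : 'M[R]_m :=
  skw (usubmx (usubmx w)) + dia (dsubmx w).

Definition theta (v : 'M[R]_(n, m)) (w : 'cV[R]_ambient1) : 'M[R]_(n, m) :=
  v *m algpart w + hor (dsubmx (usubmx w)).

(* For skew A, half of the inner product of A with the complex structure. *)
Definition hJ (A : 'M[R]_m) : R := \sum_(j < k) blk j j A 1 0.

Definition horizontal (v X : 'M[R]_(n, m)) := tang v X /\ hJ (v^T *m X) = 0.

Lemma hJD A B : hJ (A + B) = hJ A + hJ B.
Proof.
by rewrite /hJ -big_split; apply: eq_bigr => j _; rewrite blkD mxDE.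
Qed.

Lemma hJZ a A : hJ (a *: A) = a * hJ A.
Proof.
by rewrite /hJ mulr_sumr; apply: eq_bigr => j _; rewrite blkZ mxZE.
Qed.

Lemma hJ0 : hJ 0 = 0.
Proof. by rewrite -(scale0r 0) hJZ mul0r. Qed.

Lemma hJ_sum (I : Type) (r : seq I) (P : pred I) (F : I -> 'M[R]_m) :
  hJ (\sum_(i <- r | P i) F i) = \sum_(i <- r | P i) hJ (F i).
Proof. by apply: (big_morph hJ hJD hJ0). Qed.

Lemma hJ_cstr : hJ (@cstr R k) = k%:R.
Proof.
rewrite /hJ (eq_bigr (fun=> 1)) => [|j _]; first by rewrite sumr_const card_ord.
by rewrite blk_cstr eqxx scale1r rot90E.
Qed.

Lemma hJ_emb a b B : hJ (emb a b B) = (a == b)%:R * B 1 0.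
Proof.
rewrite /hJ (bigD1 a) //= big1 ?addr0 => [|j ja].
  by rewrite blk_emb eqxx mxZE eq_sym.
by rewrite blk_emb (negbTE ja) mxZE mul0r.
Qed.

Lemma algpart_skew w : (algpart w)^T = - algpart w.
Proof.
rewrite /algpart trD opprD; congr (_ + _).
  rewrite /skw raddf_sum /= -sumrN; apply: eq_bigr => l _.
  by rewrite trB trmxK opprB.
rewrite /dia raddf_sum /= -sumrN; apply: eq_bigr => l _.
rewrite trZ trB !emb_tr rot90_tr -scalerN; congr (_ *: _).
have embN a : emb a a (- rot90 R) = - emb a a (rot90 R).
  by rewrite /emb mulmxN mulNmx.
by rewrite !embN opprB opprK addrC.
Qed.

Lemma algpart_hJ w : hJ (algpart w) = 0.
Proof.
rewrite /algpart hJD /skw /dia !hJ_sum !big1 ?addr0 // => l _.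
  by rewrite hJZ -scaleN1r hJD hJZ !hJ_emb !eqxx mulN1r subrr mulr0.
have [lt _] := pairs_ltP; have := lt l (ltn_ord l).
case: (pairs_lt l) => a b /= ba.
rewrite -scaleN1r hJD hJZ emb_tr !hJ_emb -(eq_sym a b) -val_eqE /= (gtn_eqF ba).
by rewrite !mul0r mulr0 addr0.
Qed.

Lemma blk_embT0 (a b c d : 'I_k) (B : 'M[R]_2) : (b < a)%N -> (d <= c)%N ->
  blk a b (emb c d B)^T = 0.
Proof.
move=> ba dc; rewrite emb_tr blk_emb.
case: eqP => [ad|_]; case: eqP => [cb|_] /=; rewrite ?scale0r //.
by move: ba; rewrite ad -cb ltnNge dc.
Qed.

Lemma blk_lower (a b c d : 'I_k) (B : 'M[R]_2) : (b < a)%N -> (d < c)%N ->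
  blk a b (emb c d B - (emb c d B)^T) = ((c, d) == (a, b))%:R *: B.
Proof.
move=> ba dc; rewrite blkD blkN blk_embT0 ?oppr0 ?addr0 ?(ltnW dc) // blk_emb.
by rewrite xpair_eqE [a == c]eq_sym.
Qed.

(** A block strictly below the diagonal sees only one entry of [skw], since [dia] is block diagonal
    and the transposed terms lie above. Once [skw] is gone, block [dg l] of the diagonal returns the
    coefficient of index [l]. *)
Lemma algpart_eq0 w : algpart w = 0 ->
  usubmx (usubmx w) = 0 /\ dsubmx w = 0.
Proof.
rewrite /algpart => H.
have x0 : usubmx (usubmx w) = 0.
  apply: comp_eq0 => l lc; apply: unt_eq0.
  have [lt inj] := pairs_ltP; have ltl := lt _ lc.
  have := congr1 (blk (pairs_lt l).1 (pairs_lt l).2) H.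
  rewrite blk0 blkD /skw /dia !blk_sum [X in _ + X]big1 ?addr0; last first.
    move=> i _; rewrite blkZ blkD blkN !blk_emb.
    have E c : ((pairs_lt l).1 == c) && (c == (pairs_lt l).2) = false.
      by apply/negP => /andP[/eqP e1 /eqP e2]; move: ltl; rewrite e1 -e2 ltnn.
    by rewrite !E !scale0r subrr scaler0.
  rewrite (bigD1 (Ordinal lc)) //= big1 ?addr0 => [|i il].
    by rewrite blk_lower // eqxx scale1r.
  rewrite blk_lower //; last exact: lt.
  rewrite -!surjective_pairing; case: eqP => [/(inj _ _ (ltn_ord i) lc) e|_].
    by move: il; rewrite -val_eqE /= e eqxx.
  by rewrite scale0r.
split=> //; move: H; rewrite x0.
have -> : skw 0 = 0.
  rewrite /skw big1 // => l _; rewrite /entry2 mulmx0.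
  have -> : unt 0 = 0 :> 'M[R]_2 by apply/matrixP => i j; rewrite !mxE.
  by rewrite /emb mulmx0 mul0mx trmx0 subrr.
rewrite add0r => H; apply: comp_eq0 => l lk; apply/matrixP => i j; rewrite !ord1.
have := congr1 (fun A => blk (dg l) (dg l) A 1 0) H.
rewrite /dia blk_sum blk0 summxE mxE (bigD1 (Ordinal lk)) //= big1 ?addr0.
  rewrite blkZ blkD blkN !blk_emb eqxx (negbTE (dg_neq0 lk)) /= scale0r subr0.
  by rewrite scale1r mxZE rot90E /= mulr1 mx0E.
move=> a al; rewrite blkZ blkD blkN !blk_emb (negbTE (dg_neq0 lk)) /=.
have -> : (dg l == dg a) = false.
  rewrite -val_eqE /= !dgE //; apply/negP => /eqP[e].
  by move: al; rewrite -val_eqE /= e eqxx.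
by rewrite /= !scale0r subrr scaler0 mxE.
Qed.

Lemma hor_tang (v : 'M[R]_(n, m)) (w : 'cV[R]_ambient1) : (forall j, (j < k)%N ->
    unt (compmx k (2 * n) j *m dsubmx (usubmx w)) *m v = 0) ->
  v^T *m hor (dsubmx (usubmx w)) = 0.
Proof.
move=> H; rewrite /hor mulmx_sumr big1 // => j _.
by rewrite mulmxA -trmx_mul H // trmx0 mul0mx.
Qed.

Section Fibre.
Variable v : 'M[R]_(n, m).
Hypothesis vv : v^T *m v = 1%:M.

Lemma theta_horizontal (w : 'cV[R]_ambient1) : (forall j, (j < k)%N ->
    unt (compmx k (2 * n) j *m dsubmx (usubmx w)) *m v = 0) ->
  horizontal v (theta v w).
Proof.
move=> /hor_tang H.
have vt : v^T *m theta v w = algpart w.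
  by rewrite /theta mulmxDr mulmxA vv mul1mx H addr0.
split; last by rewrite vt algpart_hJ.
rewrite /tang vt -[X in _ + X]trmxK trmx_mul trmxK vt algpart_skew.
by rewrite addrN.
Qed.

Lemma theta_inj (w : 'cV[R]_ambient1) : (forall j, (j < k)%N ->
    unt (compmx k (2 * n) j *m dsubmx (usubmx w)) *m v = 0) ->
  theta v w = 0 -> w = 0.
Proof.
move=> /hor_tang H T0.
have vt : v^T *m theta v w = algpart w.
  by rewrite /theta mulmxDr mulmxA vv mul1mx H addr0.
have A0 : algpart w = 0 by rewrite -vt T0 mulmx0.
have [x1 x3] := algpart_eq0 A0.
have x2 : dsubmx (usubmx w) = 0.
  apply: comp_eq0 => j jk; apply: unt_eq0; apply: trmx_inj; rewrite trmx0.
  have := congr1 (mulmx^~ (sel (Ordinal jk))^T) T0.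
  rewrite /= /theta A0 mulmx0 add0r mul0mx /hor mulmx_suml.
  rewrite (bigD1 (Ordinal jk)) //= big1 ?addr0 => [|i ij].
    by rewrite -mulmxA sel_selT eqxx mulmx1.
  by rewrite -mulmxA sel_selT (negbTE ij) mul_mx_scalar scale0r.
by rewrite -[w]vsubmxK x3 -[usubmx w]vsubmxK x1 x2 !col_mx0.
Qed.

(* The symmetric matrices and the circle direction complement the horizontal space. *)
Lemma horizontal_symm_eq0 X y : horizontal v X ->
  X + v *m (symm y + tau o0 y *: @cstr R k) = 0 ->
  (forall l, (l < k - 1)%N -> tau (dg l) y = 0) -> X = 0 /\ y = 0.
Proof.
move=> [tX hX] E tl.
have E2 : v^T *m X + (symm y + tau o0 y *: @cstr R k) = 0.
  by have := congr1 (mulmx v^T) E; rewrite mulmxDr mulmxA vv mul1mx mulmx0.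
have sS : (symm y)^T = symm y.
  rewrite /symm raddf_sum /=; apply: eq_bigr => l _.
  by rewrite trD trmxK addrC.
have sA : (v^T *m X)^T = - (v^T *m X) by rewrite trmx_mul trmxK (tangE tX).
(* In [E2] everything but [symm y] is skew, so adding the transposed equation isolates it. *)
have S0 : symm y = 0.
  have := congr1 trmx E2; rewrite !trD trZ sS sA cstr_tr trmx0 => E3.
  have : symm y = - symm y.
    have := congr1 (fun M => M - symm y) (etrans E2 (esym E3)).
    move/matrixP => E4; apply/matrixP => i j; have := E4 i j.
    have /matrixP/(_ i j) := E2; have /matrixP/(_ i j) := E3.
    by rewrite !(mxDE, mxNE, mxZE, mx0E); lra.
  exact: mx_eq_opp.
(* Horizontality removes [X] under [hJ], and [hJ] takes the nonzero value [k] on the complex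
   structure. *)
have t0 : tau o0 y = 0.
  have := congr1 hJ E2; rewrite S0 add0r hJD hX add0r hJZ hJ_cstr hJ0.
  by move=> /eqP; rewrite mulf_eq0 pnatr_eq0 (gtn_eqF hk) orbF => /eqP.
have X0 : X = 0 by move: E; rewrite S0 t0 scale0r addr0 mulmx0 addr0.
split=> //.
have tj j : tau j y = 0.
  by have [->|/dg_surj[l lk <-]] := eqVneq j o0; [|exact: tl].
have [le inj] := pairs_leP.
apply: comp_eq0 => l lc; apply: unt_eq0; rewrite -/(entry2 y l).
have := congr1 (blk (pairs_le l).1 (pairs_le l).2) S0.
rewrite blk0 /symm blk_sum (bigD1 (Ordinal lc)) //= big1 ?addr0 => [|i il]; last first.
  have Ni : pairs_le i != pairs_le l.
    apply/eqP => /(inj _ _ (ltn_ord i) lc) e.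
    by move: il; rewrite -val_eqE /= e eqxx.
  rewrite blkD emb_tr !blk_emb.
  move: (le _ lc) (le _ (ltn_ord i)) Ni; case: (pairs_le l) => a b.
  case: (pairs_le i) => c d /=; rewrite xpair_eqE => ba dc Ni.
  have -> : (a == c) && (d == b) = false.
    by rewrite [a == c]eq_sym; exact: negbTE.
  have -> : (a == d) && (c == b) = false; last by rewrite !scale0r addr0.
  apply/negP => /andP[/eqP ad /eqP cb]; move: Ni; rewrite -ad cb [b == a]eq_sym andbb.
  by rewrite -val_eqE eqn_leq /= ba; move: dc; rewrite -ad cb => ->.
have ba := le _ lc.
have tauE : forall j, pairs_le l = (j, j) -> tau j y = skpart (entry2 y l).
  move=> j lj; rewrite /tau (bigD1 (Ordinal lc)) ?lj //= big1 ?addr0 // => i.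
  move=> /andP[/eqP ij il]; case/negP: il; apply/eqP/val_inj => /=.
  by apply: inj => //; rewrite ij lj.
move: ba tauE; case: (pairs_le l) => a b /= ba tauE.
rewrite blkD emb_tr !blk_emb !eqxx scale1r.
(* Off the diagonal the block itself appears in [symm y]. On the diagonal only $B+B^T=0$ is known,
   and the vanishing of [tau] supplies the skew part of $B$. *)
have [ab|ab] := eqVneq a b; last first.
  by rewrite scale0r addr0.
move: tauE; rewrite -ab => /(_ a erefl); rewrite tj /skpart scale1r => sk0 /matrixP H.
apply/matrixP => i j; have := H 0 0; have := H 0 1; have := H 1 0; have := H 1 1.
rewrite !(mxDE, mxTE, mx0E).
by case: (ord2P i) => ->; case: (ord2P j) => ->; lra.
Qed.

End Fibre.

End TangentModel.

(** * The isomorphism of the two models *)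

Lemma bin2_double k : ('C(k, 2) * 2 = k * k.-1)%N.
Proof. by rewrite bin2 muln2 halfK oddM; case: k => //= q; rewrite andNb subn0. Qed.

(** The two binomial terms are $2k(k-1)$ and $2k(k+1)$; their sum $4k^2$ cancels the defect of
    $2k(n-2k)$ from $2nk$. *)
Lemma rank_sum n k : (0 < k)%N -> (k * 2 <= n)%N ->
  ('C(k, 2) * (2 * 2) + k * (2 * (n - k * 2)) + (k - 1) * 1 + 'C(k.+1, 2) * (2 * 2) =
   n * k * 2 + (k - 1) * 1)%N.
Proof.
move=> hk hn; have := bin2_double k; have := bin2_double k.+1.
move: 'C(_, _) 'C(_, _) => a b; case: k hk hn => // q _ hn /=.
have [d ->] : exists d, n = (d + q.+1 * 2)%N by exists (n - q.+1 * 2)%N; lia.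
by rewrite addnK; nia.
Qed.

Lemma dimY_sum n k : (0 < k)%N -> (k * 2 <= n)%N ->
  dimY n k = ('C(k, 2) * (2 * 2) + k * (2 * (n - k * 2)) + (k - 1) * 1)%N.
Proof.
move=> hk hn; rewrite /dimY; have := bin2_double k; move: 'C(_, _) => a.
case: k hk hn => // q _ hn /=.
have [d ->] : exists d, n = (d + q.+1 * 2)%N by exists (n - q.+1 * 2)%N; lia.
by rewrite addnK; nia.
Qed.

Lemma continuous_linmx (R : realType) (T : topologicalType) p q r s
    (L : 'M[R]_(p, q) -> 'M[R]_(r, s)) (f : T -> 'M[R]_(p, q)) y :
  linear L -> {for y, continuous f} -> {for y, continuous (fun x => L (f x))}.
Proof.
move=> lL /mx_continuousP cf.
pose LM := GRing.isLinear.Build _ _ _ _ _ lL.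
pose LL : {linear 'M[R]_(p, q) -> 'M[R]_(r, s)} := HB.pack L LM.
apply: (continuous_fun_ext (f := fun x => \sum_i \sum_j f x i j *: LL (delta_mx i j))).
  move=> x; rewrite -[L]/(LL : _ -> _) [in RHS](matrix_sum_delta (f x)) linear_sum.
  by apply: eq_bigr => i _; rewrite linear_sum; apply: eq_bigr => j _; rewrite linearZ.
apply: continuous_summx => i _; apply: continuous_summx => j _.
by apply: continuous_scalemx; [exact: cf|exact: continuous_cstmx].
Qed.

Lemma continuous_mxof (R : realType) (T : topologicalType) p q
    (f : T -> 'cV[R]_p -> 'cV[R]_q) y :
  (forall x, {for y, continuous (f ^~ x)}) ->
  {for y, continuous (fun t => mxof (f t))}.
Proof.
move=> cf; apply/mx_continuousP => i j.
apply: (continuous_fun_ext (f := fun t => f t (delta_mx j 0) i 0)).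
  by move=> t; rewrite mxE.
by have /mx_continuousP := cf (delta_mx j 0); apply.
Qed.

(** * Equivariance, injectivity and surjectivity of the models *)

Section TangentFraming.
Context {R : realType} (n k : nat).
Hypotheses (hk : (0 < k)%N) (hn : (k * 2 <= n)%N).
Local Notation m := (k * 2)%N.
Local Notation c2 := 'C(k, 2).
Local Notation c3 := 'C(k.+1, 2).
Local Notation pi := (orbit_proj (circle R k)).
Local Notation zr := (zeta_r R n k).
Local Notation eps := (epsilon R n k).
Let o0 : 'I_k := Ordinal hk.

Definition rhs1 : vbundle R (Y R n k) :=
  whitney (whitney (multiple c2 (tensor zr zr)) (multiple k (tensor zr (@qxi R n k))))
    (multiple (k - 1) eps).

Definition rho1 (r : 'M[R]_2) : 'M[R]_(ambient1 n k) :=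
  block_mx (block_mx (multmx c2 (tensmx r r)) 0 0 (multmx k (tensmx r 1%:M))) 0 0
    (multmx (k - 1) 1%:M).

Definition zz_framing : framing hk (tensor zr zr) (fun r => tensmx r r : 'M[R]_(2 * 2)) :=
  tensor_framing (zeta_framing n hk) (zeta_framing n hk).

Definition zx_framing :
    framing hk (tensor zr (@qxi R n k)) (fun r => tensmx r 1%:M : 'M[R]_(2 * n)) :=
  tensor_framing (zeta_framing n hk) (qxi_framing hk hn).

Definition rhs1_framing : framing hk rhs1 rho1 :=
  whitney_framing (whitney_framing (multiple_framing zz_framing c2)
      (multiple_framing zx_framing k))
    (multiple_framing (trivial_framing n hk 1) (k - 1)).

Lemma usub_block p1 p2 q1 q2 (A : 'M[R]_(p1, q1)) (B : 'M[R]_(p2, q2)) x :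
  usubmx (block_mx A 0 0 B *m x) = A *m usubmx x :> 'cV_p1.
Proof. by rewrite -{1}[x]vsubmxK mul_block_col !mul0mx addr0 add0r col_mxKu. Qed.

Lemma dsub_block p1 p2 q1 q2 (A : 'M[R]_(p1, q1)) (B : 'M[R]_(p2, q2)) x :
  dsubmx (block_mx A 0 0 B *m x) = B *m dsubmx x :> 'cV_p2.
Proof. by rewrite -{1}[x]vsubmxK mul_block_col !mul0mx addr0 add0r col_mxKd. Qed.

(** The fibre of the pulled back canonical bundle is orthogonal to the columns of [v]; this is the
    condition under which [theta] is horizontal and injective. *)
Lemma rhs1_image v i (x : 'cV[R]_(vrank rhs1)) : vdom i (pi v) ->
  forall j, (j < k)%N ->
  unt (compmx k (2 * n) j *m dsubmx (usubmx (frm rhs1_framing v i *m x))) *m \val v = 0.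
Proof.
case: i => [[i1 i2] i3] [/= [Ei1 Ei2] Ei3] j jk.
rewrite usub_block dsub_block.
set z := compmx _ _ _ *m _.
have -> : unt z *m \val v = unt (tensmx 1%:M (\val v)^T *m z).
  by rewrite unt_tens mul1mx trmxK.
rewrite /z (multiple_framing_annihil (fE := zx_framing)) //.
  by apply/matrixP => a b; rewrite !mxE.
move=> [s e] [/= ss ee]; rewrite tensmx_mul mul1mx.
by have -> := qxi_mat_ortho ee; rewrite tensmx0.
Qed.

Section Equivariance.
Variable r : 'M[R]_2.
Hypothesis rS : SO2 r.
Local Notation D := (diag_circle k r).

Lemma entry2_equiv a (x : 'cV[R]_(multdim a (2 * 2))) l :
  entry2 ((multmx a (tensmx r r))^T *m x) l = r^T *m entry2 x l *m r.
Proof.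
by rewrite /entry2 multmxT mulmxA compmx_mult trmx_tens -mulmxA unt_tens trmxK.
Qed.

Lemma skw_equiv x : skw hk ((multmx c2 (tensmx r r))^T *m x) = D^T *m skw hk x *m D.
Proof.
rewrite /skw mulmx_sumr mulmx_suml; apply: eq_bigr => l _.
rewrite entry2_equiv mulmxBr mulmxBl emb_diag; congr (_ - _).
by rewrite !emb_tr emb_diag !trmx_mul trmxK mulmxA.
Qed.

Lemma symm_equiv x : symm hk ((multmx c3 (tensmx r r))^T *m x) = D^T *m symm hk x *m D.
Proof.
rewrite /symm mulmx_sumr mulmx_suml; apply: eq_bigr => l _.
rewrite entry2_equiv mulmxDr mulmxDl emb_diag; congr (_ + _).
by rewrite !emb_tr emb_diag !trmx_mul trmxK mulmxA.
Qed.

Lemma rot90_conj : r^T *m rot90 R *m r = rot90 R.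
Proof.
have C : rot90 R *m r = r *m rot90 R.
  have [rE _] := SO2_rot2 rS; rewrite rE /rot2 mulmxDl mulmxDr.
  by rewrite -!scalemxAl -!scalemxAr mulmx1 mul1mx.
by rewrite -mulmxA C mulmxA (SO2_orth rS) mul1mx.
Qed.

Lemma diag_orthr : D *m D^T = 1%:M.
Proof. by rewrite diag_circleT diag_circleM (SO2_orthr rS) diag_circle1. Qed.

Lemma cstr_conj : D^T *m @cstr R k *m D = @cstr R k.
Proof. by rewrite /cstr diag_circleT !diag_circleM rot90_conj. Qed.

(** Under $B\mapsto r^TBr$ the skew part of a $2\times2$ matrix is multiplied by $\det r=1$, so the
    [tau] are invariant scalars. *)
Lemma skpart_conj (B : 'M[R]_2) : skpart (r^T *m B *m r) = skpart B.
Proof.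
rewrite /skpart; have [_] := rS; rewrite det2E => d.
by rewrite -[RHS]mul1r -d !mul2E !mxTE; ring.
Qed.

Lemma tau_equiv j x : tau hk j ((multmx c3 (tensmx r r))^T *m x) = tau hk j x.
Proof.
by rewrite /tau; apply: eq_bigr => l _; rewrite entry2_equiv skpart_conj.
Qed.

Lemma dia_equiv x : dia hk x = D^T *m dia hk x *m D :> 'M[R]_m.
Proof.
rewrite /dia mulmx_sumr mulmx_suml; apply: eq_bigr => l _.
by rewrite -scalemxAr -scalemxAl mulmxBr mulmxBl !emb_diag rot90_conj.
Qed.

Lemma hor_equiv (x : 'cV[R]_(multdim k (2 * n))) :
  hor ((multmx k (tensmx r 1%:M))^T *m x) = hor x *m D.
Proof.
rewrite /hor mulmx_suml; apply: eq_bigr => j _.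
rewrite multmxT mulmxA compmx_mult trmx_tens -mulmxA unt_tens trmx1 trmx1 mulmx1.
by rewrite trmx_mul trmxK -!mulmxA sel_diag.
Qed.

(** The algebraic part $A$ becomes $D^TAD$, whose left factor cancels against $vD$. The diagonal
    coefficients do not change, since rotations commute with [rot90]. *)
Lemma theta_equiv (v : 'M[R]_(n, m)) w :
  theta hk (v *m D) ((rho1 r)^T *m w) = theta hk v w *m D.
Proof.
rewrite /theta /algpart /rho1 !tr_block_mx !trmx0 !usub_block !dsub_block.
rewrite skw_equiv hor_equiv mulmxDl; congr (_ + _).
rewrite multmxT trmx1 multmx1 mul1mx {1}dia_equiv -mulmxDl -mulmxDr.
by rewrite !mulmxA -(mulmxA v) diag_orthr mulmx1.
Qed.

End Equivariance.

Lemma lin_entry2 a l : linear (fun x => @entry2 R a x l).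
Proof. by apply: (lin_comp (@lin_unt R 2 2)); exact: lin_cVmul. Qed.

Lemma lin_skw : linear (@skw R k hk).
Proof.
apply: lin_sum => l; apply: lin_add; [|apply: lin_opp; apply: lin_tr];
  exact: (lin_comp (@lin_emb _ _ _ _) (lin_entry2 l)).
Qed.

Lemma lin_symm : linear (@symm R k hk).
Proof.
apply: lin_sum => l; apply: lin_add; [|apply: lin_tr];
  exact: (lin_comp (@lin_emb _ _ _ _) (lin_entry2 l)).
Qed.

Lemma lin_dia : linear (@dia R k hk).
Proof.
apply: lin_sum => l; apply: lin_scal => a x y.
by rewrite mulmxDr -scalemxAr mxDE mxZE.
Qed.

Lemma lin_hor : linear (@hor R n k).
Proof.
apply: lin_sum => l; apply: lin_mulr; apply: lin_tr.
by apply: (lin_comp (@lin_unt R _ _)); exact: lin_cVmul.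
Qed.

Lemma lin_theta v : linear (@theta R n k hk v).
Proof.
have lu := @lin_usub R (multdim c2 (2 * 2) + multdim k (2 * n)) (multdim (k - 1) 1).
apply: lin_add.
  apply: lin_mull; apply: lin_add.
    by apply: (lin_comp lin_skw); apply: (lin_comp (@lin_usub R _ _)); exact: lu.
  by apply: (lin_comp lin_dia); exact: lin_dsub.
by apply: (lin_comp lin_hor); apply: (lin_comp (@lin_dsub R _ _)); exact: lu.
Qed.

Lemma skpartP a (B C : 'M[R]_2) : skpart (a *: B + C) = a * skpart B + skpart C.
Proof. by rewrite /skpart !mxDE !mxZE; ring. Qed.

Lemma tauP j a x y : tau hk j (a *: x + y) = a * tau hk j x + tau hk j y :> R.
Proof.
rewrite /tau mulr_sumr -big_split; apply: eq_bigr => l _.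
by rewrite lin_entry2 skpartP.
Qed.

Let n0 : (0 < n)%N. Proof. by apply: leq_trans hn; rewrite muln_gt0 hk. Qed.

Definition row_pairs : nat -> 'I_n * 'I_k :=
  projT1 (cid (enum_pred_fun (Ordinal n0, o0) (xpredT : pred ('I_n * 'I_k)))).

Lemma row_pairs_surj p : exists2 l, (l < n * k)%N & row_pairs l = p.
Proof.
have E : #|(xpredT : pred ('I_n * 'I_k))| = (n * k)%N by rewrite card_prod !card_ord.
by rewrite -E /row_pairs; case: cid => f [] _ _ H /=; exact: H.
Qed.

Definition rowblocks (X : 'M[R]_(n, m)) : 'cV[R]_(multdim (n * k) 2) :=
  joinmx (n * k) (fun l => (row (row_pairs l).1 X *m (sel (row_pairs l).2)^T)^T).

Lemma lin_rowblocks : linear rowblocks.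
Proof.
apply: lin_join => l; apply: lin_tr; apply: lin_mulr.
by move=> a x y; apply/rowP => j; rewrite !mxE.
Qed.

Lemma rowblocks_eq0 X : rowblocks X = 0 -> X = 0.
Proof.
move=> /joinmx_eq0 H; apply: sel_eq0 => j; apply/row_matrixP => i.
have [l lk E] := row_pairs_surj (i, j); have := H l lk.
by rewrite E /= row_mul row0 => /(congr1 trmx); rewrite trmxK trmx0.
Qed.

Lemma rowblocks_equiv X r :
  rowblocks (X *m diag_circle k r) = (multmx (n * k) r)^T *m rowblocks X.
Proof.
rewrite /rowblocks multmxT joinmx_mult; congr (joinmx _ _); apply/funext => l.
by rewrite row_mul -mulmxA diag_selT mulmxA trmx_mul.
Qed.

Definition lam (v : 'M[R]_(n, m)) (z : 'cV[R]_(ambient1 n k + multdim c3 (2 * 2))) :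
    'cV[R]_(multdim (n * k) 2 + multdim (k - 1) 1) :=
  col_mx (rowblocks (theta hk v (usubmx z) +
      v *m (symm hk (dsubmx z) + tau hk o0 (dsubmx z) *: @cstr R k)))
    (joinmx (k - 1) (fun l => (tau hk (dg hk l) (dsubmx z))%:M)).

Lemma lin_lam v : linear (lam v).
Proof.
have lu := @lin_usub R (ambient1 n k) (multdim c3 (2 * 2)).
have ld := @lin_dsub R (ambient1 n k) (multdim c3 (2 * 2)).
apply: lin_col.
  apply: (lin_comp lin_rowblocks); apply: lin_add.
    by apply: (lin_comp (@lin_theta v)); exact: lu.
  apply: lin_mull; apply: lin_add.
    by apply: (lin_comp lin_symm); exact: ld.
  by apply: lin_scal => a x y; rewrite ld tauP.
apply: lin_join => l a x y.
by rewrite ld tauP raddfD /= -scale_scalar_mx.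
Qed.

Definition rhs1c : vbundle R (Y R n k) := whitney rhs1 (multiple c3 (tensor zr zr)).
Definition rhs2 : vbundle R (Y R n k) :=
  whitney (multiple (n * k) zr) (multiple (k - 1) eps).

Definition rhs1c_framing : framing hk rhs1c
    (fun r => block_mx (rho1 r) 0 0 (multmx c3 (tensmx r r))) :=
  whitney_framing rhs1_framing (multiple_framing zz_framing c3).
Definition rhs2_framing : framing hk rhs2
    (fun r => block_mx (multmx (n * k) r) 0 0 (multmx (k - 1) 1%:M)) :=
  whitney_framing (multiple_framing (zeta_framing n hk) (n * k))
    (multiple_framing (trivial_framing n hk 1) (k - 1)).

Lemma lam_equiv (v : 'M[R]_(n, m)) r z : SO2 r ->
  lam (v *m diag_circle k r) ((block_mx (rho1 r) 0 0 (multmx c3 (tensmx r r)))^T *m z) =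
  (block_mx (multmx (n * k) r) 0 0 (multmx (k - 1) 1%:M))^T *m lam v z.
Proof.
move=> rS; rewrite /lam [(block_mx (rho1 r) _ _ _)^T]tr_block_mx.
rewrite [(block_mx (multmx (n * k) r) _ _ _)^T]tr_block_mx !trmx0.
rewrite usub_block dsub_block.
rewrite mul_block_col !mul0mx addr0 add0r -rowblocks_equiv theta_equiv //.
congr (col_mx _ _).
  congr (rowblocks _); rewrite [RHS]mulmxDl; congr (_ + _); rewrite tau_equiv // symm_equiv //.
  rewrite -{1}(cstr_conj rS) scalemxAl scalemxAr -mulmxDl -mulmxDr.
  by rewrite !mulmxA -(mulmxA v) diag_orthr // mulmx1.
rewrite multmxT trmx1 multmx1 mul1mx; congr (joinmx _ _); apply/funext => l.
by rewrite tau_equiv.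
Qed.

Lemma lam_inj v i z : vdom i (pi v) ->
  lam (\val v) (frm rhs1c_framing v i *m z) = 0 -> frm rhs1c_framing v i *m z = 0.
Proof.
case: i => i j [/= Ei Ej]; rewrite /lam usub_block dsub_block.
have := rhs1_image (usubmx z) Ei.
move=> Him H.
have := congr1 usubmx H; rewrite col_mxKu linear0 => /rowblocks_eq0 H1.
have := congr1 dsubmx H; rewrite col_mxKd linear0 => /joinmx_eq0 H2.
have vv := stiefelP v.
have tl l : (l < k - 1)%N ->
    tau hk (dg hk l) (frm (multiple_framing zz_framing c3) v j *m dsubmx z) = 0.
  by move=> /H2 /matrixP/(_ 0 0); rewrite !mxE eqxx mulr1n.
have [T0 y0] := horizontal_symm_eq0 vv (theta_horizontal hk vv Him) H1 tl.
by rewrite -[z]vsubmxK mul_block_col !mul0mx addr0 add0r (theta_inj vv Him T0) y0 col_mx0.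
Qed.

Lemma vrank_multiple a (E : vbundle R (Y R n k)) : vrank (multiple a E) = (a * vrank E)%N.
Proof. by elim: a => //= a IH; rewrite mulSn -IH. Qed.

Lemma horizontalB (v X X' : 'M[R]_(n, m)) :
  horizontal v X -> horizontal v X' -> horizontal v (X - X').
Proof.
rewrite /horizontal /tang => -[tX hX] [tX' hX']; split.
  by rewrite trB mulmxBr mulmxBl addrACA -opprD tX tX' subr0.
by rewrite mulmxBr -scaleN1r hJD hJZ hX hX' mulr0 addr0.
Qed.

Lemma rank_rhs1 : vrank rhs1 = (c2 * (2 * 2) + k * (2 * (n - k * 2)) + (k - 1) * 1)%N.
Proof.
rewrite -[LHS]/(vrank (multiple c2 (tensor zr zr)) +
  vrank (multiple k (tensor zr (@qxi R n k))) + vrank (multiple (k - 1) eps))%N.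
by rewrite !vrank_multiple.
Qed.

Lemma rank_rhs1c : vrank rhs1c = (n * k * 2 + (k - 1) * 1)%N.
Proof.
rewrite -[LHS]/(vrank rhs1 + vrank (multiple c3 (tensor zr zr)))%N.
by rewrite rank_rhs1 vrank_multiple; exact: rank_sum.
Qed.

Lemma rank_rhs2 : vrank rhs2 = (n * k * 2 + (k - 1) * 1)%N.
Proof.
rewrite -[LHS]/(vrank (multiple (n * k) zr) + vrank (multiple (k - 1) eps))%N.
by rewrite !vrank_multiple.
Qed.

Lemma rank_dimY : dimY n k = vrank rhs1.
Proof. by rewrite rank_rhs1; exact: dimY_sum. Qed.

Lemma continuous_theta z v :
  {for v, continuous (fun u : stiefel R n m => theta hk (\val u) z)}.
Proof.
have cv := @val_continuous R n m v.
apply: continuous_addmx; last exact: continuous_cstmx.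
by apply: continuous_mulmx; [exact: cv|exact: continuous_cstmx].
Qed.

Lemma continuous_lam z v : {for v, continuous (fun u : stiefel R n m => lam (\val u) z)}.
Proof.
have cv := @val_continuous R n m v.
set c := joinmx (k - 1) (fun l => (tau hk (dg hk l) (dsubmx z))%:M).
pose L X := col_mx (rowblocks X) (0 : 'cV[R]_(multdim (k - 1) 1)).
apply: (continuous_fun_ext (f := fun u : stiefel R n m => L (theta hk (\val u) (usubmx z) +
   \val u *m (symm hk (dsubmx z) + tau hk o0 (dsubmx z) *: @cstr R k)) + col_mx 0 c)).
  by move=> u; rewrite /L add_col_mx addr0 add0r.
apply: continuous_addmx; last exact: continuous_cstmx.
apply: continuous_linmx.
  by apply: lin_col; [exact: lin_rowblocks|move=> a x y; rewrite scaler0 addr0].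
apply: continuous_addmx; first exact: continuous_theta.
by apply: continuous_mulmx; [exact: cv|exact: continuous_cstmx].
Qed.

Lemma rhs1c_iso_rhs2 : bundle_iso rhs1c rhs2.
Proof.
apply: (@framing_iso _ _ _ hk _ _ _ _ _ _ rhs1c_framing rhs2_framing
    (fun v => mxof (lam (\val v)))).
- by rewrite rank_rhs1c rank_rhs2.
- by rewrite rank_rhs2 !multdimE.
- by move=> v; apply: continuous_mxof => x; exact: continuous_lam.
- move=> v w vw; have [rS wE] := rotmP hk vw.
  apply: (can_inj (@trmxK _ _ _)); apply/row_matrixP => j.
  rewrite -!tr_col; congr trmx; rewrite !colE -!mulmxA !(mxofE _ (@lin_lam _)).
  by rewrite wE; exact: lam_equiv.
- move=> v i x Ei; rewrite mxofE; last exact: lin_lam.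
  exact: lam_inj.
Qed.

(* Equality of ranks in the second isomorphism turns injectivity of lam into
   surjectivity of theta. *)
Lemma theta_surj v i X : vdom i (pi v) -> horizontal (\val v) X ->
  exists x, X = theta hk (\val v) (frm rhs1_framing v i *m x).
Proof.
move=> Ei hX; pose u := \val v.
have [_ cover _ _ _] := frm_vbundle (multiple_framing zz_framing c3).
have [j Ej] := cover (pi v).
have Eij : @vdom _ _ rhs1c (i, j) (pi v) by [].
pose A := mxof (lam u) *m frm rhs1c_framing v (i, j).
have Ainj (x : 'cV_(vrank rhs1c)) : A *m x = 0 -> x = 0.
  rewrite /A -mulmxA mxofE; last exact: lin_lam.
  move=> /(lam_inj Eij) H.
  by rewrite -[x]mul1mx -(frm_orth rhs1c_framing Eij) -mulmxA H mulmx0.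
have AA : A *m linv A = 1%:M.
  apply: mulmx1_eqdim; last exact: linvK.
  by rewrite rank_rhs1c !multdimE.
(* The matrix [A] of [lam] is injective between spaces of equal dimension, so [X] together with zero
   scalars has a preimage. *)
pose z := linv A *m col_mx (rowblocks X) (0 : 'cV_(multdim (k - 1) 1)).
have : A *m z = col_mx (rowblocks X) (0 : 'cV_(multdim (k - 1) 1)).
  by rewrite /z mulmxA AA mul1mx.
rewrite /A -mulmxA mxofE; last exact: lin_lam.
rewrite /lam usub_block dsub_block => /eq_col_mx[H1 /joinmx_eq0 H2].
exists (usubmx z); apply/esym.
have Him := rhs1_image (usubmx z) Ei.
have vv := stiefelP v.
set W := theta _ _ _.
have hW := theta_horizontal hk vv Him.
have hD := horizontalB hW hX.
set y := frm _ v j *m dsubmx z in H1 H2.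
(* The difference [W - X] is horizontal, and by this equation it also lies in the complement spanned
   by the symmetric matrices and the circle direction; hence it vanishes. *)
have E0 : (W - X) + u *m (symm hk y + tau hk o0 y *: @cstr R k) = 0.
  rewrite addrAC; apply: rowblocks_eq0.
  by rewrite addrC -scaleN1r lin_rowblocks H1 scaleN1r addNr.
have tl l : (l < k - 1)%N -> tau hk (dg hk l) y = 0.
  by move=> /H2 /matrixP/(_ 0 0); rewrite !mxE eqxx mulr1n.
have [+ _] := horizontal_symm_eq0 vv hD E0 tl.
by move/eqP; rewrite subr_eq0 => /eqP.
Qed.

End TangentFraming.

(** * Charts of the orbit space *)

Section SliceSmoothness.
Context {R : realType} {V : normedModType R}.

Lemma smooth_mx_lin p q r s (L : 'M[R]_(p, q) -> 'M[R]_(r, s)) (O : set V)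
    (g : V -> 'M[R]_(p, q)) :
  linear L -> open O -> smooth_mx O g -> smooth_mx O (fun x => L (g x)).
Proof.
move=> lL oO sg; pose LM := GRing.isLinear.Build _ _ _ _ _ lL.
pose LL : {linear 'M[R]_(p, q) -> 'M[R]_(r, s)} := HB.pack L LM.
exact: (smooth_mx_lin1 oO LL sg).
Qed.

Lemma smooth_refl (O : set V) p (g : V -> 'cV[R]_p) : open O ->
  (forall x, O x -> dot (g x) (g x) != 0) -> smooth_mx O g ->
  smooth_mx O (fun x => refl (g x)).
Proof.
move=> oO g0 sg; apply: smooth_mxB => //; last exact: smooth_mx_cst.
apply: smooth_mxZ => //.
  apply: smoothM => //; first exact: smooth_cst.
  by apply: smooth_inv => //; exact: smooth_dot.
by apply: smooth_mxM => //; exact: smooth_mxT.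
Qed.

End SliceSmoothness.

Section SliceCharts.
Context {R : realType} (n k : nat).
Hypotheses (hk : (0 < k)%N) (hn : (k * 2 <= n)%N).
Local Notation m := (k * 2)%N.
Local Notation pi := (orbit_proj (circle R k)).
Local Notation J := (@cstr R k).
Local Notation e1 := (@unit_vec R k hk 0).
Local Notation e2 := (@unit_vec R k hk 1).

Let sJ : J^T = - J. Proof. exact: cstr_tr. Qed.
Let JJ : J *m J = - 1%:M. Proof. exact: cstr_sqr. Qed.
Let Je1 : J *m e1 = e2. Proof. exact: cstr_unit0. Qed.
Let Je2 : J *m e2 = - e1. Proof. by rewrite -Je1 mulmxA JJ mulNmx mul1mx. Qed.
Let e11 : dot e1 e1 = 1. Proof. by rewrite dot_unit eqxx. Qed.
Let e22 : dot e2 e2 = 1. Proof. by rewrite dot_unit eqxx. Qed.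
Let e12 : dot e1 e2 = 0. Proof. by rewrite dot_unit. Qed.

Variable v : stiefel R n m.
Local Notation v0 := (\val v).
Let vv : v0^T *m v0 = 1%:M. Proof. exact: stiefelP. Qed.
Local Notation norm := (slice_norm J e1 e2 v0).
Local Notation coord := (slice_coord J e1 e2 v0).
Local Notation param := (slice_param e2 v0).
Local Notation sdom := (slice_dom J e1 e2 v0).
Local Notation stang := (slice_tang e1 e2 v0).

Let center_neq0 (b : 'cV[R]_n) : dot (v0 *m e2) b = 0 ->
  dot (v0 *m e2 + b) (v0 *m e2 + b) != 0.
Proof.
move=> cb; rewrite dotDl !dotDr dot_isom // e22 cb (dotC b) cb addr0 add0r.
by rewrite gt_eqF // ltr_pwDl // dot_ge0.
Qed.

Let c_neq0 : dot (v0 *m e2) (v0 *m e2) != 0.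
Proof. by rewrite dot_isom // e22 oner_neq0. Qed.

Lemma smooth_slice_param (V : normedModType R) (O : set V) (g : V -> 'M[R]_(n, m)) :
  open O -> (forall x, O x -> stang (g x)) -> smooth_mx O g ->
  smooth_mx O (fun x => param (g x)).
Proof.
move=> oO tg sg.
have sc p q (A : 'M[R]_(p, q)) : smooth_mx O (fun=> A) by exact: smooth_mx_cst.
have sb : smooth_mx O (fun x => g x *m e2) by exact: smooth_mxM.
have sr : smooth_mx O (fun x => slice_rest e2 v0 (g x)).
  apply: smooth_mxD => //; first by apply: smooth_mxB => //; exact: smooth_mxM.
  apply: smooth_mxM => //; apply: smooth_mxM => //; exact: smooth_mxT.
have ss : smooth_mx O (fun x => sk v0 (slice_rest e2 v0 (g x))).
  apply: smooth_mxB => //.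
    apply: smooth_mxB => //; apply: smooth_mxM => //; exact: smooth_mxT.
  by do 2 (apply: smooth_mxM => //); exact: smooth_mxM.
apply: smooth_mxM => //.
  apply: smooth_refl => //; last exact: smooth_mxD.
  by move=> x Ox; apply: center_neq0; exact: slice_tang_beta (tg x Ox).
apply: smooth_mxM => //; apply: smooth_mxM => //; apply: smooth_mxM => //; last first.
  exact: smooth_mxD.
apply: smooth_mxV => //; last exact: smooth_mxB.
move=> x Ox; rewrite -unitfE -unitmxE; apply/skew_unit/sk_skew.
exact: slice_rest_tang (tg x Ox).
Qed.

Let dom2 : set 'M[R]_(n, m) :=
  [set u | rho_dom hk v u /\ 1 + dot (v0 *m e2) (norm u *m e2) != 0].

Let smooth_vec p (O : set 'M[R]_(n, m)) (g : 'M[R]_(n, m) -> 'M[R]_(n, m))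
    (A : 'M[R]_(m, p)) : open O -> smooth_mx O g -> smooth_mx O (fun u => g u *m A).
Proof. by move=> oO sg; apply: smooth_mxM => //; exact: smooth_mx_cst. Qed.

Let smooth_den (O : set 'M[R]_(n, m)) : open O -> O `<=` rho_dom hk v ->
  smooth O (fun u => 1 + dot (v0 *m e2) (norm u *m e2)).
Proof.
move=> oO sub; apply: smoothD => //; first exact: smooth_cst.
apply: smooth_dot => //; first exact: smooth_mx_cst.
by apply: smooth_vec => //; apply: smooth_mx_sub (@smooth_slice_norm R n k hk v).
Qed.

Let open_dom2 : open dom2.
Proof.
by have o := @open_rho_dom R n k hk v; apply: open_neq0 => //; exact: smooth_den.
Qed.

Let smooth_norm2 : smooth_mx dom2 norm.
Proof. by apply: smooth_mx_sub (@smooth_slice_norm R n k hk v) => u []. Qed.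

Let smooth_beta : smooth_mx dom2 (slice_beta J e1 e2 v0).
Proof.
apply: smooth_mxB => //; last exact: smooth_mx_cst.
apply: smooth_mxZ => //.
  by apply: smooth_inv => // [u []//|]; apply: smooth_den => // u [].
by apply: smooth_mxD => //; [exact: smooth_vec|exact: smooth_mx_cst].
Qed.

Let smooth_back : smooth_mx dom2 (slice_back J e1 e2 v0).
Proof.
apply: smooth_mxM => //; first exact: smooth_mx_cst.
apply: smooth_mxM => //; apply: smooth_refl => //.
  move=> u [_ ct]; apply: center_neq0.
  rewrite /slice_beta dotDr dotNr dotZr dotDr dot_isom // e22.
  by rewrite [dot _ _ + 1]addrC mulVf // subrr.
by apply: smooth_mxD => //; exact: smooth_mx_cst.
Qed.

Let sdomE : sdom = [set u | dom2 u /\ \det (1%:M + v0^T *m slice_back J e1 e2 v0 u) != 0].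
Proof.
apply/seteqP; split=> u.
  by move=> [r0 c0]; rewrite unitmxE unitfE => d0; split=> //; split.
by move=> [[[_ r0] c0] d0]; split=> //; rewrite unitmxE unitfE.
Qed.

Let smooth_vback (O : set 'M[R]_(n, m)) : open O -> O `<=` dom2 ->
  smooth_mx O (fun u => 1%:M + v0^T *m slice_back J e1 e2 v0 u).
Proof.
move=> oO sub; apply: smooth_mxD => //; first exact: smooth_mx_cst.
by apply: smooth_mxM => //; [exact: smooth_mx_cst|exact: smooth_mx_sub smooth_back].
Qed.

Lemma open_slice_dom : open sdom.
Proof.
by rewrite sdomE; apply: open_neq0 => //; apply: smooth_det => //; exact: smooth_vback.
Qed.

Lemma smooth_slice_coord : smooth_mx sdom coord.
Proof.
have oS := open_slice_dom.
have sub : sdom `<=` dom2 by rewrite sdomE => u [].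
have sc p q (A : 'M[R]_(p, q)) : smooth_mx sdom (fun=> A) by exact: smooth_mx_cst.
have sb := smooth_mx_sub sub smooth_beta.
have sk := smooth_mx_sub sub smooth_back.
have sa : smooth_mx sdom (fun u => v0^T *m slice_back J e1 e2 v0 u) by exact: smooth_mxM.
have sN : smooth_mx sdom (fun u => invmx (1%:M + v0^T *m slice_back J e1 e2 v0 u)).
  apply: smooth_mxV => //; last exact: smooth_vback.
  by rewrite sdomE => u [].
have sNT := smooth_mxT oS sN; have saT := smooth_mxT oS sa.
apply: smooth_mxB => //; last first.
  by apply: smooth_mxM => //; apply: smooth_mxM => //; exact: smooth_mxT.
apply: smooth_mxD => //; last exact: smooth_mxM.
apply: smooth_mxD => //.
  apply: smooth_mxM => //; apply: smooth_mxM => //; apply: smooth_mxM => //.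
  exact: smooth_mxB.
apply: smooth_mxM => //; apply: smooth_mxB => //; exact: smooth_mxM.
Qed.

(** Horizontal vectors and vectors tangent to the slice both complement the line of [v J] among the
    tangent vectors at [v]. The functional [a], with value 1 on [v J], projects to the first space;
    [b], with value $-1$ there because $Je_2=-e_1$, corrects into the second. The map [K] is the
    model [theta] followed by this correction, and surjectivity of [theta] makes [C] its two-sided
    inverse. *)
Lemma slice_coordinates : exists K : 'rV[R]_(dimY n k) -> 'M[R]_(n, m),
  exists C : 'M[R]_(n, m) -> 'rV[R]_(dimY n k),
  [/\ linear K, linear C, forall x, stang (K x), forall x, C (K x) = x &
      forall X, stang X -> K (C X) = X].
Proof.
rewrite (@rank_dimY R n k hk hn).
have [_ cover _ _ _] := frm_vbundle (rhs1_framing (R := R) hk hn).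
have [i Ei] := cover (pi v); set fr := frm (rhs1_framing hk hn) v i.
pose T (x : 'cV[R]_(vrank (@rhs1 R n k))) := theta hk v0 (fr *m x).
have lT : linear T by apply: (lin_comp (@lin_theta R n k hk v0)); exact: lin_cVmul.
have hT x : horizontal v0 (T x) by apply: theta_horizontal => // j jk; exact: rhs1_image.

pose rb := @rowblocks R n k hk hn.
pose B := mxof (fun x => rb (T x)).
have lrT : linear (fun x => rb (T x)) by apply: lin_comp lT; exact: lin_rowblocks.
have Binj (x : 'cV_(vrank (@rhs1 R n k))) : B *m x = 0 -> x = 0.
  rewrite /B mxofE // => /rowblocks_eq0 H.
  have {H} : fr *m x = 0.
    by apply: theta_inj H => // j jk; exact: rhs1_image.
  by move=> H; rewrite -[x]mul1mx -(frm_orth (rhs1_framing hk hn) Ei) -mulmxA H mulmx0.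
pose a X := hJ (v0^T *m X) / k%:R.
pose hz X := X - a X *: (v0 *m J).
pose b X := dot (v0 *m e1) (X *m e2).
have k0 : k%:R != 0 :> R by rewrite pnatr_eq0 -lt0n.
have la s X X' : a (s *: X + X') = s * a X + a X'.
  by rewrite /a mulmxDr -scalemxAr hJD hJZ mulrDl mulrA.
have lb s X X' : b (s *: X + X') = s * b X + b X'.
  by rewrite /b mulmxDl -scalemxAl dotDr dotZr.
have tJ s : tang v0 (s *: (v0 *m J)).
  by apply: tangZ; rewrite /tang trmx_mul sJ mulmxA vv mul1mx -[_ *m v0]mulmxA vv mulmx1 subrr.
have bJ : b (v0 *m J) = -1.
  by rewrite /b -mulmxA Je2 mulmxN dotNr dot_isom // e11.
have aJ : a (v0 *m J) = 1 by rewrite /a mulmxA vv mul1mx hJ_cstr divff.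
have tD X X' : tang v0 X -> tang v0 X' -> tang v0 (X + X').
  by rewrite /tang => tX tX'; rewrite trD mulmxDr mulmxDl addrACA tX tX' addr0.
have aT x : a (T x) = 0 by rewrite /a (hT x).2 mul0r.
have hzh X : tang v0 X -> horizontal v0 (hz X).
  move=> tX; split; first by rewrite /hz -scaleNr; exact: tD.
  have := la (- a X) (v0 *m J) X; rewrite aJ mulr1 addNr => /eqP.
  by rewrite {1}/a mulf_eq0 invr_eq0 (negbTE k0) orbF addrC scaleNr => /eqP.
pose K (x : 'rV[R]_(vrank (@rhs1 R n k))) := T x^T + b (T x^T) *: (v0 *m J).
pose C X := (linv B *m rb (hz X))^T.
exists K, C.
have bK x : b (K x) = 0.
  by rewrite /K addrC lb bJ mulrN1 addNr.
have tK x : stang (K x) by split; [apply: tD => //; case: (hT x^T)|exact: bK].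
have hzK x : hz (K x) = T x^T.
  rewrite /hz; have -> : a (K x) = b (T x^T) by rewrite /K addrC la aJ aT mulr1 addr0.
  by rewrite addrK.
have lK : linear K.
  apply: lin_add; first by apply: (lin_comp lT); apply: lin_tr => s x y.
  apply: lin_scal => s x y; rewrite -lb; congr (b _).
  by rewrite trD trZ lT.
have lC : linear C.
  apply: lin_tr; apply: lin_mull; apply: (lin_comp (@lin_rowblocks R n k hk hn)).
  apply: lin_add => //; apply: lin_opp; exact: lin_scal.
have rbT x : linv B *m rb (T x) = x.
  have <- : B *m x = rb (T x) by rewrite /B mxofE.
  by rewrite mulmxA linvK // mul1mx.
split=> // [x|X tX].
  by rewrite /C hzK rbT trmxK.
have [y yE] := @theta_surj R n k hk hn v i (hz X) Ei (hzh X tX.1).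
have CE : C X = y^T by rewrite /C yE -/fr -/(T y) rbT.
rewrite /K CE trmxK -[T y]yE /hz -scaleNr [in b _]addrC lb bJ mulrN1 opprK.
have -> : b X = 0 by exact: tX.2.
by rewrite addr0 scaleNr subrK.
Qed.

Lemma slice_dom_orbit u w : pi u = pi w -> sdom (\val u) -> sdom (\val w).
Proof.
move=> /orbit_projP[_ [r rS <-] ->]; have [_ r1] := SO2_rot2 rS.
rewrite diag_circle_SO2; last exact: rS.
exact: (slice_dom_rot JJ Je1 r1).
Qed.

Lemma slice_coord_orbit u w : pi u = pi w -> coord (\val u) = coord (\val w).
Proof.
move=> /orbit_projP[_ [r rS <-] ->]; have [_ r1] := SO2_rot2 rS.
by rewrite diag_circle_SO2; [rewrite (slice_coord_rot JJ Je1 _ _ r1)|exact: rS].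
Qed.

Let pstief (X : 'M[R]_(n, m)) : stiefel R n m := stiefel_of v (param X).

Let pstiefE X : stang X -> \val (pstief X) = param X.
Proof. by move=> tX; exact: (stiefel_ofE _ (slice_param_stiefel e22 vv tX)). Qed.

Let coord_tang (u : stiefel R n m) : sdom (\val u) -> stang (coord (\val u)).
Proof. exact: (slice_coord_tang sJ JJ Je1 e22 e12 vv (stiefelP u)). Qed.

Let coordK (u : stiefel R n m) : sdom (\val u) -> param (coord (\val u)) = norm (\val u).
Proof. exact: (slice_coordK sJ JJ e22 vv (stiefelP u)). Qed.

Let pstief_coord u : sdom (\val u) -> pi (pstief (coord (\val u))) = pi u.
Proof.
move=> du; have [r0 _ _] := du.
apply/esym/orbit_projP; have [r [rS E]] := slice_normP r0.
exists (diag_circle k r); first by exists r.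
by rewrite (pstiefE (coord_tang du)) (coordK du).
Qed.

Section Chart.
Variables (K : 'rV[R]_(dimY n k) -> 'M[R]_(n, m)) (C : 'M[R]_(n, m) -> 'rV[R]_(dimY n k)).
Hypotheses (lK : linear K) (lC : linear C) (tK : forall x, stang (K x)).
Hypotheses (CK : forall x, C (K x) = x) (KC : forall X, stang X -> K (C X) = X).

Let dom : set (Y R n k) := [set y | sdom (\val (repr y))].
Let phi (y : Y R n k) := C (coord (\val (repr y))).
Let inv (x : 'rV[R]_(dimY n k)) : Y R n k := pi (pstief (K x)).

Let phi_pi u : phi (pi u) = C (coord (\val u)).
Proof. exact: (congr1 C (slice_coord_orbit (orbit_projK (pi u)))). Qed.

Let dom_pi u : dom (pi u) <-> sdom (\val u).
Proof.
split; first exact: (slice_dom_orbit (orbit_projK (pi u))).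
exact: (slice_dom_orbit (esym (orbit_projK (pi u)))).
Qed.

Let invK y : dom y -> inv (phi y) = y.
Proof.
rewrite -(orbit_projK y) => /dom_pi du; rewrite /inv phi_pi (KC (coord_tang du)).
exact: pstief_coord.
Qed.

Let smooth_pK : smooth_mx setT (fun x => param (K x)).
Proof.
apply: smooth_slice_param => //; first exact: openT.
by apply: smooth_mx_lin; [|exact: openT|exact: smooth_mx_id].
Qed.

(** On the image of [param] the value of [slice_im] is zero, but [slice_re] may be negative;
    normalisation then changes the sign of the point and does not give it back. Positivity excludes
    these parameters. *)
Let im : set 'rV[R]_(dimY n k) :=
  [set x | setT x /\ ([set u | sdom u /\ 0 < slice_re e1 v0 u] (param (K x)))].

Let open_im : open im.
Proof.
apply: open_preim => //; first exact: openT.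
by apply: open_gt0; [|apply: smooth_slice_re]; exact: open_slice_dom.
Qed.

Let imE : phi @` dom = im.
Proof.
apply/seteqP; split=> [_ [y dy <-]|x [_ [dx x0]]].
  move: dy; rewrite -(orbit_projK y) => /dom_pi du.
  rewrite phi_pi /im /= (KC (coord_tang du)).
  have [r0 _ _] := du; have [r [rS E]] := slice_normP r0.
  rewrite (coordK du); split; [exact: I|split].
    have [_ r1] := SO2_rot2 rS.
    rewrite E diag_circle_SO2; last exact: rS.
    exact: (slice_dom_rot JJ Je1 r1 du).
  by rewrite (slice_re_norm Je1 r0) sqrtr_gt0.
have E := pstiefE (tK x).
exists (inv x); first by apply/dom_pi; rewrite E.
by rewrite /inv phi_pi E (slice_paramK J e22 e12 vv (tK x) x0).
Qed.

Let cinv x : {for x, continuous inv}.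
Proof.
apply: (@continuous_comp _ _ _ (fun x => pstief (K x)) pi); last exact: orbit_proj_continuous.
apply: stiefel_continuous.
apply: (continuous_fun_ext (f := fun x => param (K x))); first by move=> z; rewrite pstiefE.
exact: smooth_mx_continuous smooth_pK _.
Qed.

Let smooth_Cc : smooth_mx sdom (fun u => C (coord u)).
Proof. by apply: smooth_mx_lin => //; [exact: open_slice_dom|exact: smooth_slice_coord]. Qed.

Let cphi y : dom y -> {for y, continuous phi}.
Proof.
rewrite -(orbit_projK y) => /dom_pi du; apply: orbit_continuous.
apply: (continuous_fun_ext (f := fun u : stiefel R n m => C (coord (\val u)))).
  by move=> u; rewrite /= phi_pi.
apply: (@continuous_comp _ _ _ (fun u : stiefel R n m => \val u) (fun u => C (coord u))).
  exact: val_continuous.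
exact: smooth_mx_continuous smooth_Cc du.
Qed.

Let open_dom : open dom.
Proof. by apply: open_orbit_set; [exact: open_slice_dom|exact: slice_dom_orbit]. Qed.

Let imW (W : set (Y R n k)) : W `<=` dom -> phi @` W = im `&` inv @^-1` W.
Proof.
move=> Wd; apply/seteqP; split=> [_ [y Wy <-]|x [imx Wx]].
  by split; [rewrite -imE; exists y => //; exact: Wd|rewrite /= invK //; exact: Wd].
exists (inv x) => //; move: imx; rewrite -imE => -[y dy <-].
by rewrite invK.
Qed.

Let inv_im (W : set (Y R n k)) x : W `<=` dom -> (phi @` W) x -> W (inv x).
Proof. by move=> Wd [y Wy <-]; rewrite (invK (Wd _ Wy)). Qed.

Let open_imW (W : set (Y R n k)) : open W -> W `<=` dom -> open (phi @` W).
Proof.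
move=> oW /imW ->; apply: openI => //.
by apply: open_comp => // x _; exact: cinv.
Qed.

(** In one direction a local extension of [f] to matrices is composed with the smooth map
    [param \o K]. In the other, [(f \o inv)] composed with the coordinates [C (coord z)] is the
    extension, since [coord] is defined and smooth on an open set of matrices. *)
Let smooth_phi (W : set (Y R n k)) (f : Y R n k -> R) : open W -> W `<=` dom ->
  (orbit_fstruct W f <-> smooth (phi @` W) (f \o inv)).
Proof.
move=> oW Wd; have oim := open_imW oW Wd; split=> [Hf|sf].
  apply: smooth_local => x Wx; pose w := pstief (K x).
  have Ww : (pi @^-1` W) w := inv_im Wd Wx.
  have [U [F [oU Uw sF FE]]] := Hf w Ww.
  pose N := [set z | (phi @` W) z /\ U (param (K z))].
  have sN : smooth_mx (phi @` W) (fun z => param (K z)).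
    by apply: smooth_mx_sub smooth_pK.
  have oN : open N by exact: open_preim.
  exists N; first by split=> //; move: Uw; rewrite /w pstiefE.
  have sN' : smooth_mx N (fun z => param (K z)) by apply: smooth_mx_sub sN => z [].
  have sFN : smooth N (F \o (fun z => param (K z))).
    by apply: (smooth_comp oN sF sN') => z [].
  apply: smooth_ext oN _ sFN => z [Wz Uz].
  have Wpz : (pi @^-1` W) (pstief (K z)) := inv_im Wd Wz.
  by have := FE _ Wpz; rewrite (pstiefE (tK z)) => /(_ Uz).
move=> u Wu; have du := (dom_pi u).1 (Wd _ Wu).
pose N := [set z | sdom z /\ (phi @` W) (C (coord z))].
have oN : open N by apply: open_preim smooth_Cc oim; exact: open_slice_dom.
exists N, ((f \o inv) \o (fun z => C (coord z))); split.
- exact: oN.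
- have Cu : (phi @` W) (C (coord (\val u))) :=
    eq_ind _ (phi @` W) (imageP phi Wu) _ (phi_pi u).
  exact: conj du Cu.
- have sN : smooth_mx N (fun z => C (coord z)) by apply: smooth_mx_sub smooth_Cc => z [].
  by apply: smooth_comp oN sf sN _ => z [].
- move=> w Ww _; rewrite [LHS]/= -(phi_pi w).
  exact: (congr1 f (invK (Wd _ Ww))).
Qed.

Let open_phim : open (phi @` dom). Proof. exact: open_imW. Qed.

Let cinv_im x : (phi @` dom) x -> {for x, continuous inv}.
Proof. by move=> _; exact: cinv. Qed.

Lemma slice_chart : exists c : chart (@orbit_fstruct R n _ (circle R k)) (dimY n k),
  chart_dom c (pi v).
Proof.
exists (Chart open_dom open_phim invK cphi cinv_im smooth_phi) => /=.
by apply/dom_pi; exact: slice_dom_center.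
Qed.

End Chart.

Lemma chart_exists : exists c : chart (@orbit_fstruct R n _ (circle R k)) (dimY n k),
  chart_dom c (pi v).
Proof.
have [K [C [lK lC tK CK KC]]] := slice_coordinates.
exact: (slice_chart lK lC tK CK KC).
Qed.

End SliceCharts.

(** * Tangent bundles *)

Section TangentBundle.
Context {R : realType} {B : topologicalType} (C : fstruct R B) (d : nat).
Local Notation chart := (chart C d).
Local Notation TB := (tangent_bundle C d).
Implicit Types phi psi chi : chart.

Lemma open_chart_image phi (W : set B) : open W -> W `<=` chart_dom phi ->
  open (phi @` W).
Proof.
move=> oW Wd.
have -> : phi @` W = (phi @` chart_dom phi) `&` (chart_inv phi @^-1` W).
  apply/seteqP; split=> [_ [y Wy <-]|x [[y dy <-]]].
    by split; [exists y => //; exact: Wd|rewrite /= chartK //; exact: Wd].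
  by rewrite /= chartK // => Wy; exists y.
rewrite openE => x [ix Wx]; rewrite /interior.
have H1 := open_nbhs_nbhs (conj (@chart_im_open _ _ _ _ phi) ix).
have H2 : nbhs x (chart_inv phi @^-1` W).
  exact: (chart_inv_continuous ix) (open_nbhs_nbhs (conj oW Wx)).
by apply: filterS2 H1 H2 => z.
Qed.

Lemma chart_coord_smooth phi (W : set B) j : open W -> W `<=` chart_dom phi ->
  C W (fun y => phi y 0 j).
Proof.
move=> oW Wd; apply/(chart_smooth _ oW Wd).
apply: smooth_ext (@smooth_mx_id R 1 d _ 0 j); first exact: open_chart_image.
by move=> _ [y Wy <-]; rewrite /= chartK //; exact: Wd.
Qed.

Definition transition phi psi : 'rV[R]_d -> 'rV[R]_d := phi \o chart_inv psi.

(** Compatibility of charts is a consequence of the common functional structure: the coordinates of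
    [phi] are smooth functions, and [psi] must see them as smooth. *)
Lemma transition_smooth phi psi (W : set B) : open W -> W `<=` chart_dom phi ->
  W `<=` chart_dom psi -> smooth_mx (psi @` W) (transition phi psi).
Proof.
move=> oW Wf Wp i j.
have -> : (fun x => transition phi psi x i j) =
    (fun y => phi y 0 j) \o chart_inv psi.
  by apply/funext => x; rewrite (ord1 i).
by apply/(chart_smooth _ oW Wp); exact: chart_coord_smooth.
Qed.

Lemma transition_diff phi psi y : chart_dom phi y -> chart_dom psi y ->
  differentiable (transition phi psi) (psi y).
Proof.
move=> fy py; have oW := openI (@chart_dom_open _ _ _ _ phi) (@chart_dom_open _ _ _ _ psi).
have sub1 : chart_dom phi `&` chart_dom psi `<=` chart_dom phi by move=> ? [].
have sub2 : chart_dom phi `&` chart_dom psi `<=` chart_dom psi by move=> ? [].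
apply: smooth_mx_differentiable (transition_smooth oW sub1 sub2) _.
by exists y.
Qed.

Lemma near_chart phi y (W : set B) : open W -> W y -> chart_dom phi y ->
  \forall x \near phi y, W (chart_inv phi x) /\
    chart_dom phi (chart_inv phi x) /\ phi (chart_inv phi x) = x.
Proof.
move=> oW Wy fy; have oV := openI oW (@chart_dom_open _ _ _ _ phi).
have sub : W `&` chart_dom phi `<=` chart_dom phi by move=> ? [].
have : nbhs (phi y) (phi @` (W `&` chart_dom phi)).
  by apply: open_nbhs_nbhs; split; [exact: open_chart_image|exists y].
by apply: filterS => _ [z [Wz fz] <-]; rewrite chartK.
Qed.

Lemma vtrans_transition phi psi y (x : 'rV[R]_d) :
  @vtrans _ _ TB phi psi y *m x^T = ('d (transition phi psi) (psi y) x)^T.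
Proof. by rewrite /= -trmx_mul mul_rV_lin1. Qed.

Lemma cV_eqmx p q (M N : 'M[R]_(p, q)) :
  (forall x : 'rV[R]_q, M *m x^T = N *m x^T) -> M = N.
Proof.
move=> H; apply/matrixP => i j.
have /matrixP/(_ i 0) := H (delta_mx 0 j).
by rewrite trmx_delta -!colE !mxE.
Qed.

Lemma tangent_bundle_is_vbundle : (forall y, exists phi, chart_dom phi y) ->
  is_vbundle TB.
Proof.
move=> cover; split.
- by move=> phi; exact: chart_dom_open.
- exact: cover.
- move=> phi psi y fy py; apply: continuous_trmx; apply/mx_continuousP => i j.
  pose W := chart_dom phi `&` chart_dom psi.
  have oW : open W by apply: openI; exact: chart_dom_open.
  have sub1 : W `<=` chart_dom phi by move=> ? [].
  have sub2 : W `<=` chart_dom psi by move=> ? [].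
  have st := transition_smooth oW sub1 sub2.
  have c : {for psi y, continuous
      (fun x => 'd (fun z => transition phi psi z 0 j) x (delta_mx 0 i))}.
    have Wy : (psi @` W) (psi y) by exists y.
    have sd := @smooth_diff _ _ _ _ (delta_mx 0 i : 'rV[R]_d) (st 0 j).
    exact: (smooth_continuous sd Wy).
  have c' := @continuous_comp _ _ _ psi (fun x => 'd (fun z => transition phi psi z 0 j) x
    (delta_mx 0 i)) y (chart_continuous py) c.
  apply: continuous_near_eq c'.
  have : nbhs y W by apply: open_nbhs_nbhs.
  apply: filterS => z Wz /=; rewrite mxE -diff_mxE //.
  by apply: transition_diff; [exact: sub1|exact: sub2].
- move=> phi y fy; apply: cV_eqmx => x.
  rewrite vtrans_transition mul1mx; congr trmx.
  have E : \forall z \near phi y, id z = transition phi phi z.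
    by apply: filterS (near_chart (@chart_dom_open _ _ _ _ phi) fy fy) => z [_ [_ /esym]].
  have did : differentiable (@id 'rV[R]_d) (phi y) by exact: ex_diff.
  have [_ ->] := diff_near_eq E did.
  by rewrite diff_val.
- move=> phi psi chi y fy py cy; apply: cV_eqmx => x.
  apply: etrans (esym (mulmxA _ _ _)) _.
  apply: etrans (congr1 (mulmx _) (vtrans_transition psi chi y x)) _.
  apply: etrans (vtrans_transition phi psi y _) _.
  apply: etrans _ (esym (vtrans_transition phi chi y x)); apply: (congr1 trmx).
  have dpc := transition_diff py cy.
  have E0 : transition psi chi (chi y) = psi y by rewrite /transition /= chartK.
  have dfp : differentiable (transition phi psi) (transition psi chi (chi y)).
    by rewrite E0; exact: transition_diff.
  have E : \forall z \near chi y,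
      (transition phi psi \o transition psi chi) z = transition phi chi z.
    apply: filterS (near_chart (@chart_dom_open _ _ _ _ psi) py cy) => z [pz _].
    by rewrite /transition /= chartK.
  have [_ DE] := diff_near_eq E (differentiable_comp dpc dfp).
  apply: etrans _ (esym (congr1 (@^~ x) DE)).
  apply: etrans _ (esym (congr1 (@^~ x) (diff_comp dpc dfp))).
  exact: (congr1 (fun z => 'd (transition phi psi) z ('d (transition psi chi) (chi y) x))
    (esym E0)).
Qed.

End TangentBundle.

(** Carathéodory's form of the derivative: a slope that is continuous at 0 takes the derivative as
    its value there. It spares computing the differential of an inverse matrix. *)
Lemma slope_diff (R : realType) (W : normedModType R) (f h : R -> W) :
  (forall t, f t = f 0 + t *: h t) -> {for 0, continuous h} ->
  differentiable f (0 : R) /\ 'd f (0 : R) 1 = h 0.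
Proof.
move=> fE ch.
have c : (t^-1 *: ((f \o shift 0) (t *: (1 : R)) - f 0)) @[t --> (0 : R)^'] --> h 0.
  have ch' : h t @[t --> (0 : R)^'] --> h 0 by apply: cvg_within_filter; exact: ch.
  apply: cvg_trans ch'; apply: near_eq_cvg; near=> t.
  have t0 : t != 0 by near: t; exact: nbhs_dnbhs_neq.
  rewrite /= addr0 -[t *: 1]/(t * 1) mulr1 [f t]fE addrC addKr.
  by rewrite scalerA mulVf // scale1r.
have df : differentiable f (0 : R) by apply/derivable1_diffP; apply/cvg_ex; exists (h 0).
by split=> //; rewrite -deriveE // /derive; exact: cvg_lim c.
Unshelve. all: by end_near. Qed.

(** * Tangent vectors of the orbit space *)

Section OrbitPaths.
Context {R : realType} (n k : nat).
Hypotheses (hk : (0 < k)%N) (hn : (k * 2 <= n)%N).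
Local Notation m := (k * 2)%N.
Local Notation pi := (orbit_proj (circle R k)).
Local Notation ychart := (chart (@orbit_fstruct R n _ (circle R k)) (dimY n k)).
Implicit Types (phi psi : ychart) (u v w : stiefel R n m) (X : 'M[R]_(n, m)).

(** The Cayley transform of $W$ begins with $1+2W$, so the factor [t / 2] gives the curve the
    velocity [X] at 0. *)
Definition path v X (t : R) : stiefel R n m :=
  stiefel_of v (cay ((t / 2) *: sk (\val v) X) *m \val v).

Let skewZ v X (t : R) : tang (\val v) X ->
  ((t / 2) *: sk (\val v) X)^T = - ((t / 2) *: sk (\val v) X).
Proof. by move=> tX; rewrite trZ sk_skew // scalerN. Qed.

Lemma pathE v X t : tang (\val v) X ->
  \val (path v X t) = cay ((t / 2) *: sk (\val v) X) *m \val v.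
Proof.
by move=> tX; apply/stiefel_ofE/cay_stiefel; [exact: stiefelP|exact: skewZ].
Qed.

(** The difference quotient of the curve in closed form, from $(1-W)^{-1}(1+W)=1+(1-W)^{-1}\,2W$. *)
Definition path_slope v X (t : R) : 'M[R]_(n, m) :=
  invmx (1%:M - (t / 2) *: sk (\val v) X) *m (sk (\val v) X *m \val v).

Lemma path_slopeE v X t : tang (\val v) X ->
  \val (path v X t) = \val v + t *: path_slope v X t.
Proof.
move=> tX; rewrite pathE // /path_slope; have := skewZ t tX.
set W := _ *: sk _ _ => sW; have uW := skew_unit sW.
rewrite /cay; have -> : 1%:M + W = (1%:M - W) + t *: sk (\val v) X.
  rewrite /W; apply/matrixP => i j; rewrite !(mxDE, mxNE, mxZE); by field.
by rewrite mulmxDr mulVmx // mulmxDl mul1mx -scalemxAr -scalemxAl mulmxA.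
Qed.

Lemma path_slope0 v X : tang (\val v) X -> path_slope v X 0 = X.
Proof.
move=> tX; rewrite /path_slope mul0r scale0r subr0 invmx1 mul1mx sk_mul //.
exact: stiefelP.
Qed.

Lemma path0 v X : tang (\val v) X -> \val (path v X 0) = \val v.
Proof. by move=> tX; rewrite path_slopeE // scale0r addr0. Qed.

Lemma path_slope_continuous v X t : tang (\val v) X ->
  {for t, continuous (path_slope v X)}.
Proof.
move=> tX; have oT : open [set: R] := openT.
have s : smooth_mx [set: R] (path_slope v X).
  apply: smooth_mxM => //; last exact: smooth_mx_cst.
  apply: smooth_mxV => //.
    by move=> z _; rewrite -unitfE -unitmxE; apply/skew_unit/skewZ.
  apply: smooth_mxB => //; first exact: smooth_mx_cst.
  apply: smooth_mxZ => //; last exact: smooth_mx_cst.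
  by apply: smoothM => //; [exact: smooth_id|exact: smooth_cst].
exact: smooth_mx_continuous s I.
Qed.

Lemma path_continuous v X t : tang (\val v) X -> {for t, continuous (path v X)}.
Proof.
move=> tX; apply: stiefel_continuous.
have E : (fun t => \val v + t *: path_slope v X t) =1 (fun t => \val (path v X t)).
  by move=> z; rewrite path_slopeE.
apply: (continuous_fun_ext E).
apply: continuous_addmx; first exact: continuous_cstmx.
by apply: continuous_scalemx; [exact: cvg_id|exact: path_slope_continuous].
Qed.

Lemma path_diff v X : tang (\val v) X ->
  differentiable (fun t => \val (path v X t)) (0 : R) /\
  'd (fun t => \val (path v X t)) (0 : R) 1 = X.
Proof.
move=> tX; rewrite -[in RHS](path_slope0 tX); apply: slope_diff.
  by move=> t; rewrite path0 // path_slopeE.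
exact: path_slope_continuous.
Qed.

Lemma path_near v X (P : set (Y R n k)) : tang (\val v) X -> open P -> P (pi v) ->
  \forall t \near (0 : R), P (pi (path v X t)).
Proof.
move=> tX oP Pv.
have vE : path v X 0 = v by apply: val_inj; exact: path0.
have := orbit_near oP Pv; rewrite -{1}vE => H.
exact: (path_continuous (t := 0) tX H).
Qed.

Lemma path_near_val v X (P : set 'M[R]_(n, m)) : tang (\val v) X -> open P -> P (\val v) ->
  \forall t \near (0 : R), P (\val (path v X t)).
Proof.
move=> tX oP Pv; have [d _] := path_diff tX.
have c := differentiable_continuous d.
apply: c; rewrite path0 //; exact: open_nbhs_nbhs.
Qed.

Definition chart_deriv phi v X : 'rV[R]_(dimY n k) :=
  'd (fun t : R => phi (pi (path v X t))) (0 : R) 1.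

(** Rotating [v] and [X] together leaves [sk] unchanged, because it contains them only in products
    $AA'^T$ in which the rotation cancels. The two curves are thus rotated copies of each other. *)
Lemma path_orbit v w X r : tang (\val v) X -> SO2 r ->
  \val w = \val v *m diag_circle k r ->
  forall t, pi (path w (X *m diag_circle k r) t) = pi (path v X t).
Proof.
move=> tX rS wE t; have DD := @diag_orthr R k _ rS.
have skE : sk (\val w) (X *m diag_circle k r) = sk (\val v) X.
  have K p q (A : 'M[R]_(p, m)) (A' : 'M[R]_(q, m)) :
      A *m diag_circle k r *m (A' *m diag_circle k r)^T = A *m A'^T.
    by rewrite trmx_mul mulmxA -(mulmxA A) DD mulmx1.
  have S (u Z : 'M[R]_(n, m)) : u *m (u^T *m Z) *m u^T = u *m u^T *m (Z *m u^T).
    by rewrite !mulmxA.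
  by rewrite /sk !S wE !K.
have tXw : tang (\val w) (X *m diag_circle k r).
  rewrite /tang wE !trmx_mul -!mulmxA -mulmxDr (mulmxA (\val v)^T) (mulmxA X^T).
  by rewrite -mulmxDl tX mul0mx mulmx0.
apply/esym/orbit_projP; exists (diag_circle k r); first by exists r.
by rewrite !pathE // skE wE mulmxA.
Qed.

Lemma chart_deriv_equiv phi v w X r : tang (\val v) X -> SO2 r ->
  \val w = \val v *m diag_circle k r ->
  chart_deriv phi w (X *m diag_circle k r) = chart_deriv phi v X.
Proof.
move=> tX rS wE.
have E : (fun t : R => phi (pi (path w (X *m diag_circle k r) t))) =
    (fun t => phi (pi (path v X t))).
  by apply/funext => t; rewrite (path_orbit tX rS wE).
exact: (congr1 (fun f : R -> 'rV[R]_(dimY n k) => 'd f (0 : R) 1) E).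
Qed.

(** Makes a chart the restriction of a smooth map on matrices, so that its derivative along curves
    is a differential in [X]. This is why it is linear in [X], although the curves are not, and
    continuous in [v]. *)
Lemma chart_extension phi v : chart_dom phi (pi v) -> exists W F,
  [/\ open W, W (\val v), @smooth_mx R _ W 1 (dimY n k) F &
      forall u, chart_dom phi (pi u) -> W (\val u) -> F (\val u) = phi (pi u)].
Proof.
move=> vphi; have oD := @chart_dom_open _ _ _ _ phi.
have C j := @chart_coord_smooth _ _ _ _ phi _ j oD (fun _ => id).
have /choice[W HW] j : exists W, exists F, [/\ open W, W (\val v), smooth W F &
    forall u, chart_dom phi (pi u) -> W (\val u) -> F (\val u) = phi (pi u) 0 j].
  exact: C j v vphi.
have /choice[F {}HW] j := HW j.
pose W0 := [set z | forall j, W j z].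
exists W0, (fun z => \row_j F j z); split.
- rewrite openE => z Wz.
  have nz j : nbhs z (W j) by have [oW _ _ _] := HW j; apply: open_nbhs_nbhs.
  exact: (@filter_forall _ _ W (nbhs z) _ nz).
- by move=> j; have [] := HW j.
- move=> i j; have [_ _ sF _] := HW j.
  have -> : (fun z => (\row_j F j z) i j) = F j by apply/funext => z; rewrite mxE.
  by apply: smooth_sub sF => z; apply.
- move=> u uphi Wu; apply/rowP => j; rewrite mxE.
  by have [_ _ _] := HW j; apply.
Qed.

Lemma chart_deriv_ext phi (W : set 'M[R]_(n, m)) (F : 'M[R]_(n, m) -> 'rV[R]_(dimY n k)) v X :
  open W -> W (\val v) -> smooth_mx W F ->
  (forall u, chart_dom phi (pi u) -> W (\val u) -> F (\val u) = phi (pi u)) ->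
  chart_dom phi (pi v) -> tang (\val v) X ->
  differentiable (fun t : R => phi (pi (path v X t))) (0 : R) /\
  chart_deriv phi v X = 'd F (\val v) X.
Proof.
move=> oW Wv sF FE vphi tX.
have [dp dpE] := path_diff tX.
have dF : differentiable F (\val (path v X 0)).
  by rewrite path0 //; exact: smooth_mx_differentiable sF Wv.
have dc := differentiable_comp dp dF.
have near_eq : \forall t \near (0 : R),
    (F \o (fun t => \val (path v X t))) t = phi (pi (path v X t)).
  apply: filterS2 (path_near tX (@chart_dom_open _ _ _ _ phi) vphi)
    (path_near_val tX oW Wv) => t Ht1 Ht2.
  exact: FE.
have [d dE] := diff_near_eq near_eq dc.
split; first exact: d.
apply: etrans (congr1 (@^~ 1) dE) _.
apply: etrans (congr1 (@^~ 1) (diff_comp dp dF)) _.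
exact: (etrans (congr1 ('d F (\val (path v X 0))) dpE)
  (congr1 (fun z => 'd F z X) (path0 tX))).
Qed.

Lemma chart_deriv_diff phi v X : chart_dom phi (pi v) -> tang (\val v) X ->
  differentiable (fun t : R => phi (pi (path v X t))) (0 : R).
Proof.
move=> vphi tX; have [W [F [oW Wv sF FE]]] := chart_extension vphi.
by have [] := chart_deriv_ext oW Wv sF FE vphi tX.
Qed.

Lemma chart_deriv_linear phi v a X X' : chart_dom phi (pi v) ->
  tang (\val v) X -> tang (\val v) X' -> tang (\val v) (a *: X + X') ->
  chart_deriv phi v (a *: X + X') = a *: chart_deriv phi v X + chart_deriv phi v X'.
Proof.
move=> vphi tX tX' tXX; have [W [F [oW Wv sF FE]]] := chart_extension vphi.
have E Z (tZ : tang (\val v) Z) := (chart_deriv_ext oW Wv sF FE vphi tZ).2.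
by rewrite !E // linearP.
Qed.

Lemma chart_deriv_trans phi psi v X : chart_dom phi (pi v) -> chart_dom psi (pi v) ->
  tang (\val v) X ->
  chart_deriv phi v X = 'd (transition phi psi) (psi (pi v)) (chart_deriv psi v X).
Proof.
move=> vphi vpsi tX; have dpsi := chart_deriv_diff vpsi tX.
have E0 : psi (pi (path v X 0)) = psi (pi v).
  by congr (psi (pi _)); apply: val_inj; exact: path0.
have dt : differentiable (transition phi psi) (psi (pi (path v X 0))).
  by rewrite E0; exact: transition_diff.
have near_eq : \forall t \near (0 : R),
    (transition phi psi \o (fun t => psi (pi (path v X t)))) t = phi (pi (path v X t)).
  apply: filterS (path_near tX (@chart_dom_open _ _ _ _ psi) vpsi) => t Ht.
  by rewrite /transition /= chartK.
have [_ dE] := diff_near_eq near_eq (differentiable_comp dpsi dt).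
apply: etrans (congr1 (@^~ 1) dE) _.
apply: etrans (congr1 (@^~ 1) (diff_comp dpsi dt)) _.
exact: (congr1 (fun z => 'd (transition phi psi) z (chart_deriv psi v X)) E0).
Qed.

Lemma chart_deriv_continuous phi v (X : stiefel R n m -> 'M[R]_(n, m)) :
  chart_dom phi (pi v) -> {for v, continuous X} ->
  (\forall u \near v, tang (\val u) (X u)) ->
  {for v, continuous (fun u => chart_deriv phi u (X u))}.
Proof.
move=> vphi cX tX; have [W [F [oW Wv sF FE]]] := chart_extension vphi.
have cv := @val_continuous R n m v.
apply: (continuous_near_eq (f := fun u => 'd F (\val u) (X u))).
  have nW : \forall u \near v, W (\val u) by apply: cv; exact: open_nbhs_nbhs.
  have nphi := orbit_near (@chart_dom_open _ _ _ _ phi) vphi.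
  near=> u.
  have Wu : W (\val u) by near: u.
  have uphi : chart_dom phi (pi u) by near: u.
  have tu : tang (\val u) (X u) by near: u.
  by have [_ ->] := chart_deriv_ext oW Wu sF FE uphi tu.
apply: (continuous_near_eq
    (f := fun u => \sum_i \sum_j X u i j *:
      (\row_l 'd (fun z => F z 0 l) (\val u) (delta_mx i j)))).
  have nW : \forall u \near v, W (\val u) by apply: cv; exact: open_nbhs_nbhs.
  apply: filterS nW => u Wu; have dF := smooth_mx_differentiable sF Wu.
  rewrite [in RHS](matrix_sum_delta (X u)) linear_sum; apply: eq_bigr => i _.
  rewrite linear_sum; apply: eq_bigr => j _; rewrite linearZ; congr (_ *: _).
  by apply/rowP => l; rewrite mxE diff_mxE.
have /mx_continuousP cX' := cX.
apply: continuous_summx => i _; apply: continuous_summx => j _.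
apply: continuous_scalemx; first exact: cX'.
apply/mx_continuousP => a l.
apply: (continuous_fun_ext (f := fun u => 'd (fun z => F z 0 l) (\val u) (delta_mx i j))).
  by move=> u; rewrite mxE.
apply: (@continuous_comp _ _ _ (fun u : stiefel R n m => \val u)
  (fun z => 'd (fun z => F z 0 l) z (delta_mx i j))); first exact: cv.
have sd := @smooth_diff _ _ _ _ (delta_mx i j : 'M[R]_(n, m)) (sF 0 l).
exact: (smooth_continuous sd Wv).
Unshelve. all: by end_near. Qed.

End OrbitPaths.

(** * Matrices commuting with all $E_{ab}\otimes1$ *)

Section Commutant.
Context {R : realType} (k : nat).
Hypothesis hk : (0 < k)%N.
Local Notation m := (k * 2)%N.

(** Commuting with every $E_{ab}\otimes1$ forces $A=1\otimes B$. Skewness makes $B$ a multiple of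
    [rot90], and [hJ A] is $k$ times that multiple. *)
Lemma commutant_eq0 (A : 'M[R]_m) : A^T = - A ->
  (forall a b, A *m emb a b 1%:M = emb a b 1%:M *m A) -> hJ A = 0 -> A = 0.
Proof.
move=> sA cA hA.
have E (a b c : 'I_k) : blk c a A = (c == a)%:R *: blk b b A.
  have := congr1 (blk c b) (cA a b); rewrite /blk /emb !mulmx1 => H.
  have H1 : sel c *m (A *m ((sel a)^T *m sel b)) *m (sel b)^T = blk c a A.
    by rewrite /blk -!mulmxA sel_selT eqxx mulmx1.
  apply: etrans (esym H1) _; rewrite H.
  by rewrite !mulmxA sel_selT mul_scalar_mx -!scalemxAl.
have B0 a : blk a a A = 0.
  have B10 : blk a a A 1 0 = 0.
    move: hA; rewrite /hJ (eq_bigr (fun=> blk a a A 1 0)) => [|j _]; last first.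
      by rewrite (E j a j) eqxx scale1r.
    rewrite sumr_const card_ord => /eqP; rewrite mulrn_eq0 -leqn0 leqNgt hk /=.
    by move=> /eqP.
  have sB : (blk a a A)^T = - blk a a A.
    by rewrite /blk !trmx_mul trmxK sA mulNmx mulmxN mulmxA.
  have /matrixP sB' := sB.
  apply/mx2P; have := sB' 0 0; have := sB' 1 1; have := sB' 0 1;
    rewrite !(mxTE, mxNE, mx0E); lra.
apply: sel_eq0 => j; apply: trmx_inj; rewrite trmx0; apply: sel_eq0 => i.
apply: trmx_inj; rewrite trmx0 trmx_mul trmxK trmxK mulmxA -/(blk i j A).
by rewrite (E j j i) B0 scaler0.
Qed.

End Commutant.

(** * Tangent vectors in arbitrary charts and the first isomorphism *)

Section TangentIso.
Context {R : realType} (n k : nat).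
Hypotheses (hk : (0 < k)%N) (hn : (k * 2 <= n)%N).
Local Notation m := (k * 2)%N.
Local Notation pi := (orbit_proj (circle R k)).
Local Notation ychart := (chart (@orbit_fstruct R n _ (circle R k)) (dimY n k)).
Implicit Types (phi psi : ychart) (u v w : stiefel R n m) (X : 'M[R]_(n, m)).

Lemma chart_deriv_fun phi v X (f : Y R n k -> R) : orbit_fstruct (chart_dom phi) f ->
  chart_dom phi (pi v) -> tang (\val v) X ->
  'd (fun t : R => f (pi (path v X t))) (0 : R) 1 =
  'd (f \o chart_inv phi) (phi (pi v)) (chart_deriv phi v X).
Proof.
move=> Cf vphi tX; have dphi := chart_deriv_diff vphi tX.
have oD := @chart_dom_open _ _ _ _ phi.
have sf := (chart_smooth _ oD (fun _ => id)).1 Cf.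
have E0 : phi (pi (path v X 0)) = phi (pi v).
  by congr (phi (pi _)); apply: val_inj; exact: path0.
have df : differentiable (f \o chart_inv phi) (phi (pi (path v X 0))).
  by rewrite E0; apply: smooth_differentiable sf _; exists (pi v).
have near_eq : \forall t \near (0 : R),
    ((f \o chart_inv phi) \o (fun t => phi (pi (path v X t)))) t = f (pi (path v X t)).
  by apply: filterS (path_near tX oD vphi) => t Ht; rewrite /= chartK.
have [_ dE] := diff_near_eq near_eq (differentiable_comp dphi df).
apply: etrans (congr1 (@^~ 1) dE) _.
apply: etrans (congr1 (@^~ 1) (diff_comp dphi df)) _.
exact: (congr1 (fun z => 'd (f \o chart_inv phi) z (chart_deriv phi v X)) E0).
Qed.

(* If Q commutes with the circle, then v Q v^T is invariant; the entries of these
   matrices are smooth functions on the orbit space which separate its tangent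
   vectors. *)
Definition orbit_form (Q : 'M[R]_m) i j (y : Y R n k) : R :=
  (\val (repr y) *m Q *m (\val (repr y))^T) i j.

Section Forms.
Variable Q : 'M[R]_m.
Hypothesis QD : forall r, SO2 r -> diag_circle k r *m Q *m (diag_circle k r)^T = Q.

Lemma orbit_formE i j u : orbit_form Q i j (pi u) = (\val u *m Q *m (\val u)^T) i j.
Proof.
have /orbit_projP[_ [r rS <-] E] : pi u = pi (repr (pi u)) by rewrite orbit_projK.
rewrite /orbit_form E trmx_mul -!mulmxA (mulmxA (diag_circle k r)).
by rewrite (mulmxA (_ *m Q)) QD // !mulmxA.
Qed.

Lemma orbit_form_smooth i j (W : set (Y R n k)) : orbit_fstruct W (orbit_form Q i j).
Proof.
move=> u _; exists setT, (fun z : 'M[R]_(n, m) => (z *m Q *m z^T) i j); split=> //.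
- exact: openT.
- have oT := @openT 'M[R]_(n, m).
  have si := @smooth_mx_id R n m setT.
  have sq := smooth_mxM oT (smooth_mxM oT si (smooth_mx_cst setT Q)) (smooth_mxT oT si).
  exact: sq i j.
- by move=> w _ _; rewrite /= orbit_formE.
Qed.

Lemma orbit_form_deriv i j v X : tang (\val v) X ->
  'd (fun t : R => orbit_form Q i j (pi (path v X t))) (0 : R) 1 =
  (X *m Q *m (\val v)^T + \val v *m Q *m X^T) i j.
Proof.
move=> tX; pose h t := path_slope v X t.
(* This is the slope of $zQz^T$ along $z=v+t\,h(t)$, collected from the terms of first and second
   order in $t$. *)
pose g t := h t *m Q *m (\val v)^T + \val v *m Q *m (h t)^T + t *: (h t *m Q *m (h t)^T).
have ch : {for 0, continuous h} by exact: path_slope_continuous.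
have cg : {for 0, continuous g}.
  have cc p q (M : 'M[R]_(p, q)) : {for (0 : R), continuous (fun _ : R => M)}.
    exact: continuous_cstmx.
  have chQ := continuous_mulmx ch (cc _ _ Q).
  have chT := continuous_trmx ch.
  apply: continuous_addmx; last first.
    by apply: continuous_scalemx; [exact: cvg_id|exact: continuous_mulmx].
  apply: continuous_addmx; first exact: (continuous_mulmx chQ (cc _ _ _)).
  exact: (continuous_mulmx (cc _ _ _) chT).
have /mx_continuousP/(_ i j) cgij := cg.
have g0 : g 0 = X *m Q *m (\val v)^T + \val v *m Q *m X^T.
  by rewrite /g scale0r addr0 /h path_slope0.
rewrite -g0; apply: (slope_diff (h := fun t => g t i j) _ cgij).2 => t.
rewrite !orbit_formE path0 // path_slopeE // -/(h t) /g; move: (h t) => z.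
rewrite trD trZ !mulmxDl !mulmxDr -!scalemxAl -!scalemxAr.
rewrite !(mxDE, mxZE); set a := (_ *m _ *m _) i j; set b := (_ *m _ *m _) i j.
set c := (_ *m _ *m _) i j; set e := (_ *m _ *m _) i j.
change (a + t * b + (t * c + t * (t * e)) = a + t * (c + b + t * e)).
by ring.
Qed.

End Forms.

(** If [phi] does not see [X], all invariant functions $vQv^T$ have zero derivative:
    $XQv^T+vQX^T=0$. Multiplying by $v$ gives $XQ=vQA$ with $A=v^TX$. For $Q=E_{ab}\otimes1$ this
    makes $A$ commute with every $Q$, so $A=0$ by horizontality; then $XQ=0$ for the diagonal $Q$,
    which together cover all columns of $X$. *)
Lemma chart_deriv_inj phi v X : chart_dom phi (pi v) -> horizontal (\val v) X ->
  chart_deriv phi v X = 0 -> X = 0.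
Proof.
move=> vphi [tX hX] D0; have vv := stiefelP v.
set A := (\val v)^T *m X.
have XQ a b : X *m emb a b 1%:M = \val v *m (emb a b 1%:M *m A).
  have QD r : SO2 r ->
      diag_circle k r *m emb a b 1%:M *m (diag_circle k r)^T = emb a b 1%:M :> 'M[R]_m.
    move=> rS; rewrite -[X in X *m _ *m _]trmxK diag_circleT emb_diag.
    by rewrite mulmx1 trmxK SO2_orthr.
  have H : X *m emb a b 1%:M *m (\val v)^T + \val v *m emb a b 1%:M *m X^T = 0.
    apply/matrixP => i j; rewrite -(orbit_form_deriv QD i j tX).
    have sQ : orbit_fstruct (chart_dom phi) (orbit_form (emb a b 1%:M) i j).
      exact: orbit_form_smooth.
    rewrite (chart_deriv_fun sQ vphi tX) D0.
    by rewrite linear0 mx0E.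
  have := congr1 (mulmx^~ (\val v)) H; rewrite /= mulmxDl mul0mx -mulmxA vv mulmx1.
  rewrite -[_ *m X^T *m _]mulmxA (tangE tX) mulmxN => /eqP; rewrite subr_eq0 => /eqP ->.
  by rewrite mulmxA.
have A0 : A = 0.
  apply: (commutant_eq0 hk) hX; first by rewrite /A trmx_mul trmxK (tangE tX).
  by move=> a b; rewrite /A -mulmxA XQ mulmxA vv mul1mx.
apply: sel_eq0 => j; have := congr1 (mulmx^~ (sel j)^T) (XQ j j).
rewrite /= A0 !mulmx0 mul0mx /emb mulmx1 -!mulmxA sel_selT eqxx mulmx1.
by [].
Qed.

Lemma TY_is_vbundle : is_vbundle (TY R n k).
Proof.
apply: tangent_bundle_is_vbundle => y.
by rewrite -(orbit_projK y); exact: chart_exists.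
Qed.

Lemma lin_algpart : linear (@algpart R n k hk).
Proof.
have lu := @lin_usub R (multdim 'C(k, 2) (2 * 2) + multdim k (2 * n)) (multdim (k - 1) 1).
apply: lin_add; last by apply: (lin_comp (@lin_dia R k hk)); exact: lin_dsub.
by apply: (lin_comp (@lin_skw R k hk)); apply: (lin_comp (@lin_usub R _ _)); exact: lu.
Qed.

Lemma theta_continuous v (w : stiefel R n m -> 'cV[R]_(ambient1 n k)) :
  {for v, continuous w} -> {for v, continuous (fun u => theta hk (\val u) (w u))}.
Proof.
move=> cw; apply: continuous_addmx.
  by apply: continuous_mulmx; [exact: val_continuous|exact: (continuous_linmx lin_algpart cw)].
have lh : linear (fun x : 'cV[R]_(ambient1 n k) => hor (dsubmx (usubmx x)) : 'M[R]_(n, m)).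
  apply: (lin_comp (@lin_hor R n k)); apply: (lin_comp (@lin_dsub R _ _)).
  exact: (@lin_usub R (multdim 'C(k, 2) (2 * 2) + multdim k (2 * n)) (multdim (k - 1) 1)).
exact: (continuous_linmx lh cw).
Qed.

Local Notation fr := (rhs1_framing (R := R) hk hn).

Lemma theta_frame_horizontal v (j : vidx (@rhs1 R n k)) x : vdom j (pi v) ->
  horizontal (\val v) (theta hk (\val v) (frm fr v j *m x)).
Proof.
move=> Ej; apply: (theta_horizontal hk (stiefelP v)) => l lk.
exact: rhs1_image.
Qed.

Definition TY_matrix v phi (j : vidx (@rhs1 R n k)) :
    'M[R]_(vrank (TY R n k), vrank (@rhs1 R n k)) :=
  mxof (fun x => (chart_deriv phi v (theta hk (\val v) (frm fr v j *m x)))^T).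

Lemma TY_matrixE v phi (j : vidx (@rhs1 R n k)) x :
  chart_dom phi (pi v) -> vdom j (pi v) ->
  TY_matrix v phi j *m x = (chart_deriv phi v (theta hk (\val v) (frm fr v j *m x)))^T.
Proof.
move=> vphi Ej; rewrite /TY_matrix mxofE //.
have tT z : tang (\val v) (theta hk (\val v) (frm fr v j *m z)).
  by have [] := theta_frame_horizontal z Ej.
apply: lin_tr => a z z'; have := tT (a *: z + z').
rewrite mulmxDr -scalemxAr lin_theta => tl.
exact: chart_deriv_linear.
Qed.

Lemma TY_matrix_orbit v w phi (j : vidx (@rhs1 R n k)) : vdom j (pi v) -> pi v = pi w ->
  TY_matrix v phi j = TY_matrix w phi j.
Proof.
move=> Ej vw; have [rS wE] := rotmP hk vw.
have E x : chart_deriv phi v (theta hk (\val v) (frm fr v j *m x)) =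
    chart_deriv phi w (theta hk (\val w) (frm fr w j *m x)).
  have [tX _] := theta_frame_horizontal x Ej.
  apply: etrans (esym (chart_deriv_equiv phi tX rS wE)) _.
  apply: (congr1 (chart_deriv phi w)).
  by rewrite -(theta_equiv hk rS) -wE (frm_equiv fr Ej vw) mulmxA.
apply/matrixP => a b; rewrite /TY_matrix [LHS]mxE [RHS]mxE.
exact: (congr1 (fun z : 'rV[R]_(dimY n k) => z^T a 0) (E _)).
Qed.

Lemma TY_matrix_trans phi phi' (j j' : vidx (@rhs1 R n k)) v :
  chart_dom phi (pi v) -> chart_dom phi' (pi v) -> vdom j (pi v) -> vdom j' (pi v) ->
  TY_matrix v phi' j' =
  @vtrans _ _ (TY R n k) phi' phi (pi v) *m TY_matrix v phi j *m vtrans j j' (pi v).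
Proof.
move=> vphi vphi' Ej Ej'; apply: cV_eqmx => x.
have assoc p q r s (V : 'M[R]_(p, q)) (M : 'M[R]_(q, r)) (T : 'M[R]_(r, s)) (z : 'cV[R]_s) :
  V *m (M *m (T *m z)) = V *m M *m T *m z by rewrite !mulmxA.
pose X := theta hk (\val v) (frm fr v j' *m x^T).
have tX : tang (\val v) X by have [] := theta_frame_horizontal x^T Ej'.
have FE : frm fr v j *m (vtrans j j' (pi v) *m x^T) = frm fr v j' *m x^T.
  by rewrite mulmxA (frm_trans fr Ej Ej').
have ME : TY_matrix v phi j *m (vtrans j j' (pi v) *m x^T) = (chart_deriv phi v X)^T :=
  etrans (TY_matrixE _ vphi Ej)
    (congr1 (fun z => (chart_deriv phi v (theta hk (\val v) z))^T) FE).
apply: etrans (TY_matrixE _ vphi' Ej') _.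
apply: etrans (congr1 trmx (chart_deriv_trans vphi' vphi tX)) _.
apply: etrans (esym (vtrans_transition phi' phi (pi v) (chart_deriv phi v X))) _.
apply: etrans (congr1 (mulmx _) (esym ME)) _.
exact: assoc.
Qed.

Lemma rhs1_iso_TY : bundle_iso (@rhs1 R n k) (TY R n k).
Proof.
refine (@bundle_iso_glue R n _ (circle R k) (@rhs1 R n k) (TY R n k) TY_matrix
  (frm_vbundle fr) TY_is_vbundle
  (@rank_dimY R n k hk hn) _ _ _ _).
- move=> phi j v vphi Ej; apply: continuous_mxof => x; apply: continuous_trmx.
  apply: chart_deriv_continuous => //.
    apply: theta_continuous; apply: continuous_mulmx; last exact: continuous_cstmx.
    exact: frm_continuous.
  have [oE _ _ _ _] := frm_vbundle fr.
  apply: filterS (orbit_near (oE j) Ej) => u Eu.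
  by have [] := theta_frame_horizontal x Eu.
- by move=> phi j v w _; exact: TY_matrix_orbit.
- exact: TY_matrix_trans.
- move=> phi j v x vphi Ej; rewrite TY_matrixE // => D0.
  have hT := theta_frame_horizontal x Ej.
  have T0 := chart_deriv_inj vphi hT (trmx_inj (etrans D0 (esym (trmx0 _ _ _)))).
  have F0 : frm fr v j *m x = 0.
    by apply: (theta_inj (stiefelP v)) T0 => l lk; exact: rhs1_image.
  by rewrite -[x]mul1mx -(frm_orth fr Ej) -mulmxA F0 mulmx0.
Qed.

End TangentIso.

Theorem theorem3p1 (R : realType) (n k : nat) (hk : (1 <= k)%N)
    (hn : (2 * k <= n)%N) :
  bundle_iso (TY R n k)
    (whitney
      (whitney
        (multiple 'C(k, 2) (tensor (zeta_r R n k) (zeta_r R n k)))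
        (multiple k
          (tensor (zeta_r R n k) (pullback (@q R n k) (xi_last R n k)))))
      (multiple (k - 1) (epsilon R n k))) /\
  bundle_iso
    (whitney (TY R n k)
      (multiple 'C(k.+1, 2) (tensor (zeta_r R n k) (zeta_r R n k))))
    (whitney (multiple (n * k) (zeta_r R n k))
      (multiple (k - 1) (epsilon R n k))).
Proof.
have kn : (k * 2 <= n)%N by rewrite mulnC.
have iso1 : bundle_iso (TY R n k) (@rhs1 R n k).
  exact: bundle_iso_sym (@rhs1_iso_TY R n k hk kn).
split; first exact: iso1.
(* The first isomorphism, summed with the added copies of the tensor square, replaces [TY] by its
   model. *)
apply: bundle_iso_trans (@rhs1c_iso_rhs2 R n k hk kn); apply: whitney_isol iso1.
exact: frm_vbundle (multiple_framing (zz_framing n hk) 'C(k.+1, 2)).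
Qed.
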